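(* For every $f\in L^1(\mathbb{R})$, $$\lim_{N\to\infty}\int_{\mathbb{R}}\mathcal{T}_N(E)f(E)\,\mathrm{d}E=\int_{\mathbb{R}}\mathcal{T}_\infty(E)f(E)\,\mathrm{d}E,$$ where $\mathcal{T}_N$ is the transmittance of the $N$-fold repeated sample and $\mathcal{T}_\infty$ is the crystalline transmittance, both defined in the context.
   Context: **Sample and crystal.** Let $L\ge1$ be an integer, $\{J_x\}_{1\le x<L}$ non-zero real numbers, $\{\lambda_x\}_{1\le x\le L}$ real numbers (the parameters of the sample Jacobi matrix), and $\kappa_{\mathcal S}\neq0$ a real number. Set $J_L=\kappa_{\mathcal S}$ and extend to $\mathbb{Z}$ by $J_{x+nL}=J_x$, $\lambda_{x+nL}=\lambda_x$. Let $h_{\rm crystal}$ be the periodic Jacobi matrix on $\ell^2(\mathbb{Z})$, $(h_{\rm crystal}u)(x)=J_xu(x+1)+J_{x-1}u(x-1)+\lambda_xu(x)$, and $\mathrm{sp}(h_{\rm crystal})$ its spectrum. For a positive integer $N$ let $h_{\mathcal S}^{(N)}$ be the restriction of $h_{\rm crystal}$ to $\ell^2([1,NL]\cap\mathbb{Z})$ with Dirichlet boundary conditions $u(0)=u(NL+1)=0$. **Reservoirs.** Let $\nu_l,\nu_r$ be Borel probability measures on $\mathbb{R}$. For $a\in\{l,r\}$ let $\mathfrak{h}_a=L^2(\mathbb{R},\mathrm{d}\nu_a)$, $h_a$ the operator of multiplication by the variable $E$ on $\mathfrak h_a$, and $\chi_a\in\mathfrak{h}_a$ the constant function $1$. Put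 $F_a(E)=\langle\chi_a,(h_a-E-\mathrm{i}0)^{-1}\chi_a\rangle$ (boundary value, existing for Lebesgue a.e. $E\in\mathbb{R}$) and $\Sigma_a=\{E\in\mathbb{R}\mid \mathrm{Im}\,F_a(E)>0\}$. The reservoirs and the coupling strength $\kappa\in\mathbb{R}\setminus\{0\}$ do not depend on $N$. **Coupled system.** On $\mathfrak{h}_l\oplus\ell^2([1,NL]\cap\mathbb{Z})\oplus\mathfrak{h}_r$ let $$h^{(N)}=h_l\oplus h_{\mathcal S}^{(N)}\oplus h_r+\kappa\sum_{a\in\{l,r\}}\big(|\chi_a\rangle\langle\psi_a|+|\psi_a\rangle\langle\chi_a|\big),\qquad \psi_l=\delta_1,\ \psi_r=\delta_{NL}.$$ Standing assumption: for every $N$, $h^{(N)}$ has no singular continuous spectrum. The transmittance of the $N$-fold repeated sample is, for Lebesgue a.e. $E\in\mathbb{R}$, $$\mathcal{T}_N(E)=4\kappa^4|\langle\psi_l,(h^{(N)}-E-\mathrm{i}0)^{-1}\psi_r\rangle|^2\,\mathrm{Im}\,F_l(E)\,\mathrm{Im}\,F_r(E).$$ **Crystalline transmittance.** Let $h_{\rm crystal}^{(l)}$ and $h_{\rm crystal}^{(r)}$ be the restrictions of $h_{\rm crystal}$ to $\ell^2((-\infty,0]\cap\mathbb{Z})$ and $\ell^2([1,\infty)\cap\mathbb{Z})$ with Dirichlet boundary conditions, and $m_l(E)=\langle\delta_0,(h_{\rm crystal}^{(l)}-E-\mathrm{i}0)^{-1}\delta_0\rangle$, $m_r(E)=\langle\delta_1,(h_{\rm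 crystal}^{(r)}-E-\mathrm{i}0)^{-1}\delta_1\rangle$ the Weyl $m$-functions; one has $\mathrm{Im}\,m_{l/r}(E)>0$ for Lebesgue a.e. $E\in\mathrm{sp}(h_{\rm crystal})$. Set $\mathcal{T}_\infty(E)=0$ for $E\in\mathbb{R}\setminus(\mathrm{sp}(h_{\rm crystal})\cap\Sigma_l\cap\Sigma_r)$ and, for $E\in\mathrm{sp}(h_{\rm crystal})\cap\Sigma_l\cap\Sigma_r$, $$\mathcal{T}_\infty(E)=\left[1+\frac14\left(\frac{|\kappa_{\mathcal S}^2m_r(E)-\kappa^2F_r(E)|^2}{\mathrm{Im}(\kappa_{\mathcal S}^2m_r(E))\,\mathrm{Im}(\kappa^2F_r(E))}+\frac{|\kappa_{\mathcal S}^2m_l(E)-\kappa^2F_l(E)|^2}{\mathrm{Im}(\kappa_{\mathcal S}^2m_l(E))\,\mathrm{Im}(\kappa^2F_l(E))}\right)\right]^{-1}$$ (defined Lebesgue a.e.). *)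

(* Defs.v *)
From HB Require Import structures.
From mathcomp Require Import all_boot all_order all_algebra.
From mathcomp Require Import all_classical all_reals all_analysis.
From mathcomp Require Export complex.

Set Implicit Arguments.
Unset Strict Implicit.
Unset Printing Implicit Defensive.

Import Order.TTheory GRing.Theory Num.Theory.
Import numFieldNormedType.Exports.

Local Open Scope classical_set_scope.
Local Open Scope ring_scope.
Local Open Scope complex_scope.

(* R[i]^o is R[i] with the topology of its modulus; the library puts no
   topology on R[i] itself. *)
Notation cplx R := (R[i]^o).

HB.instance Definition _ := isPointed.Build int 0.
HB.instance Definition _ := @isMeasurable.Build default_measure_display
  int discrete_measurable discrete_measurable0
  discrete_measurableC discrete_measurableU.

Section ComplexIntegral.
Context (d : measure_display) (T : measurableType d) (R : realType).
Variable mu : {measure set T -> \bar R}.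

Definition cmeasurable (f : T -> R[i]) : Prop :=
  measurable_fun setT (fun x => complex.Re (f x)) /\
  measurable_fun setT (fun x => complex.Im (f x)).

Definition cintegrable (f : T -> R[i]) : Prop :=
  mu.-integrable setT (fun x => (complex.Re (f x))%:E) /\
  mu.-integrable setT (fun x => (complex.Im (f x))%:E).

Definition cintegral (f : T -> R[i]) : R[i] :=
  (\int[mu]_x complex.Re (f x)) +i* (\int[mu]_x complex.Im (f x)).

End ComplexIntegral.

Section HilbertSpaces.
Context (R : realType).

(* A Hilbert space is presented by representatives: its vectors are the
   elements of the linear space [hcar] satisfying [hmem], and two of them are
   the same vector when [heqv] holds (almost everywhere equality for L^2).
   The inner product is antilinear in its first argument. *)
Record hilbert := Hilbert {
  hcar :> lmodType R[i];
  hmem : set hcar;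
  heqv : hcar -> hcar -> Prop;
  hip : hcar -> hcar -> R[i] }.

Definition hnorm (H : hilbert) (u : H) : R :=
  Num.sqrt (complex.Re (hip u u)).

Definition L2 (d : measure_display) (T : measurableType d)
    (mu : {measure set T -> \bar R}) : hilbert :=
  @Hilbert (T -> R[i])
    [set u | cmeasurable u /\
             (\int[mu]_x ((Normc.normc (u x)) ^+ 2)%:E < +oo)%E]
    (fun u v => {ae mu, forall x, u x = v x})
    (fun u v => cintegral mu (fun x => (u x)^* * v x)).

(* l^2(D) for D a set of integers, as the functions in l^2(Z) that vanish
   outside D. *)
Definition ell2 (D : set int) : hilbert :=
  let H := L2 (counting : {measure set int -> \bar R}) in
  @Hilbert (int -> R[i])
    [set u | hmem (h := H) u /\ forall x, ~ D x -> u x = 0]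
    (@heqv H) (@hip H).

Definition hsum (H K : hilbert) : hilbert :=
  @Hilbert (H * K)%type
    [set w | hmem w.1 /\ hmem w.2]
    (fun w w' => heqv w.1 w'.1 /\ heqv w.2 w'.2)
    (fun w w' => hip w.1 w'.1 + hip w.2 w'.2).

(* A possibly unbounded linear operator: [oact] is meaningful on [odom] only. *)
Record oper (H : hilbert) := Oper {
  odom : set H;
  oact : H -> H }.

Definition oper_sum (H K : hilbert) (A : oper H) (B : oper K) :
    oper (hsum H K) :=
  @Oper (hsum H K)
    [set w | odom A w.1 /\ odom B w.2]
    (fun w => (oact A w.1, oact B w.2)).

Definition oper_perturb (H : hilbert) (A : oper H) (V : H -> H) : oper H :=
  @Oper H (odom A) (fun u => oact A u + V u).

(* |a><b| *)
Definition ketbra (H : hilbert) (a b : H) : H -> H := fun u => hip b u *: a.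

(* (A - z)^-1 v, with the value 0 when A - z does not reach v. *)
Definition resolvent (H : hilbert) (A : oper H) (z : R[i]) (v : H) : H :=
  xget 0 [set u | odom A u /\ heqv (oact A u - z *: u) v].

(* <a, (A - z)^-1 b> *)
Definition green (H : hilbert) (A : oper H) (a b : H) (z : R[i]) : R[i] :=
  hip a (resolvent A z b).

(* A - z is a bijection from the domain onto H with bounded inverse. *)
Definition resolvent_set (H : hilbert) (A : oper H) : set R[i] :=
  [set z |
    (forall u, odom A u -> heqv (oact A u - z *: u) 0 -> heqv u 0) /\
    exists M : R, forall v, hmem v ->
      exists2 u, odom A u &
        heqv (oact A u - z *: u) v /\ hnorm u <= M * hnorm v].

Definition spectrum (H : hilbert) (A : oper H) : set R[i] :=
  ~` resolvent_set A.

(* The spectral measure of a self-adjoint A for the vector v, determined by its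
   Borel transform. *)
Definition is_spectral_measure (H : hilbert) (A : oper H) (v : H)
    (mu : {finite_measure set (measurableTypeR R) -> \bar R}) : Prop :=
  forall z : R[i], complex.Im z != 0 ->
    green A v v z = cintegral mu (fun x : R => (x%:C - z)^-1).

Definition singular_continuous
    (mu : {measure set (measurableTypeR R) -> \bar R}) : Prop :=
  (forall x : R, mu [set x] = 0%E) /\
  exists S : set (measurableTypeR R),
    [/\ measurable S, lebesgue_measure S = 0%E & mu (~` S) = 0%E].

(* The singular continuous subspace, made of the vectors with singular
   continuous spectral measure, is trivial. *)
Definition no_sc_spectrum (H : hilbert) (A : oper H) : Prop :=
  forall (v : H) (mu : {finite_measure set (measurableTypeR R) -> \bar R}),
    hmem v -> is_spectral_measure A v mu -> singular_continuous mu ->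
    heqv v 0.

(* G(E + i0) *)
Definition boundary_value (G : R[i] -> R[i]) (E : R) : R[i] :=
  lim ((G (E +i* eps) : cplx R) @[eps --> (0 : R)^'+]).

End HilbertSpaces.

Section Crystal.
Context (R : realType).
Variables (L : nat) (J lam : int -> R) (kS : R).

(* The representative of x modulo L in {1, ..., L}. *)
Definition cell_site (x : int) : int := ((x - 1) %% L%:Z)%Z + 1.

Definition crystal_J (x : int) : R :=
  if cell_site x == L%:Z then kS else J (cell_site x).

Definition crystal_lam (x : int) : R := lam (cell_site x).

(* The restriction of the crystal Jacobi matrix to l^2(D); the boundary
   condition is Dirichlet because the vectors of l^2(D) vanish outside D. *)
Definition h_crystal (D : set int) : oper (ell2 R D) :=
  @Oper R (ell2 R D) (@hmem R (ell2 R D))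
    (fun (u : int -> R[i]) (x : int) =>
      if `[< D x >] then
        (crystal_J x)%:C * u (x + 1) + (crystal_J (x - 1))%:C * u (x - 1)
        + (crystal_lam x)%:C * u x
      else 0).

Definition delta (x : int) : int -> R[i] := fun y => (y == x)%:R.

Definition sp_crystal : set R :=
  [set E | spectrum (h_crystal setT) E%:C].

Definition weyl_l : R -> R[i] :=
  let D := [set x : int | x <= 0] in
  boundary_value (green (h_crystal D) (delta 0) (delta 0)).

Definition weyl_r : R -> R[i] :=
  let D := [set x : int | 1 <= x] in
  boundary_value (green (h_crystal D) (delta 1) (delta 1)).

End Crystal.

Section Reservoir.
Context (R : realType) (nu : probability (measurableTypeR R) R).

Definition h_res : oper (L2 nu) :=
  let mulE (u : R -> R[i]) : R -> R[i] := fun x => x%:C * u x in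
  @Oper R (L2 nu)
    [set u | @hmem R (L2 nu) u /\ @hmem R (L2 nu) (mulE u)] mulE.

Definition chi : L2 nu := fun _ : R => 1.

Definition F_res : R -> R[i] := boundary_value (green h_res chi chi).

Definition Sigma_res : set R := [set E | 0 < complex.Im (F_res E)].

End Reservoir.

Section Transmittance.
Context (R : realType).
Variables (L : nat) (J lam : int -> R) (kS : R).
Variables (nul nur : probability (measurableTypeR R) R) (kap : R).

Definition box (N : nat) : set int := [set x | 1 <= x <= (N * L)%:Z].

Definition coupled_space (N : nat) : hilbert R :=
  hsum (hsum (L2 nul) (ell2 R (box N))) (L2 nur).

Definition chi_l (N : nat) : coupled_space N := (chi nul, 0, 0).
Definition chi_r (N : nat) : coupled_space N := (0, 0, chi nur).
Definition psi_l (N : nat) : coupled_space N := (0, delta R 1, 0).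
Definition psi_r (N : nat) : coupled_space N := (0, delta R (N * L)%:Z, 0).

Definition h_coupled (N : nat) : oper (coupled_space N) :=
  oper_perturb
    (oper_sum (oper_sum (h_res nul) (h_crystal L J lam kS (box N)))
              (h_res nur))
    (fun u => kap%:C *:
      (ketbra (chi_l N) (psi_l N) u + ketbra (psi_l N) (chi_l N) u
       + (ketbra (chi_r N) (psi_r N) u + ketbra (psi_r N) (chi_r N) u))).

Definition transmittance (N : nat) (E : R) : R :=
  4 * kap ^+ 4
  * Normc.normc (boundary_value (green (h_coupled N) (psi_l N) (psi_r N)) E) ^+ 2
  * complex.Im (F_res nul E) * complex.Im (F_res nur E).

Definition crystal_transmittance (E : R) : R :=
  let ml := (kS ^+ 2)%:C * weyl_l L J lam kS E in
  let mr := (kS ^+ 2)%:C * weyl_r L J lam kS E in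
  let Fl := (kap ^+ 2)%:C * F_res nul E in
  let Fr := (kap ^+ 2)%:C * F_res nur E in
  if `[< (sp_crystal L J lam kS `&` Sigma_res nul `&` Sigma_res nur) E >] then
    (1 + 4^-1 *
      (Normc.normc (mr - Fr) ^+ 2 / (complex.Im mr * complex.Im Fr)
       + Normc.normc (ml - Fl) ^+ 2 / (complex.Im ml * complex.Im Fl)))^-1
  else 0.

End Transmittance.

(* Main.v *)
Require Import Defs.
From mathcomp Require Import all_boot all_order all_algebra.
From mathcomp Require Import all_classical all_reals all_analysis.
From mathcomp Require Import measurable_realfun.
From mathcomp Require Import ring lra zify.
Import Order.TTheory GRing.Theory Num.Theory.
Import numFieldNormedType.Exports.
Local Open Scope classical_set_scope.
Local Open Scope ring_scope.
Local Open Scope complex_scope.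

Set Implicit Arguments.
Unset Strict Implicit.
Unset Printing Implicit Defensive.

(** Both transmittances have explicit expressions in terms of the monodromy
matrix T(E) of one cell, and for these the limit is an averaging statement.

Write f_l, f_r for kap^2 F_l, kap^2 F_r. Eliminating the reservoirs turns them
into boundary conditions at the two ends of the sample, and the equation inside
the sample is solved by transfer matrices of determinant 1. The Green function
between the ends is -1/d_N, where d_N = (1, f_r) T(E)^N (kS, - f_l/kS)^T
[green_box], so that T_N = 4 Im f_l Im f_r / |d_N|^2 [transmittanceE]. By
Cayley-Hamilton d_{N+2} = D d_{N+1} - d_N, where the discriminant D = tr T(E) is
a real polynomial in E of degree L. Conservation of the current at real energy
gives 4 Im f_l Im f_r <= |d_N|^2 [den_lower_bound], hence 0 <= T_N <= 1, which
is the domination used throughout. At an energy where the boundary value of F_l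
or F_r does not exist, it has the default value 0, so both transmittances are 0
there, as they are wherever Im F_l or Im F_r vanishes.

If D^2 > 4, then |d_N| grows exponentially, so T_N tends to 0 [escape]. Such an
energy has exponentially decaying Bloch solutions at both ends, from which the
resolvent is built: E is not in the spectrum and T_oo = 0 [notin_spectrum].

If D^2 < 4, a bounded Bloch solution shows that E is in the spectrum
[in_spectrum]. Write D = 2 cos theta. Then d_N = X cos N theta + Y sin N theta,
and 1/|d_N|^2 is 1/|Im (conj X Y)| times the Poisson kernel at a point
w e^{2 i N theta} with |w| < 1 [disc_point_spec]. The Poisson kernel has mean 1
over the phase, so the limit should be 4 Im f_l Im f_r / |Im (conj X Y)|. This
is the crystalline transmittance [crystal_formula]: kS^2 m_r is the root in the
upper half-plane of the quadratic fixed-point equation of T(E), kS^2 m_l is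
determined by the same equation [weyl_limits], and inserting them gives an
algebraic identity [flux_identity].

The integrals converge because theta(E) has a nonzero derivative inside the
bands except at finitely many energies: the harmonics e^{2 i k N theta} tend
weakly to 0 for k <> 0 [phase_vanish], and where |w| <= r < 1 finitely many
harmonics approximate the Poisson kernel uniformly [poisson_average]. The
energies with D^2 = 4 or D' = 0 form a finite set. *)

Local Notation normc := (@Normc.normc _).
Local Notation Re := (@complex.Re _).
Local Notation Im := (@complex.Im _).

(** * Complex numbers through their real and imaginary parts *)

Section ComplexToolkit.
Variable R : realType.
Implicit Types z w : R[i].

Lemma ReD z w : Re (z + w) = Re z + Re w. Proof. by case: z; case: w. Qed.
Lemma ImD z w : Im (z + w) = Im z + Im w. Proof. by case: z; case: w. Qed.
Lemma ReN z : Re (- z) = - Re z. Proof. by case: z. Qed.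
Lemma ImN z : Im (- z) = - Im z. Proof. by case: z. Qed.
Lemma ReM z w : Re (z * w) = Re z * Re w - Im z * Im w.
Proof. by case: z; case: w. Qed.
Lemma ImM z w : Im (z * w) = Re z * Im w + Im z * Re w.
Proof. by case: z; case: w => a b c d /=; rewrite mulrC. Qed.
Lemma ReJ z : Re z^* = Re z. Proof. by case: z. Qed.
Lemma ImJ z : Im z^* = - Im z. Proof. by case: z. Qed.
Lemma ReC (x : R) : Re x%:C = x. Proof. by []. Qed.
Lemma ImC (x : R) : Im x%:C = 0. Proof. by []. Qed.

Definition ReImE := (ReD, ImD, ReN, ImN, ReM, ImM, ReJ, ImJ, ReC, ImC).

Lemma Im_div_normc z w : w != 0 -> (normc w ^+ 2) * Im (z / w) = Im (z * conjc w).
Proof.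
move=> w0; have n0 : normc w ^+ 2 != 0.
  by apply: contra_neq w0 => /eqP; rewrite expf_eq0 /= => /eqP/Normc.eq0_normc.
case: w n0 {w0} => a b; case: z => c d; rewrite /= sqr_sqrtr ?addr_ge0 ?sqr_ge0// => n0.
by field.
Qed.

Lemma complex_eq z w : Re z = Re w -> Im z = Im w -> z = w.
Proof. by case: z; case: w => a b c d /= -> ->. Qed.

Lemma normc_ge0 z : 0 <= normc z. Proof. by case: z => a b; apply: sqrtr_ge0. Qed.

Lemma normc_sq z : normc z ^+ 2 = Re z ^+ 2 + Im z ^+ 2.
Proof. by case: z => a b /=; rewrite sqr_sqrtr ?addr_ge0 ?sqr_ge0. Qed.

Lemma normc_eq0 z : (normc z == 0) = (z == 0).
Proof.
apply/eqP/eqP => [/Normc.eq0_normc//|->]; exact: Normc.normc0.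
Qed.

Lemma normc_gt0 z : (0 < normc z) = (z != 0).
Proof. by rewrite lt_def normc_eq0 normc_ge0 andbT. Qed.

Lemma normcM z w : normc (z * w) = normc z * normc w.
Proof. exact: Normc.normcM. Qed.

Lemma normcX z n : normc (z ^+ n) = normc z ^+ n.
Proof. by elim: n => [|n IH]; rewrite ?expr0 ?Normc.normc1// !exprS normcM IH. Qed.

Lemma normcXz z (n : int) : normc (z ^ n) = normc z ^ n.
Proof.
case: n => n; first by rewrite -!exprnP normcX.
by rewrite /exprz Normc.normcV normcX.
Qed.

Lemma normcN z : normc (- z) = normc z. Proof. by case: z => a b /=; rewrite !sqrrN. Qed.

Lemma normcJ z : normc z^* = normc z. Proof. by case: z => a b /=; rewrite !sqrrN. Qed.

Lemma normcR (x : R) : normc x%:C = `|x|.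
Proof. by rewrite /= expr0n addr0 sqrtr_sqr. Qed.

Lemma normcD z w : normc (z + w) <= normc z + normc w.
Proof. exact: (@le_normcD R z w). Qed.

Lemma normcB z w : normc (z - w) <= normc z + normc w.
Proof. by rewrite -(normcN w); exact: normcD. Qed.

Lemma normc_distC z w : normc (z - w) = normc (w - z).
Proof. by rewrite -normcN opprB. Qed.

Lemma normc_Re z : `|Re z| <= normc z.
Proof. by rewrite -sqrtr_sqr; case: z => a b /=; rewrite ler_sqrt ?addr_ge0 ?sqr_ge0// lerDl sqr_ge0. Qed.

Lemma normc_Im z : `|Im z| <= normc z.
Proof. by rewrite -sqrtr_sqr; case: z => a b /=; rewrite ler_sqrt ?addr_ge0 ?sqr_ge0// lerDr sqr_ge0. Qed.

Lemma normc_le z : normc z <= `|Re z| + `|Im z|.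
Proof.
case: z => a b; have -> : a +i* b = a%:C + b%:C * 'i%C by simpc.
apply: le_trans (normcD _ _) _; rewrite normcM !normcR/=.
by rewrite expr0n expr1n add0r sqrtr1 mulr1 add0r !mulr0 !mulr1 subr0 !addr0.
Qed.

Lemma complex_normE z : `|z| = (normc z)%:C. Proof. by []. Qed.

Section Cvg.
Context (T : Type) (F : set_system T) {FF : Filter F}.
Implicit Types (f : T -> R[i]).

Lemma cvg_complexE f (l : R[i]) :
  (f x : cplx R) @[x --> F] --> (l : cplx R) <->
  (normc (f x - l)) @[x --> F] --> 0.
Proof.
split => [/cvgrPdist_lt h|/cvgrPdist_lt h]; apply/cvgrPdist_lt.
  move=> e e0; have := h e%:C; rewrite ltcR => /(_ e0).
  apply: filterS => x; rewrite complex_normE ltcR normc_distC.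
  by rewrite sub0r normrN ger0_norm ?normc_ge0.
move=> [e e']; rewrite ltcE/= => /andP[/eqP -> e0].
apply: filterS (h e e0) => x; rewrite sub0r normrN ger0_norm ?normc_ge0//.
by rewrite complex_normE normc_distC => he; rewrite ltcE/= eqxx.
Qed.

Lemma cvg_Re f l : (f x : cplx R) @[x --> F] --> (l : cplx R) ->
  Re (f x) @[x --> F] --> Re l.
Proof.
move=> /cvg_complexE/cvgrPdist_lt h; apply/cvgrPdist_lt => e e0.
apply: filterS (h e e0) => x; rewrite sub0r normrN ger0_norm ?normc_ge0//.
by apply: le_lt_trans; rewrite -ReN -ReD normc_distC; apply: normc_Re.
Qed.

Lemma cvg_Im f l : (f x : cplx R) @[x --> F] --> (l : cplx R) ->
  Im (f x) @[x --> F] --> Im l.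
Proof.
move=> /cvg_complexE/cvgrPdist_lt h; apply/cvgrPdist_lt => e e0.
apply: filterS (h e e0) => x; rewrite sub0r normrN ger0_norm ?normc_ge0//.
by apply: le_lt_trans; rewrite -ImN -ImD normc_distC; apply: normc_Im.
Qed.

Lemma cvg_ReIm f l : Re (f x) @[x --> F] --> Re l -> Im (f x) @[x --> F] --> Im l ->
  (f x : cplx R) @[x --> F] --> (l : cplx R).
Proof.
move=> hr hi; apply/cvg_complexE.
apply: (@squeeze_cvgr _ _ _ _ (cst 0) (fun x => `|Re l - Re (f x)| + `|Im l - Im (f x)|)).
- apply: nearW => x; rewrite normc_ge0/=.
  by rewrite normc_distC (le_trans (normc_le _))// !ReImE.
- exact: cvg_cst.
- rewrite -[0]addr0; apply: cvgD.
    rewrite -(normr0 R) -(subrr (Re l)); apply: cvg_norm.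
    by apply: cvgB => //; exact: cvg_cst.
  rewrite -(normr0 R) -(subrr (Im l)); apply: cvg_norm.
  by apply: cvgB => //; exact: cvg_cst.
Qed.

Lemma cvg_cD f g a b : (f x : cplx R) @[x --> F] --> (a : cplx R) ->
  (g x : cplx R) @[x --> F] --> (b : cplx R) ->
  (f x + g x : cplx R) @[x --> F] --> (a + b : cplx R).
Proof. exact: cvgD. Qed.

Lemma cvg_cN f a : (f x : cplx R) @[x --> F] --> (a : cplx R) ->
  (- f x : cplx R) @[x --> F] --> (- a : cplx R).
Proof. exact: cvgN. Qed.

Lemma cvg_cM f g a b : (f x : cplx R) @[x --> F] --> (a : cplx R) ->
  (g x : cplx R) @[x --> F] --> (b : cplx R) ->
  (f x * g x : cplx R) @[x --> F] --> (a * b : cplx R).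
Proof.
move=> fa gb; apply: cvg_ReIm.
  rewrite ReM (_ : (fun x => Re (f x * g x)) = (fun x => Re (f x) * Re (g x) - Im (f x) * Im (g x))).
    by apply: cvgB; apply: cvgM; rewrite ?cvg_Re ?cvg_Im//;
      (exact: cvg_Re fa || exact: cvg_Re gb || exact: cvg_Im fa || exact: cvg_Im gb).
  by apply/funext => x; rewrite ReM.
rewrite ImM (_ : (fun x => Im (f x * g x)) = (fun x => Re (f x) * Im (g x) + Im (f x) * Re (g x))).
  by apply: cvgD; apply: cvgM;
    (exact: cvg_Re fa || exact: cvg_Re gb || exact: cvg_Im fa || exact: cvg_Im gb).
by apply/funext => x; rewrite ImM.
Qed.

Lemma cvg_normc f a : (f x : cplx R) @[x --> F] --> (a : cplx R) ->
  normc (f x) @[x --> F] --> normc a.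
Proof.
move=> /cvg_complexE/cvgrPdist_lt h; apply/cvgrPdist_lt => e e0.
apply: filterS (h e e0) => x; rewrite sub0r normrN ger0_norm ?normc_ge0//.
apply: le_lt_trans; rewrite ler_norml; apply/andP; split.
  by rewrite lerNl opprB lerBlDr -{1}(subrK a (f x)) normcD.
by rewrite lerBlDr normc_distC -{1}(subrK (f x) a) normcD.
Qed.

Lemma cvg_cV f a : a != 0 -> (f x : cplx R) @[x --> F] --> (a : cplx R) ->
  ((f x)^-1 : cplx R) @[x --> F] --> (a^-1 : cplx R).
Proof.
move=> a0 fa.
have nE z : z^-1 = (Re z / normc z ^+ 2) +i* (- Im z / normc z ^+ 2).
  by rewrite normc_sq; case: z => u v /=; rewrite mulNr.
have nf : (normc (f x) ^+ 2)^-1 @[x --> F] --> (normc a ^+ 2)^-1.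
  apply: cvgV; first by rewrite expf_eq0 /= normc_eq0.
  by rewrite expr2; under eq_fun do rewrite expr2; apply: cvgM; apply: cvg_normc.
apply: cvg_ReIm; rewrite nE /=.
  under eq_fun do rewrite nE /=.
  by apply: cvgM nf; apply: cvg_Re.
under eq_fun do rewrite nE /=.
by apply: cvgM nf; apply: cvgN; apply: cvg_Im.
Qed.

End Cvg.

Lemma boundary_valueE (G : R[i] -> R[i]) (E : R) (l : R[i]) :
  (G (E +i* eps) : cplx R) @[eps --> (0 : R)^'+] --> (l : cplx R) ->
  boundary_value G E = l.
Proof.
by move=> h; apply: (@cvg_lim (cplx R) (@norm_hausdorff _ (cplx R))).
Qed.

End ComplexToolkit.

(** * Transfer matrices *)

Section Transfer.
Variables (R : realType) (L : nat) (J lam : int -> R) (kS : R).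
Hypothesis hL : (1 <= L)%N.
Hypothesis hJ : forall x : int, 1 <= x < L%:Z -> J x != 0.
Hypothesis hkS : kS != 0.

Local Notation cJ := (crystal_J L J kS).
Local Notation cl := (crystal_lam L lam).

Lemma cell_siteDM (x n : int) : cell_site L (n * L%:Z + x) = cell_site L x.
Proof. by rewrite /cell_site -(addrA _ x) modzMDl. Qed.

Lemma crystal_JDM (x n : int) : cJ (n * L%:Z + x) = cJ x.
Proof. by rewrite /crystal_J cell_siteDM. Qed.

Lemma crystal_lamDM (x n : int) : cl (n * L%:Z + x) = cl x.
Proof. by rewrite /crystal_lam cell_siteDM. Qed.

Lemma crystal_J0 : cJ 0 = kS.
Proof.
rewrite /crystal_J /cell_site.
suff -> : ((0 - 1) %% L%:Z)%Z + 1 = L%:Z by rewrite eqxx.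
have -> : (0 - 1 : int) = (-1) * L%:Z + (L%:Z - 1) by lia.
by rewrite modzMDl modz_small ?subrK//; lia.
Qed.

Lemma crystal_J_neq0 (x : int) : cJ x != 0.
Proof.
rewrite /crystal_J; case: ifPn => // h; apply: hJ; move: h; rewrite /cell_site.
have := modz_ge0 (x - 1) (d := L%:Z); have := ltz_pmod (x - 1) (d := L%:Z).
by lia.
Qed.

Section Generic.
Variables (A : comNzRingType) (phi : {rmorphism R -> A}).

(** The state at site n is the pair (J_n u(n+1), u(n)). Carrying the factor J_n
in the first entry gives each one-site matrix, hence every product of them,
determinant 1. The energy z lives in an arbitrary R-algebra: R[i] serves for
solving the eigenvalue equation, {poly R} for the dependence on the energy. *)
Fixpoint transfer (z : A) (n : nat) (v : A * A) : A * A :=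
  if n is m.+1 then
    let w := transfer z m v in
    ((z - phi (cl m.+1%:Z)) * phi (cJ m%:Z)^-1 * w.1 - phi (cJ m%:Z) * w.2,
     phi (cJ m%:Z)^-1 * w.1)
  else v.

Definition tr11 z n := (transfer z n (1, 0)).1.
Definition tr21 z n := (transfer z n (1, 0)).2.
Definition tr12 z n := (transfer z n (0, 1)).1.
Definition tr22 z n := (transfer z n (0, 1)).2.

Lemma phiJV (x : int) : phi (cJ x) * phi (cJ x)^-1 = 1.
Proof. by rewrite -rmorphM mulfV ?crystal_J_neq0// rmorph1. Qed.

Lemma transferE z n v : transfer z n v =
  (tr11 z n * v.1 + tr12 z n * v.2, tr21 z n * v.1 + tr22 z n * v.2).
Proof.
rewrite /tr11 /tr12 /tr21 /tr22.
elim: n => [|n IHn] /=; first by rewrite !mul1r !mul0r add0r addr0; case: v.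
by rewrite IHn /=; congr pair; ring.
Qed.

Lemma transfer_det z n : tr11 z n * tr22 z n - tr12 z n * tr21 z n = 1.
Proof.
rewrite /tr11 /tr12 /tr21 /tr22.
elim: n => [|n IHn] /=; first by ring.
move: IHn (phiJV n); set a := transfer _ _ _; set b := transfer _ _ _.
set j := phi (cJ _); set i := phi _^-1 => IHn ji.
rewrite -[RHS]IHn -[RHS]mul1r -ji; ring.
Qed.

Lemma transferDM z n q v :
  transfer z (q * L + n) v = transfer z n (transfer z (q * L) v).
Proof.
elim: n => [|n IHn]; first by rewrite addn0.
rewrite addnS /= IHn.
have e k : (q * L + k)%N%:Z = q%:Z * L%:Z + k%:Z by lia.
by rewrite -addnS !e crystal_JDM crystal_lamDM.
Qed.

Lemma transferM z q v : transfer z (q * L) v = iter q (transfer z L) v.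
Proof.
elim: q v => // q IHq v; rewrite mulSn addnC transferDM IHq.
by [].
Qed.

Lemma transfer_sol z n (u : nat -> A) :
  (forall k, (k < n)%N -> phi (cJ k.+1%:Z) * u k.+2 + phi (cJ k%:Z) * u k
    + phi (cl k.+1%:Z) * u k.+1 = z * u k.+1) ->
  transfer z n (phi kS * u 1%N, u 0%N) = (phi (cJ n%:Z) * u n.+1, u n).
Proof.
elim: n => [|n IHn] hu /=; first by rewrite crystal_J0.
rewrite IHn /=; last by move=> k kn; apply: hu; rewrite ltnS ltnW.
have hn := hu n (ltnSn n).
congr pair.
  have -> : phi (cJ n.+1) * u n.+2 = z * u n.+1 - phi (cJ n) * u n - phi (cl n.+1) * u n.+1.
    by rewrite -hn; ring.
  rewrite -[u n.+1 in RHS]mul1r -(phiJV n); ring.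
by rewrite mulrA (mulrC (phi _)) phiJV mul1r.
Qed.

Lemma transfer1 z n v :
  phi (cJ n%:Z) * (transfer z n.+1 v).2 = (transfer z n v).1.
Proof. by rewrite /= mulrA phiJV mul1r. Qed.

Lemma transfer_rec z n v (u := fun k => (transfer z k v).2) :
  phi (cJ n.+1%:Z) * u n.+2 + phi (cJ n%:Z) * u n
    + phi (cl n.+1%:Z) * u n.+1 = z * u n.+1.
Proof. by rewrite /u transfer1 /=; ring. Qed.

End Generic.

Lemma transfer_morph (A B : comNzRingType) (phi : {rmorphism R -> A})
    (psi : {rmorphism R -> B}) (f : {rmorphism A -> B}) z n v :
  (forall x, f (phi x) = psi x) ->
  transfer psi (f z) n (f v.1, f v.2) =
  (f (transfer phi z n v).1, f (transfer phi z n v).2).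
Proof.
move=> e; elim: n => //= n ->/=.
by rewrite rmorphB !rmorphM rmorphB !e.
Qed.

End Transfer.

(** * The discriminant *)

Section Discriminant.
Variables (R : realType) (L : nat) (J lam : int -> R) (kS : R).
Hypothesis hL : (1 <= L)%N.
Hypothesis hJ : forall x : int, 1 <= x < L%:Z -> J x != 0.
Hypothesis hkS : kS != 0.

Local Notation cJ := (crystal_J L J kS).
Local Notation cl := (crystal_lam L lam).

(** The discriminant of Floquet theory: the bands of the crystal are where it lies
between -2 and 2. *)
Definition discr : {poly R} :=
  tr11 L J lam kS polyC 'X L + tr22 L J lam kS polyC 'X L.

Local Notation T11 := (tr11 L J lam kS polyC 'X).
Local Notation T12 := (tr12 L J lam kS polyC 'X).
Local Notation T21 := (tr21 L J lam kS polyC 'X).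
Local Notation T22 := (tr22 L J lam kS polyC 'X).

Lemma size_tr1 n : size (T11 n) = n.+1 /\ (size (T21 n) <= n)%N.
Proof.
rewrite /tr11 /tr21; elim: n => [|n [IH1 IH2]] /=.
  by rewrite size_poly1 size_poly0.
set a := transfer _ _ _ _ _ _ _ _ in IH1 IH2 *.
have Jn0 : (cJ n%:Z)^-1 != 0 by rewrite invr_eq0 crystal_J_neq0.
split; last by rewrite size_Cmul// IH1.
have e : size (('X - (cl n.+1%:Z)%:P) * (cJ n%:Z)^-1%:P * a.1) = n.+2.
  rewrite -mulrA mulrC size_Mmonic ?monicXsubC// ?size_XsubC.
    by rewrite size_Cmul// IH1 addn2.
  by rewrite -size_poly_gt0 size_Cmul// IH1.
rewrite size_polyDl e// size_polyN size_Cmul ?crystal_J_neq0//.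
by rewrite ltnS (leq_trans IH2).
Qed.

Lemma size_tr2 n : (size (T12 n) <= n)%N /\ (size (T22 n.+1) <= n)%N.
Proof.
have Jn0 k : (cJ k)^-1 != 0 by rewrite invr_eq0 crystal_J_neq0.
suff H : (size (T12 n) <= n)%N /\ (size (T22 n) <= n.-1.+1)%N.
  split; first by case: H.
  by rewrite /tr22 /= size_Cmul//; case: H.
rewrite /tr12 /tr22; elim: n => [|n [IH1 IH2]] /=.
  by rewrite size_poly1 size_poly0.
set a := transfer _ _ _ _ _ _ _ _ in IH1 IH2 *.
split; last by rewrite size_Cmul// (leq_trans IH1).
have e : (size (('X - (cl n.+1%:Z)%:P) * (cJ n%:Z)^-1%:P * a.1)%R <= n.+1)%N.
  rewrite -mulrA (leq_trans (size_polyMleq _ _))// size_XsubC/=.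
  by rewrite size_Cmul.
rewrite (leq_trans (size_polyD _ _))// geq_max e/= size_polyN.
rewrite size_Cmul ?crystal_J_neq0//.
by rewrite (leq_trans IH2)//; case: (n).
Qed.

(** Each site contributes one factor z - lambda with an invertible coefficient,
and only to the upper left entry. In particular the discriminant is not
constant, so that its critical points and the band edges are finite in number. *)
Lemma size_discr : size discr = L.+1.
Proof.
rewrite /discr; have [e1 _] := size_tr1 L.
have := (size_tr2 L.-1).2; rewrite (prednK hL) => e2.
by rewrite size_polyDl e1// ltnS (leq_trans e2)// leq_pred.
Qed.

End Discriminant.

(** * Bloch solutions *)

Section Bloch.
Variables (R : realType) (L : nat) (J lam : int -> R) (kS : R).
Hypothesis hL : (1 <= L)%N.
Hypothesis hJ : forall x : int, 1 <= x < L%:Z -> J x != 0.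
Hypothesis hkS : kS != 0.

Local Notation cJ := (crystal_J L J kS).
Local Notation cl := (crystal_lam L lam).

Section Generic.
Variables (A : fieldType) (phi : {rmorphism R -> A}).
Local Notation tr := (transfer L J lam kS phi).
Variables (z mu : A) (v : A * A).
Hypothesis mu0 : mu != 0.
Hypothesis hv : tr z L v = (mu * v.1, mu * v.2).

(** An eigenvector v of the monodromy is the initial state of a solution on all
of Z which is multiplied by mu from one cell to the next; extending by
euclidean division gives the negative sites without inverting the transfer
matrix. *)
Definition bloch (x : int) : A :=
  mu ^ (x %/ L%:Z)%Z * (tr z `|(x %% L%:Z)%Z|%N v).2.

Lemma transferZ c n w :
  tr z n (c * w.1, c * w.2) = (c * (tr z n w).1, c * (tr z n w).2).
Proof. by rewrite transferE (transferE _ _ _ _ _ _ _ w) /=; congr pair; ring. Qed.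

Lemma transfer_eigen q : tr z (q * L) v = (mu ^+ q * v.1, mu ^+ q * v.2).
Proof.
elim: q => [|q IHq]; first by rewrite mul0n /= !mul1r; case: v.
by rewrite mulSnr transferDM// IHq transferZ hv /= !mulrA -exprSr.
Qed.

Lemma blochE (n : int) k : bloch (n * L%:Z + k%:Z) = mu ^ n * (tr z k v).2.
Proof.
have Lz : L%:Z != 0 by lia.
have kL : (k %% L < L)%N by rewrite ltn_mod.
have -> : n * L%:Z + k%:Z = (n + (k %/ L)%N%:Z) * L%:Z + (k %% L)%N%:Z.
  by rewrite {1}(divn_eq k L); lia.
rewrite /bloch divzMDl// modzMDl divz_small ?modz_small; try lia.
rewrite addr0 absz_nat [in RHS](divn_eq k L) transferDM// transfer_eigen transferZ/=.
by rewrite expfzDr// mulrA.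
Qed.

Lemma int_cell (x : int) : exists n : int, exists k : nat,
  x = n * L%:Z + k.+1%:Z.
Proof.
exists ((x - 1) %/ L%:Z)%Z, `|((x - 1) %% L%:Z)%Z|%N.
have := divz_eq (x - 1) L%:Z; have := modz_ge0 (x - 1) (d := L%:Z); lia.
Qed.

Lemma bloch_rec x : phi (cJ x) * bloch (x + 1) + phi (cJ (x - 1)) * bloch (x - 1)
   + phi (cl x) * bloch x = z * bloch x.
Proof.
have [n [k ->]] := int_cell x.
rewrite -!addrA -!PoszD addn1.
have -> : k.+1%:Z - 1 = k%:Z by lia.
rewrite !blochE !crystal_JDM crystal_lamDM mulrCA (mulrCA z).
rewrite -(transfer_rec _ hL hJ hkS). ring.
Qed.

Lemma bloch_nat k : bloch k%:Z = (tr z k v).2.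
Proof. by have := blochE 0 k; rewrite mul0r add0r expr0z mul1r. Qed.

Lemma bloch1 : phi kS * bloch 1 = v.1.
Proof.
rewrite -[1]/(1%:Z) bloch_nat -[RHS](transfer1 lam hL hJ hkS phi z 0 v).
by rewrite crystal_J0.
Qed.

End Generic.
End Bloch.

(** * Square-summable functions on the integers *)

Section IntCounting.
Variable R : realType.
Local Notation cnt := (counting : {measure set int -> \bar R}).

Lemma measurable_fun_int d (U : measurableType d) (D : set int) (g : int -> U) :
  measurable_fun D g.
Proof. by move=> mD A mA. Qed.

Lemma counting_set1 (x : int) : cnt [set x] = 1%E.
Proof. by rewrite /= /counting asboolT// fset_set1 finmap.cardfs1. Qed.

Lemma integral_counting_set1 (x : int) (F : int -> R) :
  (\int[cnt]_(y in [set x]) (F y)%:E)%E = (F x)%:E.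
Proof.
rewrite (eq_integral (cst (F x)%:E)); last by move=> y; rewrite inE => ->.
by rewrite integral_cst ?counting_set1 ?mule1.
Qed.

Lemma integral_counting_supp (x : int) (F : int -> R) :
  (forall y, y != x -> F y = 0) -> (\int[cnt]_y (F y)%:E)%E = (F x)%:E.
Proof.
move=> F0; rewrite -(integral_counting_set1 x F) [RHS]integral_mkcond.
apply: eq_integral => y _; rewrite patchE; case: ifPn => //.
by rewrite notin_setE/= => /eqP/F0 ->.
Qed.

(** The windows -n, ..., n-1 exhaust Z, so a bound on all of these partial sums
bounds the sum over Z, and a translation of f changes them by two boundary
terms only. *)
Definition wsum (n : nat) (f : int -> R) := \sum_(k < n) (f k%:Z + f (Negz k)).

Lemma wsumS n f : wsum n.+1 f = wsum n f + (f n%:Z + f (Negz n)).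
Proof. by rewrite /wsum big_ord_recr. Qed.

Lemma wsum_ge0 n f : (forall x, 0 <= f x) -> 0 <= wsum n f.
Proof. by move=> f0; apply: sumr_ge0 => i _; rewrite addr_ge0. Qed.

Lemma le_wsum n f g : (forall x, f x <= g x) -> wsum n f <= wsum n g.
Proof. by move=> fg; apply: ler_sum => i _; rewrite lerD. Qed.

Lemma wsumD n f g : wsum n (fun x => f x + g x) = wsum n f + wsum n g.
Proof. by rewrite /wsum -big_split/=; apply: eq_bigr => i _; rewrite addrACA. Qed.

Lemma wsumZ n c f : wsum n (fun x => c * f x) = c * wsum n f.
Proof. by rewrite /wsum mulr_sumr; apply: eq_bigr => i _; rewrite mulrDr. Qed.

Lemma integral_counting (f : int -> R) : (forall x, 0 <= f x) ->
  (\int[cnt]_x (f x)%:E = \sum_(0 <= k <oo) (f k%:Z + f (Negz k))%:E)%E.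
Proof.
move=> f0.
have -> : [set: int] = \bigcup_k [set k%:Z; Negz k].
  apply/seteqP; split=> //; case=> n _; exists n => //=; [by left|by right].
rewrite ge0_integral_bigcup//.
- apply: eq_eseriesr => k _; rewrite ge0_integral_setU//.
  + by rewrite !integral_counting_set1.
  + by move=> x _; rewrite lee_fin.
  + by apply/disj_setPS => x [/= -> ].
- by move=> x _; rewrite lee_fin.
- by apply/trivIsetP => i j _ _ /eqP ij; apply/seteqP; split => // x [/= [->|->] []] // [].
Qed.

Lemma integral_counting_le (f : int -> R) (B : R) : (forall x, 0 <= f x) ->
  (forall n, wsum n f <= B) -> (\int[cnt]_x (f x)%:E <= B%:E)%E.
Proof.
move=> f0 fB; rewrite integral_counting//; apply: lime_le.
  by apply: is_cvg_nneseries => n _ _; rewrite lee_fin addr_ge0.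
by apply: nearW => n; rewrite sumEFin lee_fin big_mkord; exact: fB.
Qed.

Lemma wsum_le_integral (f : int -> R) n : (forall x, 0 <= f x) ->
  ((wsum n f)%:E <= \int[cnt]_x (f x)%:E)%E.
Proof.
move=> f0; rewrite integral_counting//.
have := @nneseries_lim_ge R (fun k : nat => (f k%:Z + f (Negz k))%:E) xpredT 0 n.
rewrite sumEFin big_mkord; apply => k _; by rewrite lee_fin addr_ge0.
Qed.

Lemma wsum_shift n f : wsum n (fun x => f (x - 1)) =
  wsum n f + f (- n%:Z - 1) - f (n%:Z - 1).
Proof.
elim: n => [|n IH]; first by rewrite /wsum !big_ord0 oppr0; ring.
rewrite !wsumS IH.
have -> : Negz n - 1 = - n.+1%:Z - 1 by lia.
have -> : Negz n = - n%:Z - 1 by lia.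
have -> : n.+1%:Z - 1 = n%:Z by lia.
ring.
Qed.

Lemma wsum_shiftD n f : wsum n (fun x => f (x + 1)) =
  wsum n f + f (n%:Z) - f (- n%:Z).
Proof.
elim: n => [|n IH]; first by rewrite /wsum !big_ord0 oppr0; ring.
rewrite !wsumS IH.
have -> : Negz n + 1 = - n%:Z by lia.
have -> : Negz n = - n.+1%:Z by lia.
have -> : n%:Z + 1 = n.+1%:Z by lia.
ring.
Qed.

Lemma wsum_opp n f : wsum n (fun x => f (- x)) =
  wsum n f + f (n%:Z) - f (- n%:Z).
Proof.
elim: n => [|n IH]; first by rewrite /wsum !big_ord0 oppr0; ring.
rewrite !wsumS IH.
have -> : - Negz n = n.+1%:Z by lia.
have -> : Negz n = - n.+1%:Z by lia.
ring.
Qed.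

Lemma wsum_le_total (f : int -> R) B x : (forall x, 0 <= f x) ->
  (forall n, wsum n f <= B) -> f x <= B.
Proof.
move=> f0 fB; case: x => n; apply: le_trans (fB n.+1); rewrite wsumS.
  by rewrite addrCA lerDl addr_ge0// wsum_ge0.
by rewrite addrA lerDr addr_ge0// wsum_ge0.
Qed.

Lemma wsum_oppD (f : int -> R) B : (forall x, 0 <= f x) ->
  (forall n, wsum n f <= B) -> forall n, wsum n (fun x => f (1 - x)) <= B.
Proof.
move=> f0 fB n.
have -> : (fun x => f (1 - x)) = (fun x => (fun y => f (y + 1)) (- x)).
  by apply/funext => x; rewrite addrC.
rewrite (wsum_opp n (fun y => f (y + 1))) wsum_shiftD.
apply: le_trans (fB n.+2); rewrite !wsumS.
have := f0 (- n%:Z); have := f0 (- n%:Z + 1); have := f0 (Negz n).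
have := f0 (Negz n.+1); rewrite (_ : n%:Z + 1 = n.+1%:Z); last lia.
lra.
Qed.

(** A point has counting measure 1, so no nonempty set is negligible. *)
Lemma counting_ae (P : int -> Prop) : {ae cnt, forall x, P x} -> forall x, P x.
Proof.
move=> [N [_ N0 sN]] x; apply: contrapT => Px.
have Nx : N x by apply: sN.
have : (cnt [set x] <= cnt N)%E by apply: le_measure; rewrite ?inE//; move=> y ->.
by rewrite counting_set1 N0 lee_fin ler10.
Qed.

Definition l2 (u : int -> R[i]) := @hmem R (L2 cnt) u.

Lemma l2P (u : int -> R[i]) B : (forall n, wsum n (fun x => normc (u x) ^+ 2) <= B) ->
  l2 u.
Proof.
move=> h; split; first by split; apply: measurable_fun_int.
apply: (@le_lt_trans _ _ B%:E); last by rewrite ltry.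
by apply: integral_counting_le => // x; rewrite sqr_ge0.
Qed.

Lemma l2_wsum (u : int -> R[i]) : l2 u ->
  forall n, wsum n (fun x => normc (u x) ^+ 2) <= fine (\int[cnt]_x (normc (u x) ^+ 2)%:E)%E.
Proof.
move=> [_ h] n; rewrite -lee_fin fineK.
  by apply: wsum_le_integral => x; rewrite sqr_ge0.
rewrite ge0_fin_numE//; apply: integral_ge0 => x _; by rewrite lee_fin sqr_ge0.
Qed.

Lemma hnorm_l2 (u : int -> R[i]) : @hnorm R (ell2 R setT) u =
  Num.sqrt (fine (\int[cnt]_x (normc (u x) ^+ 2)%:E)%E).
Proof.
rewrite /hnorm /=; congr (Num.sqrt (fine _)); apply: eq_integral => x _.
by rewrite normc_sq !ReImE; congr EFin; ring.
Qed.

Lemma l2_cvg0 (u : int -> R[i]) : l2 u ->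
  (normc (u n%:Z) @[n --> \oo] --> 0) /\ (normc (u (- n%:Z)) @[n --> \oo] --> 0).
Proof.
move=> lu; have h := l2_wsum lu.
set f := fun x => normc (u x) ^+ 2; pose g (n : nat) := f n%:Z + f (Negz n).
have f0 x : 0 <= f x by rewrite sqr_ge0.
have cg : cvgn (series g).
  apply: nondecreasing_is_cvgn.
    by apply: nondecreasing_series => n _ _; rewrite addr_ge0.
  exists (fine (\int[cnt]_x (normc (u x) ^+ 2)%:E)%E) => _ [n _ <-].
  by rewrite /series/= big_mkord; apply: h.
have g0 := cvg_series_cvg_0 cg.
have sq0 (v : nat -> R) : (forall n, 0 <= v n) -> v n ^+ 2 @[n --> \oo] --> 0 -> v n @[n --> \oo] --> 0.
  move=> v0 /cvgrPdist_lt h0; apply/cvgrPdist_lt => e e0.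
  have := h0 (e ^+ 2); rewrite exprn_gt0// => /(_ isT); apply: filterS => n.
  rewrite !sub0r !normrN ger0_norm ?sqr_ge0// ger0_norm//.
  by rewrite ltr_pXn2r// nnegrE ?v0// ltW.
split; apply: sq0 => [n|]; rewrite ?normc_ge0//.
  apply: (@squeeze_cvgr _ _ _ _ (cst 0) g) => //; last exact: cvg_cst.
  by apply: nearW => n; rewrite f0/= lerDl.
rewrite -(cvg_shiftS (fun n => normc (u (- n%:Z)) ^+ 2)) /=.
apply: (@squeeze_cvgr _ _ _ _ (cst 0) g) => //; last exact: cvg_cst.
by apply: nearW => n; rewrite sqr_ge0/= /g lerDr.
Qed.

End IntCounting.

(** * Contractive recursions on the integers *)

Section FirstOrder.
Variable R : realType.

(** The solution is s(x) = sum_k rho^k g(x - k). *)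
Lemma first_order_real (rho : R) (g : int -> R) (M : R) :
  0 <= rho < 1 -> (forall x, `|g x| <= M) ->
  exists s : int -> R, (forall x, s x = rho * s (x - 1) + g x) /\
    (forall x, `|s x| <= M / (1 - rho)).
Proof.
move=> /andP[r0 r1] gM.
pose t x (k : nat) := rho ^+ k * g (x - k%:Z).
have M0 : 0 <= M by apply: le_trans (normr_ge0 _) (gM 0).
have tM x k : `|t x k| <= geometric M rho k.
  rewrite /t /= normrM normrX (ger0_norm r0) mulrC.
  by rewrite ler_wpM2r ?exprn_ge0.
have rn : `|rho| < 1 by rewrite ger0_norm.
have cgeo := @is_cvg_geometric_series R M rho rn.
have cN x : cvgn [normed series (t x)].
  apply: series_le_cvg cgeo => [n|n|n]; rewrite ?normr_ge0 ?tM//.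
  by rewrite /geometric/= mulr_ge0 ?exprn_ge0.
have cT x := normed_cvg (cN x).
exists (fun x => limn (series (t x))); split => x; last first.
  apply: le_trans (lim_series_norm (cN x)) _.
  have <- : limn (series (geometric M rho)) = M / (1 - rho).
    by apply/cvg_lim => //; apply: cvg_geometric_series.
  by apply: lim_series_le; [exact: cN|exact: cgeo|exact: tM].
have -> : limn (series (t x)) = limn (fun n => series (t x) n.+1).
  by apply/esym/cvg_lim => //; rewrite cvg_shiftS; exact: cT.
have e n : series (t x) n.+1 = rho * series (t (x - 1)) n + g x.
  rewrite /series/= big_nat_recl//= {1}/t expr0 mul1r subr0 addrC; congr (_ + _).
  rewrite mulr_sumr; apply: eq_bigr => k _; rewrite /t exprS -mulrA; congr (_ * (_ * g _)).
  lia.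
rewrite (funext e); apply/cvg_lim => //; apply: cvgD; last exact: cvg_cst.
by apply: cvgM; [exact: cvg_cst|exact: cT].
Qed.

(** By convexity |s(x)|^2 <= rho |s(x-1)|^2 + |g(x)|^2 / (1 - rho). Summing over a
window, the shifted sum on the right is the sum on the left up to a boundary
term, which the uniform bound controls; the factor 1 - rho is then absorbed. *)
Lemma first_order_l2 (rho : R) (g : int -> R[i]) (G : R) :
  0 <= rho < 1 -> (forall n, wsum n (fun x => normc (g x) ^+ 2) <= G) ->
  exists s : int -> R[i], (forall x, s x = rho%:C * s (x - 1) + g x) /\
    (forall n, wsum n (fun x => normc (s x) ^+ 2) <= 5 / (1 - rho) ^+ 3 * G).
Proof.
move=> r01 gG; have /andP[r0 r1] := r01.
have gx x : normc (g x) <= Num.sqrt G.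
  rewrite -(ger0_norm (normc_ge0 _)) -sqrtr_sqr ler_wsqrtr//.
  by apply: (wsum_le_total (f := fun x => normc (g x) ^+ 2)) => // y; rewrite sqr_ge0.
have G0 : 0 <= G by apply: le_trans (gG 0%N); rewrite /wsum big_ord0.
have [a [ha aM]] := first_order_real r01 (fun x => le_trans (normc_Re (g x)) (gx x)).
have [b [hb bM]] := first_order_real r01 (fun x => le_trans (normc_Im (g x)) (gx x)).
pose s x := a x +i* b x.
have hs x : s x = rho%:C * s (x - 1) + g x.
  apply: complex_eq.
    rewrite ReD ReM ReC ImC mul0r subr0; exact: ha.
  rewrite ImD ImM ReC ImC mul0r addr0; exact: hb.
exists s; split => // n.
pose K := 4 * G / (1 - rho) ^+ 2.
have sK x : normc (s x) ^+ 2 <= K.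
  rewrite normc_sq /s/=.
  have sq (y t : R) : `|y| <= t -> y ^+ 2 <= t ^+ 2.
    move=> h; rewrite -real_normK ?num_real// ler_sqr ?nnegrE//.
    exact: le_trans (normr_ge0 _) h.
  have := sq _ _ (aM x); have := sq _ _ (bM x).
  rewrite exprMn sqr_sqrtr// exprVn /K.
  rewrite -mulrA; have : 0 <= G / (1 - rho) ^+ 2 by rewrite divr_ge0// sqr_ge0.
  lra.
pose W := wsum n (fun x => normc (s x) ^+ 2).
have d0 : 0 < 1 - rho by rewrite subr_gt0.
have step x : normc (s x) ^+ 2 <= rho * normc (s (x - 1)) ^+ 2 + (1 - rho)^-1 * normc (g x) ^+ 2.
  have h : normc (s x) <= rho * normc (s (x - 1)) + normc (g x).
    by rewrite {1}hs (le_trans (normcD _ _))// normcM normcR ger0_norm.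
  apply: (@le_trans _ _ ((rho * normc (s (x - 1)) + normc (g x)) ^+ 2)).
    by rewrite ler_sqr ?nnegrE ?addr_ge0 ?mulr_ge0 ?normc_ge0.
  set A := normc (s (x - 1)); set B := normc (g x).
  rewrite -subr_ge0.
  (* the convexity defect is a square *)
  have -> : rho * A ^+ 2 + (1 - rho)^-1 * B ^+ 2 - (rho * A + B) ^+ 2 =
    rho / (1 - rho) * ((1 - rho) * A - B) ^+ 2 by field; rewrite gt_eqF.
  by rewrite mulr_ge0 ?sqr_ge0// divr_ge0// ltW.
have main : W <= rho * (W + K) + (1 - rho)^-1 * G.
  apply: le_trans (le_wsum n step) _; rewrite wsumD !wsumZ lerD//.
    rewrite ler_wpM2l// (wsum_shift n (fun x => normc (s x) ^+ 2)) -addrA lerD//.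
    by rewrite (le_trans _ (sK (- n%:Z - 1)))// gerDl oppr_le0 sqr_ge0.
  by rewrite ler_wpM2l// invr_ge0 ltW.
have : W * (1 - rho) <= (5 / (1 - rho) ^+ 2 * G).
  have -> : W * (1 - rho) = W - rho * W by ring.
  have : rho * K <= K by rewrite ler_piMl ?(le_trans (sqr_ge0 _) (sK 0))// ltW.
  have : (1 - rho)^-1 * G <= (1 - rho) ^- 2 * G.
    rewrite ler_wpM2r// lef_pV2 ?posrE ?exprn_gt0//.
    by rewrite expr2; nra.
  move: main; rewrite mulrDr /K.
  have -> : 4 * G / (1 - rho) ^+ 2 = 4 * ((1 - rho) ^- 2 * G) by ring.
  have -> : 5 / (1 - rho) ^+ 2 * G = 5 * ((1 - rho) ^- 2 * G) by ring.
  lra.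
rewrite -ler_pdivlMr// => h; apply: le_trans h _.
by rewrite le_eqVlt; apply/orP; left; apply/eqP; field; rewrite gt_eqF.
Qed.

(** The reflection x -> -x turns the backward recursion into the forward one. *)
Lemma first_order_l2_rev (rho : R) (g : int -> R[i]) (G : R) :
  0 <= rho < 1 -> (forall n, wsum n (fun x => normc (g x) ^+ 2) <= G) ->
  exists s : int -> R[i], (forall x, s x = rho%:C * (s (x + 1) + g (x + 1))) /\
    (forall n, wsum n (fun x => normc (s x) ^+ 2) <= 5 / (1 - rho) ^+ 3 * G).
Proof.
move=> r01 gG; have /andP[r0 r1] := r01.
have [|t [ht tG]] := @first_order_l2 rho (fun x => rho%:C * g (1 - x)) G r01.
  move=> n; apply: le_trans (wsum_oppD _ gG n); last by move=> x; rewrite sqr_ge0.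
  apply: le_wsum => x; rewrite normcM exprMn normcR ler_piMl ?sqr_ge0//.
  by rewrite ger0_norm// expr_le1 // ltW.
exists (fun x => t (- x)); split => [x|n].
  rewrite ht mulrDr; congr (_ * t _ + _ * g _); lia.
have h0 x : 0 <= normc (t x) ^+ 2 by rewrite sqr_ge0.
rewrite (wsum_opp n (fun x => normc (t x) ^+ 2)); apply: le_trans (tG n.+1).
by rewrite wsumS -addrA lerD2l lerD2l; have := h0 (Negz n); have := h0 (- n%:Z); lra.
Qed.

End FirstOrder.

(** * Wronskians *)

Section Auxiliary.
Variable R : realType.

Definition small_at_infinity (u : int -> R[i]) := forall e, 0 < e ->
  exists N : nat, forall x : int, (N <= `|x|)%N -> normc (u x) < e.

Lemma l2_small (u : int -> R[i]) : l2 u -> small_at_infinity u.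
Proof.
move=> /l2_cvg0[h1 h2] e e0.
have [N1 _ H1] := (cvgrPdist_lt _ _).1 h1 _ e0.
have [N2 _ H2] := (cvgrPdist_lt _ _).1 h2 _ e0.
exists (maxn N1 N2) => x; rewrite geq_max => /andP[n1 n2].
have [x0|x0] := leP 0 x.
  have := H1 `|x|%N n1; rewrite /= sub0r normrN ger0_norm ?normc_ge0//.
  by rewrite gez0_abs.
have := H2 `|x|%N n2; rewrite /= sub0r normrN ger0_norm ?normc_ge0//.
by rewrite ltz0_abs// opprK.
Qed.

Lemma arbitrarily_small (x M : R) : 0 <= x -> (forall e, 0 < e -> x <= M * e) -> x = 0.
Proof.
move=> x0 h; apply/eqP; rewrite eq_le x0 andbT; apply/ler_addgt0Pl => e e0.
rewrite addr0.
have M0 : 0 < `|M| + 1 by rewrite ltr_wpDl.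
have := h (e / (`|M| + 1)) (divr_gt0 e0 M0); move/le_trans; apply.
rewrite mulrCA ler_piMr ?(ltW e0)// ler_pdivrMr// mul1r.
by rewrite (le_trans (ler_norm _))// lerDl.
Qed.

Lemma root_exists (L : nat) (m : R) : (1 <= L)%N -> 0 < m -> exists2 rho, 0 < rho & rho ^+ L = m.
Proof.
move=> hL m0; exists (m `^ L%:R^-1); first exact: powR_gt0.
rewrite -powR_mulrn ?powR_ge0// -powRrM mulVf ?powRr1 ?ltW//.
by rewrite pnatr_eq0; lia.
Qed.

Lemma int_le_ex (x y : int) : x <= y -> exists n : nat, y = x + n%:Z.
Proof. by move=> xy; exists `|y - x|%N; lia. Qed.

Lemma int_ge_ex (x y : int) : y <= x -> exists n : nat, y = x - n%:Z.
Proof. by move=> xy; exists `|x - y|%N; lia. Qed.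

End Auxiliary.

Section Wronskian.
Variables (R : realType) (L : nat) (J lam : int -> R) (kS : R).
Hypothesis hL : (1 <= L)%N.
Hypothesis hJ : forall x : int, 1 <= x < L%:Z -> J x != 0.
Hypothesis hkS : kS != 0.

Local Notation cJ := (crystal_J L J kS).
Local Notation cl := (crystal_lam L lam).
Local Notation trC := (transfer L J lam kS (real_complex R)).
Local Notation t11 z := (tr11 L J lam kS (real_complex R) z L).
Local Notation t12 z := (tr12 L J lam kS (real_complex R) z L).
Local Notation t21 z := (tr21 L J lam kS (real_complex R) z L).
Local Notation t22 z := (tr22 L J lam kS (real_complex R) z L).

Definition jacobi (u : int -> R[i]) (x : int) : R[i] :=
  (cJ x)%:C * u (x + 1) + (cJ (x - 1))%:C * u (x - 1) + (cl x)%:C * u x.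

Definition wronsk (u w : int -> R[i]) (x : int) : R[i] :=
  (cJ x)%:C * (u (x + 1) * w x - u x * w (x + 1)).

(** The discrete Green identity: two solutions at the same energy have constant
Wronskian, and a source in the equation of u is read off from its jumps. *)
Lemma wronsk_step z u w x : jacobi w x = z * w x ->
  wronsk u w x - wronsk u w (x - 1) = (jacobi u x - z * u x) * w x.
Proof.
rewrite /wronsk subrK => h.
have -> : (jacobi u x - z * u x) * w x = jacobi u x * w x - u x * jacobi w x.
  by rewrite h; ring.
rewrite /jacobi; ring.
Qed.

Lemma wronsk_const z u w : (forall x, jacobi u x = z * u x) ->
  (forall x, jacobi w x = z * w x) -> forall x, wronsk u w x = wronsk u w 0.
Proof.
clear hL hJ hkS; move=> hu hw; have st y : wronsk u w y = wronsk u w (y - 1).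
  by apply/eqP; rewrite -subr_eq0 (wronsk_step _ (hw y)) hu subrr mul0r.
case=> n.
  elim: n => [//|n IH]; rewrite st -IH; congr wronsk.
  lia.
have -> : Negz n = - n.+1%:Z by lia.
elim: n.+1 => [|m IH]; first by rewrite oppr0.
by rewrite -IH [RHS]st; congr wronsk; lia.
Qed.

Lemma crystal_J_bound : exists2 K, 0 < K & forall x, `|cJ x| <= K.
Proof.
exists (1 + \sum_(k < L) `|cJ k.+1%:Z|).
  by rewrite ltr_pwDl// sumr_ge0.
move=> x; have [n [k [xE kL]]] : exists n k, x = n * L%:Z + k.+1%:Z /\ (k < L)%N.
  exists ((x - 1) %/ L%:Z)%Z, `|((x - 1) %% L%:Z)%Z|%N; split.
    have := divz_eq (x - 1) L%:Z; have := modz_ge0 (x - 1) (d := L%:Z); lia.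
  have := ltz_pmod (x - 1) (d := L%:Z); have := modz_ge0 (x - 1) (d := L%:Z).
  lia.
rewrite xE crystal_JDM (bigD1 (Ordinal kL))//= addrCA lerDl.
by rewrite addr_ge0// sumr_ge0.
Qed.

Lemma wronsk_le u w x K C e : `|cJ x| <= K ->
  normc (u x) <= e -> normc (u (x + 1)) <= e ->
  normc (w x) <= C -> normc (w (x + 1)) <= C ->
  normc (wronsk u w x) <= K * (2 * (e * C)).
Proof.
move=> hK u0 u1 w0 w1; rewrite /wronsk normcM normcR.
apply: ler_pM; rewrite ?normr_ge0 ?normc_ge0//.
apply: le_trans (normcB _ _) _; rewrite !normcM mulr_natl mulr2n.
by apply: lerD; apply: ler_pM; rewrite ?normc_ge0.
Qed.

(** The Wronskian is constant to the right of a, and it tends to 0 because u does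
while w stays bounded. *)
Lemma wronsk_pos z u w a C : small_at_infinity u ->
  (forall x, a <= x -> normc (w x) <= C) ->
  (forall x, a < x -> jacobi w x = z * w x) ->
  (forall x, a < x -> jacobi u x = z * u x) -> wronsk u w a = 0.
Proof.
move=> us wC hw hu.
have cst n : wronsk u w (a + n%:Z) = wronsk u w a.
  elim: n => [|n IH]; first by rewrite addr0.
  rewrite -IH; apply/eqP; rewrite -subr_eq0.
  have -> : a + n%:Z = a + n.+1%:Z - 1 by lia.
  by rewrite (@wronsk_step z) ?hu ?hw ?subrr ?mul0r//; lia.
have [K K0 JK] := crystal_J_bound.
apply/eqP; rewrite -normc_eq0; apply/eqP.
apply: (@arbitrarily_small _ _ (K * 2 * C)); first exact: normc_ge0.
move=> e e0; have [N hN] := us e e0.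
rewrite -(cst (N + `|a|)%N).
have -> : K * 2 * C * e = K * (2 * (e * C)) by ring.
apply: wronsk_le => //; try (apply: ltW; apply: hN; lia); apply: wC; lia.
Qed.

Lemma wronsk_neg z u w a C : small_at_infinity u ->
  (forall x, x <= a + 1 -> normc (w x) <= C) ->
  (forall x, x <= a -> jacobi w x = z * w x) ->
  (forall x, x <= a -> jacobi u x = z * u x) -> wronsk u w a = 0.
Proof.
move=> us wC hw hu.
have cst n : wronsk u w (a - n%:Z) = wronsk u w a.
  elim: n => [|n IH]; first by rewrite subr0.
  rewrite -IH; apply/esym/eqP; rewrite -subr_eq0.
  have -> : a - n.+1%:Z = a - n%:Z - 1 by lia.
  by rewrite (@wronsk_step z) ?hu ?hw ?subrr ?mul0r//; lia.
have [K K0 JK] := crystal_J_bound.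
apply/eqP; rewrite -normc_eq0; apply/eqP.
apply: (@arbitrarily_small _ _ (K * 2 * C)); first exact: normc_ge0.
move=> e e0; have [N hN] := us e e0.
rewrite -(cst (N + `|a| + 1)%N).
have -> : K * 2 * C * e = K * (2 * (e * C)) by ring.
apply: wronsk_le => //; try (apply: ltW; apply: hN; lia); apply: wC; lia.
Qed.

Section BlochBound.
Variables (z mu : R[i]) (v : R[i] * R[i]).
Hypothesis mu0 : mu != 0.
Hypothesis hv : trC z L v = (mu * v.1, mu * v.2).
Local Notation psi := (bloch L J lam kS (real_complex R) z mu v).

Lemma bloch_jacobi x : jacobi psi x = z * psi x.
Proof. exact: (bloch_rec hL hJ hkS mu0 hv). Qed.

(** rho is the modulus of the multiplier per site; within one cell the solution
takes finitely many values up to the power of mu. *)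
Lemma bloch_bound rho : 0 < rho -> rho ^+ L = normc mu ->
  exists2 C, 0 < C & forall x, normc (psi x) <= C * rho ^ x.
Proof.
move=> r0 rL.
exists (1 + \sum_(k < L) normc (trC z k v).2 / rho ^+ k).
  by rewrite ltr_pwDl// sumr_ge0// => i _; rewrite divr_ge0 ?normc_ge0 ?exprn_ge0 ?ltW.
move=> x; have [n [k [-> kL]]] : exists n k, x = n * L%:Z + k%:Z /\ (k < L)%N.
  exists (x %/ L%:Z)%Z, `|(x %% L%:Z)%Z|%N; split.
    have := divz_eq x L%:Z; have := modz_ge0 x (d := L%:Z); lia.
  have := ltz_pmod x (d := L%:Z); have := modz_ge0 x (d := L%:Z); lia.
rewrite (blochE hL hkS mu0 hv) normcM normcXz -rL.
have -> : rho ^ (n * L%:Z + k%:Z) = (rho ^+ L) ^ n * rho ^+ k.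
  by rewrite expfzDr ?gt_eqF// (mulrC n) -exprz_exp.
rewrite mulrCA ler_pM2l; last by rewrite exprz_gt0// exprn_gt0.
rewrite -ler_pdivrMr ?exprn_gt0// (bigD1 (Ordinal kL))//= addrCA lerDl.
by rewrite addr_ge0// sumr_ge0// => i _; rewrite divr_ge0 ?normc_ge0 ?exprn_ge0 ?ltW.
Qed.

Lemma bloch_neq0 : v != (0, 0) -> psi 0 != 0 \/ psi 1 != 0.
Proof.
move=> v0; have [p0|] := eqVneq (psi 0) 0; last by left.
right; apply: contra_neq v0 => p1.
have h1 := bloch1 hL hJ hkS mu0 hv; rewrite p1 mulr0 in h1.
have h0 := bloch_nat hL hkS mu0 hv 0; rewrite /= p0 in h0.
by case: (v) h0 h1 => a b /= <- <-.
Qed.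

End BlochBound.

(** Cayley-Hamilton: mu is a root of the characteristic polynomial, so T - mu is
singular, and every nonzero column of its adjugate is an eigenvector. When the
adjugate is 0, the matrix is scalar and every vector is one. *)
Lemma eigenvector_exists z mu : mu ^+ 2 - (t11 z + t22 z) * mu + 1 = 0 ->
  exists2 v, v != (0, 0) & trC z L v = (mu * v.1, mu * v.2).
Proof.
have det := transfer_det lam hL hJ hkS (real_complex R) z L.
move=> hmu; have hmu' : (mu - t11 z) * (mu - t22 z) = t12 z * t21 z.
  rewrite -[LHS]subr0 -hmu -det; ring.
have [e12|n12] := eqVneq (t12 z) 0; last first.
  exists (t12 z, mu - t11 z); first by apply: contra_neq n12 => -[].
  rewrite transferE /=; congr pair; first by ring.
  rewrite (mulrC (t21 z)) -hmu'; ring.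
(* t12 = 0: the matrix is triangular and mu is one of its diagonal entries *)
rewrite e12 mul0r in hmu'; move/eqP: hmu'; rewrite mulf_eq0 => /orP[].
  rewrite subr_eq0 => /eqP h1; have [e21|n21] := eqVneq (mu - t22 z) 0.
    exists (0, 1); first by apply/eqP => -[/eqP]; rewrite oner_eq0.
    rewrite transferE/= e12; congr pair; first by ring.
    move/eqP: e21; rewrite subr_eq0 => /eqP <-; ring.
  exists (mu - t22 z, t21 z); first by apply: contra_neq n21 => -[].
  rewrite transferE/= e12 -h1; congr pair; ring.
rewrite subr_eq0 => /eqP h1.
exists (0, 1); first by apply/eqP => -[/eqP]; rewrite oner_eq0.
rewrite transferE/= e12 -h1; congr pair; ring.
Qed.

Lemma eigen_indep z mu mu' v v' : mu != mu' -> v != (0, 0) -> v' != (0, 0) ->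
  trC z L v = (mu * v.1, mu * v.2) -> trC z L v' = (mu' * v'.1, mu' * v'.2) ->
  v.1 * v'.2 - v.2 * v'.1 != 0.
Proof.
rewrite !transferE => mm v0 v0' [a1 a2] [b1 b2]; apply/eqP => d.
have mm' : mu - mu' != 0 by rewrite subr_eq0.
have e1 : (mu - mu') * (v.1 * v'.1) = 0.
  have -> : (mu - mu') * (v.1 * v'.1) = mu * v.1 * v'.1 - v.1 * (mu' * v'.1) by ring.
  rewrite -a1 -b1; transitivity (- t12 z * (v.1 * v'.2 - v.2 * v'.1)); first by ring.
  by rewrite d mulr0.
have e2 : (mu - mu') * (v.2 * v'.2) = 0.
  have -> : (mu - mu') * (v.2 * v'.2) = mu * v.2 * v'.2 - v.2 * (mu' * v'.2) by ring.
  rewrite -a2 -b2; transitivity (t21 z * (v.1 * v'.2 - v.2 * v'.1)); first by ring.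
  by rewrite d mulr0.
have e3 : (mu - mu') * (v.1 * v'.2) = 0.
  have -> : (mu - mu') * (v.1 * v'.2) = mu * v.2 * v'.1 - v.1 * (mu' * v'.2)
      + mu * (v.1 * v'.2 - v.2 * v'.1) by ring.
  rewrite -a2 -b2 d mulr0 addr0.
  transitivity (- t22 z * (v.1 * v'.2 - v.2 * v'.1)); first by ring.
  by rewrite d mulr0.
move/eqP: e1; move/eqP: e2; move/eqP: e3.
rewrite !mulf_eq0 (negbTE mm')/= => e3 e2 e1.
move/eqP: d; rewrite subr_eq0 => d.
case: v v' v0 v0' e1 e2 e3 d {a1 a2 b1 b2} => a b [a' b'] /= v0 v0' e1 e2 e3 d.
have e4 : b * a' == 0 by rewrite -(eqP d) mulf_eq0.
move: e4 v0 v0'; rewrite mulf_eq0.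
have [a0|a0] := eqVneq a 0; have [b0|b0] := eqVneq b 0.
- by rewrite a0 b0 eqxx.
- by move: e2; rewrite (negbTE b0)/= => /eqP -> /eqP -> _; rewrite eqxx.
- by move: e1 e3; rewrite (negbTE a0)/= => /eqP -> /eqP -> _ _; rewrite eqxx.
- by move: e1 e3; rewrite (negbTE a0)/= => /eqP -> /eqP -> _ _; rewrite eqxx.
Qed.

End Wronskian.

(** * The spectrum of the crystal *)

Section Spectrum.
Variables (R : realType) (L : nat) (J lam : int -> R) (kS : R).
Hypothesis hL : (1 <= L)%N.
Hypothesis hJ : forall x : int, 1 <= x < L%:Z -> J x != 0.
Hypothesis hkS : kS != 0.

Local Notation cJ := (crystal_J L J kS).
Local Notation trC := (transfer L J lam kS (real_complex R)).
Local Notation t11 z := (tr11 L J lam kS (real_complex R) z L).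
Local Notation t12 z := (tr12 L J lam kS (real_complex R) z L).
Local Notation t21 z := (tr21 L J lam kS (real_complex R) z L).
Local Notation t22 z := (tr22 L J lam kS (real_complex R) z L).
Local Notation p11 := (tr11 L J lam kS polyC 'X L).
Local Notation p12 := (tr12 L J lam kS polyC 'X L).
Local Notation p21 := (tr21 L J lam kS polyC 'X L).
Local Notation p22 := (tr22 L J lam kS polyC 'X L).
Local Notation D := (discr L J lam kS).
Local Notation jacobi := (jacobi L J lam kS).
Local Notation wronsk := (wronsk L J kS).
Local Notation bloch := (bloch L J lam kS (real_complex R)).

Lemma transfer_real (E : R) (v : {poly R} * {poly R}) :
  trC E%:C L ((v.1.[E])%:C, (v.2.[E])%:C) =
  (((transfer L J lam kS polyC 'X L v).1.[E])%:C,
   ((transfer L J lam kS polyC 'X L v).2.[E])%:C).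
Proof.
have := @transfer_morph R L J lam kS _ _ (@polyC R) (real_complex R)
  (real_complex R \o horner_eval E) 'X L v.
rewrite /= /horner_eval hornerX; apply => x; by rewrite /= /horner_eval hornerC.
Qed.

Lemma t11_real E : t11 E%:C = (p11.[E])%:C.
Proof. by have := transfer_real E (1, 0); rewrite /= ?horner0 ?hornerC ?horner0 /tr11 => ->. Qed.
Lemma t21_real E : t21 E%:C = (p21.[E])%:C.
Proof. by have := transfer_real E (1, 0); rewrite /= ?horner0 ?hornerC ?horner0 /tr21 => ->. Qed.
Lemma t12_real E : t12 E%:C = (p12.[E])%:C.
Proof. by have := transfer_real E (0, 1); rewrite /= ?horner0 ?hornerC ?horner0 /tr12 => ->. Qed.
Lemma t22_real E : t22 E%:C = (p22.[E])%:C.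
Proof. by have := transfer_real E (0, 1); rewrite /= ?horner0 ?hornerC ?horner0 /tr22 => ->. Qed.

Lemma discr_real E : t11 E%:C + t22 E%:C = (D.[E])%:C.
Proof. by rewrite t11_real t22_real /discr hornerD rmorphD. Qed.

Lemma det_real E : p11.[E] * p22.[E] - p12.[E] * p21.[E] = 1.
Proof.
by rewrite -!hornerM -hornerN -hornerD (transfer_det lam hL hJ hkS) hornerC.
Qed.

Lemma h_crystalE x u :
  oact (h_crystal L J lam kS setT) u x = jacobi u x.
Proof. by rewrite /= asboolT. Qed.

Lemma delta_l2 (y : int) (B : set int) : B y -> @hmem R (ell2 R B) (delta R y).
Proof.
move=> By; split; last first.
  by move=> x Bx; rewrite /delta; case: eqP => // e; rewrite e in Bx.
split; first by split; apply: measurable_fun_int.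
rewrite (integral_counting_supp (x := y)); first by rewrite ltry.
by move=> x xy; rewrite /delta (negbTE xy) Normc.normc0 expr0n.
Qed.

(** The multiplier has modulus 1, so there is a bounded solution psi. If E were in
the resolvent set, the solution u of (h - E) u = delta_y would be
square-summable, hence its Wronskian with psi would vanish on both sides of
y. The jump of the Wronskian at y is psi(y), which would therefore be 0 for
every y. *)
Lemma in_spectrum (E : R) : D.[E] ^+ 2 < 4 -> sp_crystal L J lam kS E.
Proof.
move=> hE; rewrite /sp_crystal /= /spectrum => -[_ [M hM]].
have [c cE] : exists c, D.[E] = 2 * c.
  by exists (D.[E] / 2); rewrite mulrCA divff ?mulr1.
have c1 : 0 <= 1 - c ^+ 2 by rewrite cE in hE; nra.
(* a root of mu^2 - 2 c mu + 1, where 2 c is the discriminant *)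
pose mu := c +i* Num.sqrt (1 - c ^+ 2).
have nmu : normc mu = 1 by rewrite /mu /= sqr_sqrtr// addrC subrK sqrtr1.
have mu0 : mu != 0 by rewrite -normc_gt0 nmu.
have hmu : mu ^+ 2 - (t11 E%:C + t22 E%:C) * mu + 1 = 0.
  rewrite discr_real cE.
  have ss : Num.sqrt (1 - c ^+ 2) ^+ 2 = 1 - c ^+ 2 by rewrite sqr_sqrtr.
  rewrite /mu; set q := Num.sqrt _ in ss *; apply: complex_eq.
    rewrite expr2 ReD ReD ReN !ReM ReC ImC /=.
    transitivity (1 - c ^+ 2 - q ^+ 2); [ring|by rewrite ss subrr].
  by rewrite expr2 ImD ImD ImN !ImM ReC ImC /=; ring.
have [v v0 hv] := eigenvector_exists hL hJ hkS hmu.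
pose psi := bloch E%:C mu v.
have [C C0 hC] := bloch_bound hL hkS mu0 hv ltr01 (etrans (expr1n _ _) (esym nmu)).
have {}hC x : normc (psi x) <= C by apply: le_trans (hC x) _; rewrite exp1rz mulr1.
have hpsi x : jacobi psi x = E%:C * psi x := bloch_jacobi hL hJ hkS mu0 hv x.
have psi_y (y : int) : psi y = 0.
  have [u [lu _] [/counting_ae hu _]] := hM (delta R y) (delta_l2 I).
  have {}hu x : jacobi u x - E%:C * u x = delta R y x.
    by rewrite -(hu x) -h_crystalE.
  have hu0 x : x != y -> jacobi u x = E%:C * u x.
    by move=> xy; apply/eqP; rewrite -subr_eq0 hu /delta (negbTE xy).
  have us := l2_small lu.
  have w1 : wronsk u psi y = 0.
    apply: (wronsk_pos hL hkS (z := E%:C) (C := C) us) => x // yx.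
    by apply: hu0; rewrite gt_eqF.
  have w2 : wronsk u psi (y - 1) = 0.
    apply: (wronsk_neg hL hkS (z := E%:C) (C := C) us) => x // yx.
    by apply: hu0; rewrite lt_eqF//; lia.
  have := wronsk_step u (hpsi y).
  by rewrite w1 w2 subrr hu /delta eqxx mul1r => ->.
by have [] := bloch_neq0 hL hJ hkS mu0 hv v0; rewrite -/(psi _) psi_y eqxx.
Qed.

(** The solutions psi and psi' decay at plus and minus infinity. An element of the
kernel of h - z has zero Wronskian with both, hence vanishes. The resolvent is
the variation of constants u = (psi A + psi' A') / W, in which A and A' are
partial sums of psi' f and psi f: after removing the exponential factors,
they solve contractive first-order recursions, whence the bound. *)
Lemma in_resolvent_set (z mu : R[i]) : mu != 0 -> normc mu < 1 ->
  mu ^+ 2 - (t11 z + t22 z) * mu + 1 = 0 ->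
  resolvent_set (h_crystal L J lam kS setT) z.
Proof.
move=> mu0 mu1 hmu.
have hmu' : mu^-1 ^+ 2 - (t11 z + t22 z) * mu^-1 + 1 = 0.
  have -> : mu^-1 ^+ 2 - (t11 z + t22 z) * mu^-1 + 1 =
     mu^-1 ^+ 2 * (mu ^+ 2 - (t11 z + t22 z) * mu + 1) by field.
  by rewrite hmu mulr0.
have [v v0 hv] := eigenvector_exists hL hJ hkS hmu.
have [v' v0' hv'] := eigenvector_exists hL hJ hkS hmu'.
have mui0 : mu^-1 != 0 by rewrite invr_eq0.
have nmu : 0 < normc mu by rewrite normc_gt0.
have [rho r0 rL] := root_exists hL nmu.
have r1 : rho < 1.
  rewrite ltNge; apply/negP => h; move: mu1; rewrite -rL ltNge => /negP; apply.
  by rewrite exprn_ege1.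
have [C C0 hC] := bloch_bound hL hkS mu0 hv r0 rL.
have ri0 : 0 < rho^-1 by rewrite invr_gt0.
have rLi : rho^-1 ^+ L = normc mu^-1 by rewrite Normc.normcV exprVn rL.
have [C' C0' hC'] := bloch_bound hL hkS mui0 hv' ri0 rLi.
set psi := bloch z mu v in hC; set psi' := bloch z mu^-1 v' in hC'.
have hpsi x : jacobi psi x = z * psi x := bloch_jacobi hL hJ hkS mu0 hv x.
have hpsi' x : jacobi psi' x = z * psi' x := bloch_jacobi hL hJ hkS mui0 hv' x.
have mm : mu != mu^-1.
  apply/eqP => e; have : normc mu ^+ 2 == 1.
    have e2 : normc mu = (normc mu)^-1 by rewrite -Normc.normcV -e.
    by rewrite expr2 [X in _ * X]e2 mulfV// gt_eqF.
  by rewrite sqrp_eq1 ?normc_ge0// lt_eqF.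
have W00 : wronsk psi psi' 0 != 0.
  have := eigen_indep mm v0 v0' hv hv'; apply: contra_neq.
  rewrite /wronsk add0r crystal_J0// mulrBr.
  have e1 := bloch1 hL hJ hkS mu0 hv; have e2 := bloch1 hL hJ hkS mui0 hv'.
  have e3 := bloch_nat hL hkS mu0 hv 0; have e4 := bloch_nat hL hkS mui0 hv' 0.
  rewrite -[psi 0]/(bloch z mu v 0%:Z) -[psi' 0]/(bloch z mu^-1 v' 0%:Z) e3 e4 /=.
  by rewrite mulrA e1 (mulrCA _ v.2) e2.
have W0 := wronsk_const hpsi hpsi'.
move: psi psi' hC hC' hpsi hpsi' W00 W0 => psi psi' hC hC' hpsi hpsi' W00 W0.
move: (wronsk psi psi' 0) W00 W0 => W W00 W0.
split.
  move=> u [lu _] /counting_ae hu; have us := l2_small lu.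
  have {}hu x : jacobi u x = z * u x.
    by apply/eqP; rewrite -subr_eq0; apply/eqP; have := hu x; rewrite -h_crystalE.
  have w1 x : wronsk u psi x = 0.
    apply: (wronsk_pos hL hkS (z := z) (C := C * rho ^ x) us) => // y xy.
    apply: le_trans (hC y) _; rewrite ler_pM2l//.
    have [n ->] := int_le_ex xy.
    rewrite expfzDr ?gt_eqF// ler_piMr ?exprz_ge0 ?(ltW r0)//.
    by rewrite -exprnP exprn_ile1 ?(ltW r0) ?(ltW r1).
  have w2 x : wronsk u psi' x = 0.
    apply: (wronsk_neg hL hkS (z := z) (C := C' * rho^-1 ^ (x + 1)) us) => // y xy.
    apply: le_trans (hC' y) _; rewrite ler_pM2l//.
    have [n ->] := int_ge_ex xy.
    rewrite expfzDr ?gt_eqF// ler_piMr ?exprz_ge0 ?(ltW ri0)//.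
    by rewrite exprz_inv opprK -exprnP exprn_ile1 ?(ltW r0) ?(ltW r1).
  apply: aeW => x /=; have := W0 x; rewrite /wronsk => WE.
  have := w1 x; have := w2 x; rewrite /wronsk => k2 k1.
  have : W * u x = 0.
    rewrite -WE.
    have -> : (cJ x)%:C * (psi (x + 1) * psi' x - psi x * psi' (x + 1)) * u x =
      psi x * ((cJ x)%:C * (u (x + 1) * psi' x - u x * psi' (x + 1)))
      - psi' x * ((cJ x)%:C * (u (x + 1) * psi x - u x * psi (x + 1))) by ring.
    by rewrite k1 k2 !mulr0 subrr.
  by move/eqP; rewrite mulf_eq0 (negbTE W00)/= => /eqP.
have r01 : 0 <= rho < 1 by rewrite r1 ltW.
have rC0 : rho%:C != 0 by rewrite -normc_eq0 normcR normr_eq0 gt_eqF.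
pose K := 5 / (1 - rho) ^+ 3.
have K0 : 0 <= K by rewrite /K divr_ge0// exprn_ge0// subr_ge0 ltW.
(* the Bloch solutions stripped of their exponential growth *)
pose gm x := rho%:C ^ x * psi' x; pose gp x := rho%:C ^ (- x) * psi x.
have nr (x : int) : normc (rho%:C ^ x) = rho ^ x by rewrite normcXz normcR gtr0_norm.
have gmC x : normc (gm x) <= C'.
  rewrite normcM nr; apply: le_trans (ler_wpM2l _ (hC' x)) _.
    by rewrite exprz_ge0// ltW.
  by rewrite mulrCA exprz_inv -expfzDr ?gt_eqF// subrr expr0z mulr1.
have gpC x : normc (gp x) <= C.
  rewrite normcM nr; apply: le_trans (ler_wpM2l _ (hC x)) _.
    by rewrite exprz_ge0// ltW.
  by rewrite mulrCA -expfzDr ?gt_eqF// addNr expr0z mulr1.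
pose B := 2 * (C ^+ 2 * K * C' ^+ 2 + C' ^+ 2 * K * C ^+ 2) / normc W ^+ 2.
have B0 : 0 <= B.
  have h a b : 0 <= a ^+ 2 * K * b ^+ 2 :> R.
    by apply: mulr_ge0; [apply: mulr_ge0|]; rewrite ?sqr_ge0.
  by apply: divr_ge0; [apply: mulr_ge0 => //; apply: addr_ge0|exact: sqr_ge0].
exists (Num.sqrt B) => f [lf _].
have hf := l2_wsum lf; set G := fine _ in hf.
have gf (g : int -> R[i]) M : (forall x, normc (g x) <= M) ->
    forall n, wsum n (fun x => normc (g x * f x) ^+ 2) <= M ^+ 2 * G.
  move=> gM n; apply: le_trans (le_wsum n (g := fun x => M ^+ 2 * normc (f x) ^+ 2) _) _.
    move=> x; rewrite normcM exprMn ler_wpM2r ?sqr_ge0// ler_sqr ?nnegrE ?normc_ge0//.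
    exact: le_trans (normc_ge0 _) (gM x).
  by rewrite wsumZ ler_wpM2l ?sqr_ge0.
have [s [hs sG]] := first_order_l2 r01 (gf _ _ gmC).
have [s' [hs' sG']] := first_order_l2_rev r01 (gf _ _ gpC).
pose A x := rho%:C ^ (- x) * s x; pose A' x := rho%:C ^ x * s' x.
have rV (x : int) : rho%:C ^ (- x) * rho%:C ^ x = 1.
  by rewrite -expfzDr// addNr expr0z.
have AE x : A (x - 1) = A x - psi' x * f x.
  rewrite /A (hs x) /gm opprB addrC expfzDr// expr1z.
  by rewrite -[psi' x * f x]mul1r -(rV x); ring.
have A'E x : A' (x + 1) = A' x - psi (x + 1) * f (x + 1).
  rewrite /A' (hs' x) /gp -[psi (x + 1) * f _]mul1r -(rV (x + 1)).
  by rewrite (expfzDr x 1)// expr1z; ring.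
(* variation of constants: A sums psi' f up to x and A' sums psi f beyond x *)
pose u x := W^-1 * (psi x * A x + psi' x * A' x).
have uE x : u x = W^-1 * (gp x * s x + gm x * s' x).
  rewrite /u /A /A' /gp /gm; ring.
have uG n : wsum n (fun x => normc (u x) ^+ 2) <= B * G.
  have h x : normc (u x) ^+ 2 <= (2 / normc W ^+ 2) *
      (C ^+ 2 * normc (s x) ^+ 2 + C' ^+ 2 * normc (s' x) ^+ 2).
    rewrite uE normcM exprMn Normc.normcV exprVn (mulrC 2) -(mulrA _ 2).
    apply: ler_wpM2l; first by rewrite invr_ge0 sqr_ge0.
    apply: (@le_trans _ _ ((C * normc (s x) + C' * normc (s' x)) ^+ 2)).
      rewrite ler_sqr ?nnegrE ?normc_ge0 ?addr_ge0 ?mulr_ge0 ?normc_ge0 ?(ltW C0) ?(ltW C0')//.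
      apply: le_trans (normcD _ _) _; rewrite (normcM (gp x)) (normcM (gm x)).
      by apply: lerD; apply: ler_wpM2r; rewrite ?normc_ge0.
    rewrite -!exprMn; set a := C * _; set b := C' * _.
    by have := sqr_ge0 (a - b); nra.
  apply: le_trans (le_wsum n h) _; rewrite wsumZ wsumD !wsumZ.
  have -> : B * G = (2 / normc W ^+ 2) * (C ^+ 2 * (K * (C' ^+ 2 * G)) + C' ^+ 2 * (K * (C ^+ 2 * G))).
    by rewrite /B; ring.
  by rewrite ler_wpM2l ?divr_ge0 ?sqr_ge0// lerD// ler_wpM2l ?sqr_ge0.
have lu := l2P uG.
exists u; first by split => // x; case.
split.
  apply: aeW => x; rewrite -[LHS]/(oact (h_crystal L J lam kS setT) u x - z * u x) h_crystalE.
  have e1 : u (x + 1) = W^-1 * (psi (x + 1) * A x + psi' (x + 1) * A' x).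
    have := AE (x + 1); rewrite addrK => hA.
    rewrite /u A'E hA; ring.
  have e2 : u (x - 1) = W^-1 * (psi (x - 1) * (A x - psi' x * f x) + psi' (x - 1) * (A' x + psi x * f x)).
    rewrite /u AE; have := A'E (x - 1); rewrite subrK => ->; ring.
  have WE := W0 (x - 1); rewrite /wronsk subrK in WE.
  have : jacobi u x - z * u x = W^-1 * (A x * (jacobi psi x - z * psi x) +
     A' x * (jacobi psi' x - z * psi' x) + W * f x).
    by rewrite /jacobi e1 e2 /u; move: (W^-1) => k; rewrite -WE; ring.
  by move=> ->; rewrite hpsi hpsi' !subrr !mulr0 !add0r mulKf.
rewrite !hnorm_l2 -sqrtrM// ler_wsqrtr//.
rewrite -lee_fin fineK.
  by apply: integral_counting_le => // x; rewrite sqr_ge0.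
have [_ lu2] := lu; rewrite ge0_fin_numE//.
by apply: integral_ge0 => x _; rewrite lee_fin sqr_ge0.
Qed.

(** The two roots of m^2 - D m + 1 are real and have product 1, so one of them has
modulus less than 1. *)
Lemma notin_spectrum (E : R) : 4 < D.[E] ^+ 2 -> ~ sp_crystal L J lam kS E.
Proof.
move=> hE; rewrite /sp_crystal /= /spectrum; apply; rewrite /=.
set d := D.[E] in hE.
have [m [m0 m1 hm]] : exists m : R, [/\ m != 0, `|m| < 1 & m ^+ 2 - d * m + 1 = 0].
  have q0 : 0 < d ^+ 2 - 4 by rewrite subr_gt0.
  pose q := Num.sqrt (d ^+ 2 - 4).
  have qq : q ^+ 2 = d ^+ 2 - 4 by rewrite sqr_sqrtr// ltW.
  have qp : 0 < q by rewrite sqrtr_gt0.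
  have [dp|dn] := ltP 0 d.
    exists ((d - q) / 2).
    have dq : q < d by rewrite -ltr_sqr ?nnegrE ?ltW// qq; lra.
    have d2 : 2 < d by rewrite -ltr_sqr ?nnegrE ?ltW//; lra.
    have dq2 : d - 2 < q by rewrite -ltr_sqr ?nnegrE ?ltW//; nra.
    split.
    - by rewrite mulf_neq0 ?subr_eq0 ?gt_eqF.
    - by rewrite gtr0_norm; lra.
    - transitivity ((q ^+ 2 - d ^+ 2 + 4) / 4); first by field.
      by rewrite qq; field.
  exists ((d + q) / 2).
  have dq : q < - d by rewrite -ltr_sqr ?nnegrE ?(ltW qp)// ?oppr_ge0// qq; lra.
  have d2 : 2 < - d by rewrite -ltr_sqr ?nnegrE ?oppr_ge0//; lra.
  have dq2 : - d - 2 < q by rewrite -ltr_sqr ?nnegrE ?ltW//; nra.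
  split.
  - by rewrite mulf_neq0// ?invr_eq0// lt_eqF//; lra.
  - by rewrite ltr0_norm; lra.
  - transitivity ((q ^+ 2 - d ^+ 2 + 4) / 4); first by field.
    by rewrite qq; field.
apply: (@in_resolvent_set E%:C m%:C); rewrite ?normcR//.
  by rewrite -normc_eq0 normcR normr_eq0.
rewrite discr_real -/d -rmorphXn -rmorphM -rmorphB -(rmorph1 (real_complex R)) -rmorphD hm.
by rewrite rmorph0.
Qed.

End Spectrum.

(** * The Weyl functions *)

(** The resolvent is a choice among the solutions of the equation, so a Green
function is determined once all solutions have the same pairing with a. *)
Lemma greenE (R : realType) (H : hilbert R) (A : oper H) (a b : H) (z g : R[i]) :
  (exists u, odom A u /\ heqv (oact A u - z *: u) b) ->
  (forall u, odom A u -> heqv (oact A u - z *: u) b -> hip a u = g) ->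
  green A a b z = g.
Proof. by move=> /(xgetPex 0)[h1 h2]; apply. Qed.

Lemma int_gt1 (x : int) : 1 <= x -> x != 1 -> 1 <= x - 1 /\ 1 <= x + 1.
Proof. lia. Qed.

Lemma int_gt1_neq0 (x : int) : 1 <= x -> x != 1 ->
  [/\ (x == 0) = false, (x - 1 == 0) = false & (x + 1 == 0) = false].
Proof. by move=> h1 h2; split; lia. Qed.

Lemma int_abs_neq0 (x : int) N : (N.+1 <= `|x|)%N -> (x == 0) = false /\ (N <= `|x|)%N.
Proof. by move=> h; split; lia. Qed.

Section Weyl.
Variables (R : realType) (L : nat) (J lam : int -> R) (kS : R).
Hypothesis hL : (1 <= L)%N.
Hypothesis hJ : forall x : int, 1 <= x < L%:Z -> J x != 0.
Hypothesis hkS : kS != 0.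

Local Notation cJ := (crystal_J L J kS).
Local Notation cl := (crystal_lam L lam).
Local Notation trC := (transfer L J lam kS (real_complex R)).
Local Notation jacobi := (jacobi L J lam kS).
Local Notation bloch := (bloch L J lam kS (real_complex R)).

(** The current Im (conj u(n) J_n u(n+1)) grows at each site by Im z |u|^2: it is
conserved at real energy and nondecreasing for Im z > 0. *)
Lemma flux z n v :
  Im (conjc (trC z n v).2 * (trC z n v).1) =
  Im (conjc v.2 * v.1) + Im z * \sum_(k < n) normc (trC z k.+1 v).2 ^+ 2.
Proof.
elim: n => [|n IH]; first by rewrite big_ord0 mulr0 addr0.
rewrite big_ord_recr/= [in RHS]mulrDr [in RHS]addrA -IH normc_sq.
set w := trC z n v; set i := (_ _^-1); set j := (_ (cJ _)).
have ji : Re j * Re i = 1 by rewrite /j /i /= mulfV// crystal_J_neq0.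
have i0 : Im i = 0 by []. have j0 : Im j = 0 by [].
move: i j ji i0 j0 => i j ji i0 j0.
rewrite !(ReM, ImM, ReD, ImD, ReN, ImN, ReJ, ImJ) i0 j0 ReC ImC.
rewrite -[X in _ = X + _]mul1r -ji; ring.
Qed.

Lemma hip_delta (B : set int) (y : int) (u : int -> R[i]) :
  @hip R (ell2 R B) (delta R y) u = u y.
Proof.
have d x : conjc (delta R y x) * u x = if x == y then u x else 0.
  have -> : conjc (delta R y x) = if x == y then 1 else 0.
    by rewrite /delta; case: eqP => _; apply: complex_eq => //=; rewrite oppr0.
  by case: eqP => _; rewrite ?mul1r ?mul0r.
rewrite [LHS]/(cintegral _ _); apply: complex_eq.
  rewrite [LHS]/(Rintegral _ _ _) (integral_counting_supp (x := y)) => [|x xy].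
    by rewrite /= d eqxx.
  by rewrite d (negbTE xy).
rewrite [LHS]/(Rintegral _ _ _) (integral_counting_supp (x := y)) => [|x xy].
  by rewrite /= d eqxx.
by rewrite d (negbTE xy).
Qed.

Lemma geometric_window (r B : R) (f : int -> R) : 0 <= r < 1 -> 0 <= B ->
  (forall x, f x <= B * r ^+ `|x|%N) -> forall n, wsum n f <= 2 * B / (1 - r).
Proof.
move=> /andP[r0 r1] B0 hf n.
have geo m : \sum_(k < m) r ^+ k <= (1 - r)^-1.
  have e : (1 - r) * \sum_(k < m) r ^+ k = 1 - r ^+ m.
    by rewrite -{2}(expr1n R m) subrXX; congr (_ * _); apply: eq_bigr => k _;
      rewrite expr1n mul1r.
  rewrite -[leRHS]mul1r ler_pdivlMr ?subr_gt0// mulrC e.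
  by rewrite gerBl exprn_ge0.
rewrite /wsum; apply: (@le_trans _ _ (\sum_(k < n) (2 * B) * r ^+ k)).
  apply: ler_sum => k _; rewrite -mulrA mulr_natl mulr2n; apply: lerD.
    exact: hf.
  apply: le_trans (hf _) _; rewrite NegzE abszN absz_nat ler_wpM2l//.
  by rewrite exprS ler_piMl ?exprn_ge0 ?(ltW r1).
by rewrite -mulr_sumr ler_wpM2l ?mulr_ge0.
Qed.

(** The solution of (h - z) w = delta_1 on the right half-line is a multiple of
the decaying Bloch solution. For uniqueness, extend w by the value -1/J_0 at
site 0: the source disappears, so the Wronskian with psi vanishes and w is
proportional to psi. *)
Lemma green_right z mu v : mu != 0 -> normc mu < 1 ->
  trC z L v = (mu * v.1, mu * v.2) -> v.2 != 0 ->
  green (h_crystal L J lam kS [set x | 1 <= x]) (delta R 1) (delta R 1) z =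
  - (v.1 / v.2) / (kS ^+ 2)%:C.
Proof.
move=> mu0 mu1 hv v20.
have nmu : 0 < normc mu by rewrite normc_gt0.
have [rho r0 rL] := root_exists hL nmu.
have r1 : rho < 1.
  rewrite ltNge; apply/negP => h; move: mu1; rewrite -rL ltNge => /negP; apply.
  by rewrite exprn_ege1.
have [C C0 hC] := bloch_bound hL hkS mu0 hv r0 rL.
set psi := bloch z mu v in hC.
have hpsi x : jacobi psi x = z * psi x := bloch_jacobi hL hJ hkS mu0 hv x.
have p0 : psi 0 = v.2 by have := bloch_nat hL hkS mu0 hv 0.
have p1 : kS%:C * psi 1 = v.1 by have := bloch1 hL hJ hkS mu0 hv.
move: psi hC hpsi p0 p1 => psi hC hpsi p0 p1.
have kC : kS%:C != 0 by rewrite -normc_eq0 normcR normr_eq0.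
apply: greenE => [|w [lw w0] /counting_ae hw]; last rewrite hip_delta.
  pose w (x : int) := if 1 <= x then - psi x / (kS%:C * psi 0) else 0.
  exists w.
  have hwC x : normc (w x) ^+ 2 <= (C / normc (kS%:C * psi 0)) ^+ 2 * (rho ^+ 2) ^+ `|x|%N.
    rewrite /w; case: ifP => x1; last first.
      rewrite Normc.normc0 expr0n /=.
      by apply: mulr_ge0; [exact: sqr_ge0|apply: exprn_ge0; exact: sqr_ge0].
    rewrite [in leLHS]normcM Normc.normcV normcN exprAC -exprMn ler_sqr ?nnegrE; last 2 first.
    - by apply: mulr_ge0; rewrite ?invr_ge0 normc_ge0.
    - apply: mulr_ge0; last by rewrite exprn_ge0// ltW.
      by apply: mulr_ge0; rewrite ?invr_ge0 ?normc_ge0// ltW.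
    rewrite mulrAC ler_wpM2r ?invr_ge0 ?normc_ge0//.
    have <- : rho ^ x = rho ^+ `|x|%N by rewrite exprnP gez0_abs// ltW.
    exact: hC.
  have r2 : 0 <= rho ^+ 2 < 1 by rewrite sqr_ge0 expr_lt1// ltW.
  have lw := l2P (geometric_window r2 (sqr_ge0 _) hwC).
  split.
    by split => // x /negP x1; rewrite /w (negbTE x1).
  apply: aeW => x; rewrite -[LHS]/((if `[< 1 <= x >] then jacobi w x else 0) - z * w x).
  rewrite /delta asboolb; case: ifP => x1; last first.
    by rewrite /w x1 mulr0 subr0; case: eqP => // e; rewrite e in x1.
  have [e|x2] := eqVneq x 1; last first.
    have [x3 x4] := int_gt1 x1 x2.
    rewrite /jacobi /w x1 x3 x4 /=.
    transitivity (- (jacobi psi x - z * psi x) / (kS%:C * psi 0)).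
      by rewrite /jacobi; ring.
    by rewrite hpsi subrr oppr0 mul0r.
  rewrite e /jacobi /w subrr lexx ler10 /= mulr0 addr0.
  have := hpsi 1; rewrite /jacobi subrr crystal_J0// => h.
  transitivity (- (((cJ 1)%:C * psi (1 + 1) + kS%:C * psi 0 + (cl 1)%:C * psi 1) - z * psi 1) / (kS%:C * psi 0) + 1).
    by field; rewrite p0 v20.
  by rewrite h subrr oppr0 mul0r add0r.
have {}hw (x : int) : 1 <= x -> jacobi w x - z * w x = delta R 1 x.
  move=> x1; have := hw x.
  by rewrite -[LHS]/((if `[< 1 <= x >] then jacobi w x else 0) - z * w x) asboolb x1.
(* the value at 0 for which J_0 u(0) cancels the source at site 1 *)
pose u x := if x == 0 then - (kS%:C)^-1 else w x.
have us : small_at_infinity u.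
  move=> e e0; have [N hN] := l2_small lw e0; exists N.+1 => x xN.
  have [x0 x1] := int_abs_neq0 xN.
  by rewrite /u x0; apply: hN.
have hu x : 0 < x -> jacobi u x = z * u x.
  move=> x0; have x1 : 1 <= x by lia.
  have [e|x2] := eqVneq x 1.
    have := hw 1 isT; rewrite (_ : delta R 1 1 = 1); last by rewrite /delta eqxx.
    rewrite e /jacobi /u subrr /= crystal_J0// (w0 0)// mulr0 addr0 => h.
    by rewrite mulrN mulfV// addrAC -h; ring.
  have := hw x x1; rewrite /delta (negbTE x2) => /eqP; rewrite subr_eq0 => /eqP h.
  have [e1 e2 e3] := int_gt1_neq0 x1 x2.
  by rewrite /jacobi /u e1 e2 e3.
have hC' x : 0 <= x -> normc (psi x) <= C.
  move=> x0; apply: le_trans (hC x) _; rewrite ler_piMr ?(ltW C0)//.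
  by rewrite -(gez0_abs x0) -exprnP exprn_ile1 ?(ltW r0) ?(ltW r1).
have := wronsk_pos hL hkS us hC' (fun x _ => hpsi x) hu.
rewrite /wronsk add0r crystal_J0// /u /= p0 => /eqP.
rewrite mulf_eq0 (negbTE kC)/= subr_eq0 => /eqP h.
have -> : w 1 = w 1 * v.2 / v.2 by rewrite mulfK.
rewrite h -p1 rmorphXn /=; field.
by rewrite ?v20 ?kC.
Qed.

End Weyl.

Lemma int_lt0 (x : int) : x <= 0 -> x != 0 -> [/\ x + 1 <= 0, x - 1 <= 0, (x == 1) = false,
   (x - 1 == 1) = false & (x + 1 == 1) = false].
Proof. by move=> h1 h2; split; lia. Qed.

Lemma int_abs_neq1 (x : int) N : (N.+2 <= `|x|)%N -> (x == 1) = false /\ (N <= `|x|)%N.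
Proof. by move=> h; split; lia. Qed.

Lemma int_le1_ex (x : int) : x <= 1 -> exists n : nat, x = 1 - n%:Z.
Proof. by move=> h; exists `|1 - x|%N; lia. Qed.

Lemma int_le0_abs (x : int) : x <= 0 -> x = - `|x|%N%:Z.
Proof. lia. Qed.

Section WeylLeft.
Variables (R : realType) (L : nat) (J lam : int -> R) (kS : R).
Hypothesis hL : (1 <= L)%N.
Hypothesis hJ : forall x : int, 1 <= x < L%:Z -> J x != 0.
Hypothesis hkS : kS != 0.

Local Notation cJ := (crystal_J L J kS).
Local Notation cl := (crystal_lam L lam).
Local Notation trC := (transfer L J lam kS (real_complex R)).
Local Notation jacobi := (jacobi L J lam kS).
Local Notation bloch := (bloch L J lam kS (real_complex R)).

(** As on the right half-line, with the solution that decays to the left; the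
Dirichlet condition now sits at site 1. *)
Lemma green_left z mu v : 1 < normc mu ->
  trC z L v = (mu * v.1, mu * v.2) -> v.1 != 0 ->
  green (h_crystal L J lam kS [set x | x <= 0]) (delta R 0) (delta R 0) z =
  - (v.2 / v.1).
Proof.
move=> mu1 hv v10.
have nmu : 0 < normc mu by apply: lt_trans mu1.
have mu0 : mu != 0 by rewrite -normc_gt0.
have [rho r0 rL] := root_exists hL nmu.
have r1 : 1 < rho.
  rewrite ltNge; apply/negP => h; move: mu1; rewrite -rL ltNge => /negP; apply.
  by rewrite exprn_ile1// ltW.
have [C C0 hC] := bloch_bound hL hkS mu0 hv r0 rL.
set psi := bloch z mu v in hC.
have hpsi x : jacobi psi x = z * psi x := bloch_jacobi hL hJ hkS mu0 hv x.
have p0 : psi 0 = v.2 by have := bloch_nat hL hkS mu0 hv 0.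
have p1 : kS%:C * psi 1 = v.1 by have := bloch1 hL hJ hkS mu0 hv.
move: psi hC hpsi p0 p1 => psi hC hpsi p0 p1.
have kC : kS%:C != 0 by rewrite -normc_eq0 normcR normr_eq0.
have p10 : psi 1 != 0 by apply: contra_neq v10 => h; rewrite -p1 h mulr0.
have ri0 : 0 < rho^-1 by rewrite invr_gt0.
have ri1 : rho^-1 < 1 by rewrite invf_lt1.
apply: greenE => [|w [lw w0] /counting_ae hw]; last rewrite hip_delta.
  pose w (x : int) := if x <= 0 then - psi x / (kS%:C * psi 1) else 0.
  exists w.
  have hwC x : normc (w x) ^+ 2 <= (C / normc (kS%:C * psi 1)) ^+ 2 * (rho^-1 ^+ 2) ^+ `|x|%N.
    rewrite /w; case: ifP => x1; last first.
      rewrite Normc.normc0 expr0n /=.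
      by apply: mulr_ge0; [exact: sqr_ge0|apply: exprn_ge0; exact: sqr_ge0].
    rewrite [in leLHS]normcM Normc.normcV normcN exprAC -exprMn ler_sqr ?nnegrE; last 2 first.
    - by apply: mulr_ge0; rewrite ?invr_ge0 normc_ge0.
    - apply: mulr_ge0; last by rewrite exprn_ge0// ltW.
      by apply: mulr_ge0; rewrite ?invr_ge0 ?normc_ge0// ltW.
    rewrite mulrAC ler_wpM2r ?invr_ge0 ?normc_ge0//.
    have <- : rho ^ x = rho^-1 ^+ `|x|%N.
      by rewrite {1}(int_le0_abs x1) -exprz_inv -exprnP.
    exact: hC.
  have r2 : 0 <= rho^-1 ^+ 2 < 1 by rewrite sqr_ge0 expr_lt1// ltW.
  have lw := l2P (geometric_window r2 (sqr_ge0 _) hwC).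
  split.
    by split => // x /negP x1; rewrite /w (negbTE x1).
  apply: aeW => x; rewrite -[LHS]/((if `[< x <= 0 >] then jacobi w x else 0) - z * w x).
  rewrite /delta asboolb; case: ifP => x1; last first.
    by rewrite /w x1 mulr0 subr0; case: eqP => // e; rewrite e in x1.
  have [e|x2] := eqVneq x 0; last first.
    have [x3 x4 _ _ _] := int_lt0 x1 x2.
    rewrite /jacobi /w x1 x3 x4 /=.
    transitivity (- (jacobi psi x - z * psi x) / (kS%:C * psi 1)).
      by rewrite /jacobi; ring.
    by rewrite hpsi subrr oppr0 mul0r.
  rewrite e /jacobi /w add0r lexx ler10 /= mulr0 add0r.
  have := hpsi 0; rewrite /jacobi add0r crystal_J0// => h.
  transitivity (- ((kS%:C * psi 1 + (cJ (0 - 1))%:C * psi (0 - 1) + (cl 0)%:C * psi 0) - z * psi 0) / (kS%:C * psi 1) + 1).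
    by rewrite sub0r /=; field; rewrite p10.
  by rewrite h subrr oppr0 mul0r add0r.
have {}hw (x : int) : x <= 0 -> jacobi w x - z * w x = delta R 0 x.
  move=> x1; have := hw x.
  by rewrite -[LHS]/((if `[< x <= 0 >] then jacobi w x else 0) - z * w x) asboolb x1.
pose u x := if x == 1 then - (kS%:C)^-1 else w x.
have us : small_at_infinity u.
  move=> e e0; have [N hN] := l2_small lw e0; exists N.+2 => x xN.
  have [x0 x1] := int_abs_neq1 xN.
  by rewrite /u x0; apply: hN.
have hu x : x <= 0 -> jacobi u x = z * u x.
  move=> x1; have [e|x2] := eqVneq x 0.
    have := hw 0 isT; rewrite (_ : delta R 0 0 = 1); last by rewrite /delta eqxx.
    rewrite e /jacobi /u add0r /= crystal_J0// (w0 1)// mulr0 add0r => h.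
    by rewrite mulrN mulfV// -h; ring.
  have := hw x x1; rewrite /delta (negbTE x2) => /eqP; rewrite subr_eq0 => /eqP h.
  have [_ _ e1 e2 e3] := int_lt0 x1 x2.
  by rewrite /jacobi /u e1 e2 e3.
have hC' x : x <= 0 + 1 -> normc (psi x) <= C * rho.
  rewrite add0r => x0; apply: le_trans (hC x) _; rewrite ler_pM2l//.
  have [n ->] := int_le1_ex x0.
  rewrite expfzDr ?gt_eqF// expr1z -exprz_inv -exprnP ler_piMr ?(ltW r0)//.
  by rewrite exprn_ile1 ?(ltW ri0) ?(ltW ri1).
have := wronsk_neg hL hkS us hC' (fun x _ => hpsi x) hu.
rewrite /wronsk add0r crystal_J0// /u /= p0 => /eqP.
rewrite mulf_eq0 (negbTE kC)/= subr_eq0 => /eqP h.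
have -> : w 0 = w 0 * psi 1 / psi 1 by rewrite mulfK.
rewrite -h -p1; field.
by rewrite ?p10 ?kC.
Qed.

End WeylLeft.

Section RootLimit.
Variable R : realType.

(** The limiting quadratic has the two conjugate roots p0 and conj p0. Evaluated
at p, it is a0 (p - p0) (p - conj p0), and it tends to 0 because the
coefficients converge and p stays bounded. As Im p >= 0, the second factor is
at least Im p0, so p tends to p0. *)
Lemma root_limit (F : set_system R) {FF : Filter F} (a b c p : R -> R[i]) (a0 p0 : R[i]) :
  a0 != 0 -> 0 < Im p0 ->
  (a x : cplx R) @[x --> F] --> (a0 : cplx R) ->
  (b x : cplx R) @[x --> F] --> (- a0 * (p0 + conjc p0) : cplx R) ->
  (c x : cplx R) @[x --> F] --> (a0 * (p0 * conjc p0) : cplx R) ->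
  (\forall x \near F, a x * p x ^+ 2 + b x * p x + c x = 0 /\ 0 <= Im (p x)) ->
  (p x : cplx R) @[x --> F] --> (p0 : cplx R).
Proof.
move=> a00 p00 ha hb hc hp.
set b0 := - a0 * _ in hb; set c0 := a0 * (_ * _) in hc.
have na0 : 0 < normc a0 by rewrite normc_gt0.
pose be := normc b0 + normc c0 + 1.
have be0 : 0 < be by rewrite ltr_wpDl// addr_ge0 ?normc_ge0.
pose M := 1 + 4 * be / normc a0.
have M0 : 0 < M by rewrite ltr_wpDr// divr_ge0 ?mulr_ge0 ?ltW.
have bd : \forall x \near F, normc (p x) <= M.
  have h1 := @cvg_normc R R F FF _ _ ha.
  have h2 := @cvg_normc R R F FF _ _ hb; have h3 := @cvg_normc R R F FF _ _ hc.
  have nh1 : \forall x \near F, normc a0 / 2 < normc (a x).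
    by apply: (cvgr_gt _ h1); rewrite ltr_pdivrMr// ltr_pMr// ltr1n.
  have nh2 : \forall x \near F, normc (b x) < be.
    by apply: (cvgr_lt _ h2); rewrite /be -addrA ltrDl ltr_wpDl ?normc_ge0.
  have nh3 : \forall x \near F, normc (c x) < be.
    by apply: (cvgr_lt _ h3); rewrite /be addrAC ltrDr ltr_wpDl ?normc_ge0.
  near=> x; have [e _] : a x * p x ^+ 2 + b x * p x + c x = 0 /\ 0 <= Im (p x) by near: x.
  have k1 : normc a0 / 2 < normc (a x) by near: x.
  have k2 : normc (b x) < be by near: x.
  have k3 : normc (c x) < be by near: x.
  have [p1|p1] := leP (normc (p x)) 1.
    by rewrite (le_trans p1)// lerDl divr_ge0 ?mulr_ge0 ?ltW.
  have e2 : normc (a x) * normc (p x) ^+ 2 <= be * normc (p x) + be.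
    rewrite -normcX -normcM (_ : a x * _ = - (b x * p x + c x)); last first.
      by apply/eqP; rewrite -subr_eq0 opprK addrA e.
    rewrite normcN; apply: le_trans (normcD _ _) _; rewrite normcM lerD ?ler_wpM2r ?normc_ge0 ?(ltW k2) ?(ltW k3)//.
  have e3 : normc a0 / 2 * normc (p x) ^+ 2 <= 2 * be * normc (p x).
    have : normc a0 / 2 * normc (p x) ^+ 2 <= normc (a x) * normc (p x) ^+ 2.
      by rewrite ler_wpM2r ?sqr_ge0 ?(ltW k1).
    have : be <= be * normc (p x) by rewrite ler_peMr ?ltW.
    lra.
  have e4 : normc (p x) <= 4 * be / normc a0.
    rewrite ler_pdivlMr//; have p2 : 0 < normc (p x) by apply: lt_trans p1.
    have : (normc a0 * normc (p x) - 4 * be) * normc (p x) <= 0 by move: e3; rewrite expr2; lra.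
    rewrite pmulr_lle0// subr_le0; lra.
  by rewrite (le_trans e4)// lerDr.
apply/cvg_complexE.
pose g x := (normc (a0 - a x) * M ^+ 2 + normc (b0 - b x) * M + normc (c0 - c x)) / (normc a0 * Im p0).
have g0 : g x @[x --> F] --> 0.
  have z (f : R -> R[i]) l : (f x : cplx R) @[x --> F] --> (l : cplx R) ->
      normc (l - f x) @[x --> F] --> 0.
    by move=> /cvg_complexE; under eq_fun do rewrite normc_distC.
  have -> : (0 : R) = (0 * M ^+ 2 + 0 * M + 0) / (normc a0 * Im p0) by rewrite !mul0r !addr0 mul0r.
  apply: cvgM; last exact: cvg_cst.
  apply: cvgD; last exact: z.
  by apply: cvgD; apply: cvgM; (exact: cvg_cst || exact: z).
apply: (@squeeze_cvgr _ _ _ _ (cst 0) g) => //; last exact: cvg_cst.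
near=> x; have [e i0] : a x * p x ^+ 2 + b x * p x + c x = 0 /\ 0 <= Im (p x) by near: x.
have pM : normc (p x) <= M by near: x.
rewrite normc_ge0/= /g ler_pdivlMr ?mulr_gt0//.
(* p is in the closed upper half-plane, conj p0 in the lower one *)
have i1 : Im p0 <= normc (p x - conjc p0).
  apply: le_trans (normc_Im _); rewrite ImD ImN ImJ opprK.
  by rewrite (le_trans _ (ler_norm _))// lerDr.
apply: (@le_trans _ _ (normc (a0 * ((p x - p0) * (p x - conjc p0))))).
  rewrite !normcM mulrCA ler_wpM2l ?normc_ge0// ler_wpM2l ?normc_ge0//.
have -> : a0 * ((p x - p0) * (p x - conjc p0)) =
   (a0 - a x) * p x ^+ 2 + (b0 - b x) * p x + (c0 - c x).
  rewrite /b0 /c0; transitivity (a0 * ((p x - p0) * (p x - conjc p0)) - (a x * p x ^+ 2 + b x * p x + c x)).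
    by rewrite e subr0.
  ring.
apply: le_trans (normcD _ _) _; rewrite lerD2r.
apply: le_trans (normcD _ _) _; rewrite (normcM (a0 - a x)) (normcM (b0 - b x)) normcX.
apply: lerD; apply: ler_wpM2l; rewrite ?normc_ge0//.
by rewrite ler_sqr ?nnegrE ?normc_ge0 ?(ltW M0).
Unshelve. all: by end_near. Qed.

End RootLimit.

Section WeylLimit.
Variables (R : realType) (L : nat) (J lam : int -> R) (kS : R).
Hypothesis hL : (1 <= L)%N.
Hypothesis hJ : forall x : int, 1 <= x < L%:Z -> J x != 0.
Hypothesis hkS : kS != 0.

Local Notation trC := (transfer L J lam kS (real_complex R)).
Local Notation t11 z := (tr11 L J lam kS (real_complex R) z L).
Local Notation t12 z := (tr12 L J lam kS (real_complex R) z L).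
Local Notation t21 z := (tr21 L J lam kS (real_complex R) z L).
Local Notation t22 z := (tr22 L J lam kS (real_complex R) z L).
Local Notation p11 := (tr11 L J lam kS polyC 'X L).
Local Notation p12 := (tr12 L J lam kS polyC 'X L).
Local Notation p21 := (tr21 L J lam kS polyC 'X L).
Local Notation p22 := (tr22 L J lam kS polyC 'X L).
Local Notation D := (discr L J lam kS).

Lemma cvg_boundary (E : R) :
  (E +i* eps : cplx R) @[eps --> (0 : R)^'+] --> (E%:C : cplx R).
Proof.
apply: cvg_ReIm => /=; first exact: cvg_cst.
exact: cvg_at_right_filter.
Qed.

Lemma transfer_cvg (F : set_system R) {FF : Filter F} (Z : R -> R[i]) (z : R[i]) n
    (V : R -> R[i] * R[i]) v :
  (Z x : cplx R) @[x --> F] --> (z : cplx R) ->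
  ((V x).1 : cplx R) @[x --> F] --> (v.1 : cplx R) ->
  ((V x).2 : cplx R) @[x --> F] --> (v.2 : cplx R) ->
  ((trC (Z x) n (V x)).1 : cplx R) @[x --> F] --> ((trC z n v).1 : cplx R) /\
  ((trC (Z x) n (V x)).2 : cplx R) @[x --> F] --> ((trC z n v).2 : cplx R).
Proof.
move=> hz h1 h2; elim: n => [|n [IH1 IH2]]; first exact: conj h1 h2.
rewrite /=; split; last first.
  by apply: cvg_cM IH1; exact: cvg_cst.
apply: cvg_cD.
  apply: cvg_cM IH1; apply: cvg_cM; last exact: cvg_cst.
  by apply: cvg_cD hz _; exact: cvg_cst.
by apply: cvg_cN; apply: cvg_cM IH2; exact: cvg_cst.
Qed.

(** Over one cell the current of an eigenvector is multiplied by |mu|^2 and, for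
Im z > 0, strictly increases. So |mu| is not 1, the two multipliers mu and
1/mu are on either side of the unit circle, and the sign of the current tells
which is which. *)
Lemma weyl_eigen z : 0 < Im z -> exists mu v v',
  [/\ mu != 0, normc mu < 1,
    trC z L v = (mu * v.1, mu * v.2) /\ trC z L v' = (mu^-1 * v'.1, mu^-1 * v'.2),
    Im (conjc v.2 * v.1) < 0 & 0 < Im (conjc v'.2 * v'.1)].
Proof.
move=> z0.
pose d := t11 z + t22 z.
(* flux through one cell *)
have key mu v : mu != 0 -> v != (0, 0) -> trC z L v = (mu * v.1, mu * v.2) ->
    0 < (normc mu ^+ 2 - 1) * Im (conjc v.2 * v.1).
  move=> mu0 v0 hv; have := flux lam hL hJ hkS z L v; rewrite hv /=.
  have -> : Im (conjc (mu * v.2) * (mu * v.1)) = normc mu ^+ 2 * Im (conjc v.2 * v.1).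
    by rewrite normc_sq !(ReM, ImM, ReJ, ImJ); ring.
  move=> e; rewrite mulrBl mul1r e addrAC subrr add0r mulr_gt0//.
  rewrite lt_def sumr_ge0 ?andbT//; last by move=> k _; rewrite sqr_ge0.
  apply: contra_neq v0 => /eqP; rewrite psumr_eq0; last by move=> k _; rewrite sqr_ge0.
  move=> /allP h.
  have {}h k : (k < L)%N -> (trC z k.+1 v).2 = 0.
    move=> kL; have := h (Ordinal kL) (mem_index_enum _).
    by rewrite /= expf_eq0 /= normc_eq0 => /eqP.
  have e1 : v.1 = 0.
    have := h 0%N hL; rewrite /= crystal_J0// => /eqP; rewrite mulf_eq0 => /orP[|/eqP//].
    by rewrite -normc_eq0 normcR normr_eq0 invr_eq0 (negbTE hkS).
  have := h L.-1; rewrite prednK// leqnn hv /= => /(_ isT)/eqP.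
  by rewrite mulf_eq0 (negbTE mu0)/= => /eqP; case: (v) e1 => v1 v2 /= -> ->.
have [mu hmu] : exists mu, mu ^+ 2 - d * mu + 1 = 0.
  exists ((d + sqrtc (d ^+ 2 - 4)) / 2).
  transitivity ((sqrtc (d ^+ 2 - 4) ^+ 2 - d ^+ 2 + 4) / 4); first by field.
  by rewrite sqr_sqrtc; field.
have mu0 : mu != 0.
  by apply/eqP => e; move/eqP: hmu; rewrite e expr0n /= mulr0 subr0 add0r oner_eq0.
have hmu' : mu^-1 ^+ 2 - d * mu^-1 + 1 = 0.
  have -> : mu^-1 ^+ 2 - d * mu^-1 + 1 = mu^-1 ^+ 2 * (mu ^+ 2 - d * mu + 1) by field.
  by rewrite hmu mulr0.
have main nu : nu != 0 -> normc nu < 1 -> nu ^+ 2 - d * nu + 1 = 0 ->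
    nu^-1 ^+ 2 - d * nu^-1 + 1 = 0 -> exists v v',
  [/\ trC z L v = (nu * v.1, nu * v.2) /\ trC z L v' = (nu^-1 * v'.1, nu^-1 * v'.2),
    Im (conjc v.2 * v.1) < 0 & 0 < Im (conjc v'.2 * v'.1)].
  move=> nu0 nu1 h h'.
  have [v v0 hv] := eigenvector_exists hL hJ hkS h.
  have [v' v0' hv'] := eigenvector_exists hL hJ hkS h'.
  have nui0 : nu^-1 != 0 by rewrite invr_eq0.
  exists v, v'; split => //.
    have := key _ _ nu0 v0 hv; rewrite nmulr_rgt0// subr_lt0.
    by rewrite expr_lt1 ?normc_ge0.
  have := key _ _ nui0 v0' hv'; rewrite pmulr_rgt0// subr_gt0 Normc.normcV exprVn.
  by rewrite invf_gt1 ?expr_lt1 ?normc_ge0// exprn_gt0// normc_gt0.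
have [lt1|] := ltP (normc mu) 1.
  by have [v [v' [h1 h2 h3]]] := main mu mu0 lt1 hmu hmu'; exists mu, v, v'.
rewrite le_eqVlt => /orP[/eqP e|gt1].
  have [v v0 hv] := eigenvector_exists hL hJ hkS hmu.
  by have := key _ _ mu0 v0 hv; rewrite -e expr1n subrr mul0r ltxx.
have lt1 : normc mu^-1 < 1 by rewrite Normc.normcV invf_lt1// (lt_trans _ gt1).
have mui0 : mu^-1 != 0 by rewrite invr_eq0.
have [|v [v' [h1 h2 h3]]] := main _ mui0 lt1 hmu'; first by rewrite invrK.
by exists mu^-1, v, v'.
Qed.

(** The ratio -v1/v2 of an eigenvector of a matrix is a fixed point of the
corresponding Moebius map, that is, a root of this quadratic; the sign of its
imaginary part is the sign of the current. *)
Lemma weyl_right_root z : 0 < Im z ->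
  let p := (kS ^+ 2)%:C * green (h_crystal L J lam kS [set x | 1 <= x]) (delta R 1) (delta R 1) z in
  t21 z * p ^+ 2 + (t11 z - t22 z) * p + - t12 z = 0 /\ 0 <= Im p.
Proof.
move=> z0 p; have [mu [v [v' [mu0 mu1 [hv _] s _]]]] := weyl_eigen z0.
have v20 : v.2 != 0.
  by apply/eqP => e; move: s; rewrite e conjc0 mul0r /= ltxx.
have pE : p = - (v.1 / v.2).
  rewrite /p (green_right hL hJ hkS mu0 mu1 hv v20) mulrCA mulfV ?mulr1//.
  by rewrite -normc_eq0 normcR normr_eq0 expf_eq0.
rewrite pE; split; last first.
  have nv : 0 < normc v.2 ^+ 2 by rewrite exprn_gt0// normc_gt0.
  rewrite ImN oppr_ge0 -(pmulr_rle0 _ nv) Im_div_normc// mulrC ltW//.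
move: hv; rewrite transferE => -[e1 e2].
have -> : t21 z * (- (v.1 / v.2)) ^+ 2 + (t11 z - t22 z) * - (v.1 / v.2) - t12 z =
  ((t21 z * v.1 + t22 z * v.2) * v.1 - (t11 z * v.1 + t12 z * v.2) * v.2) / v.2 ^+ 2.
  by field; rewrite v20.
by rewrite e1 e2 (_ : mu * v.2 * v.1 - mu * v.1 * v.2 = 0) ?mul0r//; ring.
Qed.

Lemma weyl_left_root z : 0 < Im z ->
  let q := green (h_crystal L J lam kS [set x | x <= 0]) (delta R 0) (delta R 0) z in
  t12 z * q ^+ 2 + (t22 z - t11 z) * q + - t21 z = 0 /\ 0 <= Im q.
Proof.
move=> z0 q; have [mu [v' [v [mu0 mu1 [_ hv] _ s]]]] := weyl_eigen z0.
have v10 : v.1 != 0.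
  by apply/eqP => e; move: s; rewrite e mulr0 /= ltxx.
have mui1 : 1 < normc mu^-1 by rewrite Normc.normcV invf_gt1// normc_gt0.
have qE : q = - (v.2 / v.1) by rewrite /q (green_left hL hJ hkS mui1 hv v10).
rewrite qE; split; last first.
  have nv : 0 < normc v.1 ^+ 2 by rewrite exprn_gt0// normc_gt0.
  rewrite ImN oppr_ge0 -(pmulr_rle0 _ nv) Im_div_normc//.
  move: s; rewrite !(ImM, ReJ, ImJ); lra.
move: hv; rewrite transferE => -[e1 e2].
have -> : t12 z * (- (v.2 / v.1)) ^+ 2 + (t22 z - t11 z) * - (v.2 / v.1) - t21 z =
  ((t11 z * v.1 + t12 z * v.2) * v.2 - (t21 z * v.1 + t22 z * v.2) * v.1) / v.1 ^+ 2.
  by field; rewrite v10.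
by rewrite e1 e2 (_ : mu^-1 * v.1 * v.2 - mu^-1 * v.2 * v.1 = 0) ?mul0r//; ring.
Qed.

(** Inside a band the quadratic equation of the Weyl function has real
coefficients and negative discriminant. Its root in the upper half-plane
x + i y is the boundary value of kS^2 m_r by the continuity of that root, and
m_l is the corresponding root of the inverse equation. *)
Lemma weyl_limits (E : R) : D.[E] ^+ 2 < 4 -> exists x y : R,
  [/\ 0 < y, p21.[E] != 0, p22.[E] - p11.[E] = 2 * p21.[E] * x,
      p12.[E] = - p21.[E] * (x ^+ 2 + y ^+ 2) &
      (kS ^+ 2)%:C * weyl_r L J lam kS E = x +i* y /\
      (kS ^+ 2)%:C * weyl_l L J lam kS E = (kS ^+ 2)%:C / (x -i* y)].
Proof.
move=> hE; have dt := det_real lam hL hJ hkS E; have := hE.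
rewrite /discr hornerD => hE'.
set a := p21.[E] in dt hE' *; set b := p12.[E] in dt hE' *.
set c := p11.[E] in dt hE' *; set d := p22.[E] in dt hE' *.
have a0 : a != 0.
  apply/eqP => e; rewrite e mulr0 subr0 in dt.
  have : (c - d) ^+ 2 < 0.
    have -> : (c - d) ^+ 2 = (c + d) ^+ 2 - 4 * (c * d) by ring.
    by rewrite dt; lra.
  by rewrite ltNge sqr_ge0.
pose w := 4 - (c + d) ^+ 2; have w0 : 0 < w by rewrite subr_gt0.
pose x := (d - c) / (2 * a); pose y := Num.sqrt w / (2 * `|a|).
have y0 : 0 < y by rewrite divr_gt0 ?sqrtr_gt0// mulr_gt0 ?normr_gt0.
have e1 : d - c = 2 * a * x by rewrite /x; field.
have yy : y ^+ 2 = w / (4 * a ^+ 2).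
  rewrite /y exprMn sqr_sqrtr ?(ltW w0)// exprVn exprMn real_normK ?num_real//.
  by rewrite -natrX.
have e2 : b = - a * (x ^+ 2 + y ^+ 2).
  have -> : b = (c * d - 1) / a by rewrite -dt; field.
  by rewrite yy /x /w; field.
exists x, y; split => //.
have r0 : 0 < x ^+ 2 + y ^+ 2 by rewrite ltr_wpDl ?sqr_ge0// exprn_gt0.
have b0 : b != 0 by rewrite e2 mulf_neq0 ?oppr_eq0 ?a0 ?gt_eqF //.
have C0 (u : R) : u != 0 -> u%:C != 0 by move=> ?; rewrite -normc_eq0 normcR normr_eq0.
have [k11 k21] :
    (t11 (E +i* e) : cplx R) @[e --> (0 : R)^'+] --> (c%:C : cplx R) /\
    (t21 (E +i* e) : cplx R) @[e --> (0 : R)^'+] --> (a%:C : cplx R).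
  rewrite /c /a -t11_real -t21_real.
  apply: (@transfer_cvg _ _ (fun e => E +i* e) E%:C L (fun=> (1, 0)) (1, 0));
    [exact: cvg_boundary|exact: cvg_cst|exact: cvg_cst].
have [k12 k22] :
    (t12 (E +i* e) : cplx R) @[e --> (0 : R)^'+] --> (b%:C : cplx R) /\
    (t22 (E +i* e) : cplx R) @[e --> (0 : R)^'+] --> (d%:C : cplx R).
  rewrite /b /d -t12_real -t22_real.
  apply: (@transfer_cvg _ _ (fun e => E +i* e) E%:C L (fun=> (0, 1)) (0, 1));
    [exact: cvg_boundary|exact: cvg_cst|exact: cvg_cst].
have pos : \forall e \near (0 : R)^'+, 0 < Im (E +i* e) by exact: nbhs_right_gt.
split.
  have hlim := @root_limit R ((0 : R)^'+) _ _ _ _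
    (fun e => (kS ^+ 2)%:C * green (h_crystal L J lam kS [set x | 1 <= x]) (delta R 1) (delta R 1) (E +i* e))
    a%:C (x +i* y) (C0 _ a0) y0 k21 _ _ (filterS (fun e he => weyl_right_root he) pos).
  have {hlim} hlim := hlim _ _.
  have k2C : (kS ^+ 2)%:C != 0 by apply: C0; rewrite expf_eq0.
  have -> : weyl_r L J lam kS E = (kS ^+ 2)%:C^-1 * (x +i* y).
    apply: boundary_valueE.
    have e z : green (h_crystal L J lam kS [set x | 1 <= x]) (delta R 1) (delta R 1) z =
        (kS ^+ 2)%:C^-1 * ((kS ^+ 2)%:C * green (h_crystal L J lam kS [set x | 1 <= x]) (delta R 1) (delta R 1) z).
      by rewrite mulKf.
    under eq_fun do rewrite e.
    apply: cvg_cM; first exact: cvg_cst.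
    apply: hlim.
      have -> : - a%:C * ((x +i* y) + conjc (x +i* y)) = c%:C - d%:C.
        apply: complex_eq => /=; last by ring.
        by transitivity (- (d - c)); [rewrite e1; ring|ring].
      exact: (cvg_cD k11 (cvg_cN k22)).
    have -> : a%:C * ((x +i* y) * conjc (x +i* y)) = - b%:C.
      by rewrite e2; apply: complex_eq => /=; ring.
    exact: (cvg_cN k12).
  by rewrite mulVKf.
have hlim := @root_limit R ((0 : R)^'+) _ _ _ _
  (fun e => green (h_crystal L J lam kS [set x | x <= 0]) (delta R 0) (delta R 0) (E +i* e))
  b%:C ((x / (x ^+ 2 + y ^+ 2)) +i* (y / (x ^+ 2 + y ^+ 2))) (C0 _ b0) (divr_gt0 y0 r0) k12 _ _ (filterS (fun e he => weyl_left_root he) pos).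
have -> : weyl_l L J lam kS E = ((x / (x ^+ 2 + y ^+ 2)) +i* (y / (x ^+ 2 + y ^+ 2))).
  apply: boundary_valueE; apply: hlim.
    have -> : - b%:C * (((x / (x ^+ 2 + y ^+ 2)) +i* (y / (x ^+ 2 + y ^+ 2))) + conjc ((x / (x ^+ 2 + y ^+ 2)) +i* (y / (x ^+ 2 + y ^+ 2)))) = d%:C - c%:C.
      apply: complex_eq => /=; last by ring.
      by rewrite e1 e2; field; rewrite gt_eqF.
    exact: (cvg_cD k22 (cvg_cN k11)).
  have -> : b%:C * (((x / (x ^+ 2 + y ^+ 2)) +i* (y / (x ^+ 2 + y ^+ 2))) * conjc ((x / (x ^+ 2 + y ^+ 2)) +i* (y / (x ^+ 2 + y ^+ 2)))) = - a%:C.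
    rewrite e2; apply: complex_eq => /=; last by ring.
    by field; rewrite gt_eqF.
  exact: (cvg_cN k21).
congr (_ * _); apply: complex_eq => /=; first by rewrite sqrrN.
by rewrite sqrrN; field; rewrite gt_eqF.
Qed.

End WeylLimit.

(** * The reservoirs *)

Lemma ae_imp d (T : measurableType d) (R : realType) (mu : {measure set T -> \bar R})
    (P Q : T -> Prop) : (forall x, P x -> Q x) ->
  {ae mu, forall x, P x} -> {ae mu, forall x, Q x}.
Proof.
move=> h [A [mA A0 sA]]; exists A; split => //.
by apply: subset_trans sA => x; apply: contra_not; exact: h.
Qed.

Section Reservoirs.
Variable R : realType.

Lemma sub_real_neq0 (z : R[i]) (x : R) : Im z != 0 -> x%:C - z != 0.
Proof.
by move=> z0; rewrite subr_eq0; apply: contra_neq z0 => <-.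
Qed.

Lemma normc_resolvent_le (z : R[i]) (x : R) : Im z != 0 ->
  normc ((x%:C - z)^-1) <= `|Im z|^-1.
Proof.
move=> z0; rewrite Normc.normcV lef_pV2 ?posrE ?normr_gt0//.
  by apply: le_trans (normc_Im _); rewrite ImD ImN ImC sub0r normrN.
by rewrite normc_gt0 sub_real_neq0.
Qed.

Lemma continuous_cmeasurable (f : R -> R[i]) :
  (forall x0 : R, (f x : cplx R) @[x --> x0] --> (f x0 : cplx R)) ->
  @cmeasurable _ (measurableTypeR R) R f.
Proof.
move=> h; split; apply: measurable_realfun.continuous_measurable_fun => x; [exact: cvg_Re (h x)|exact: cvg_Im (h x)].
Qed.

Lemma resolvent_continuous (z : R[i]) (x0 : R) : Im z != 0 ->
  ((x%:C - z)^-1 : cplx R) @[x --> x0] --> ((x0%:C - z)^-1 : cplx R).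
Proof.
move=> z0; apply: cvg_cV; first exact: sub_real_neq0.
apply: cvg_cD; last exact: cvg_cst.
by apply: cvg_ReIm; [exact: cvg_id|exact: cvg_cst].
Qed.

Section Measure.
Variable nu : probability (measurableTypeR R) R.
Local Notation H := (L2 nu).

Lemma bounded_integrable (f : R -> R) M : measurable_fun setT (f : measurableTypeR R -> R) ->
  (forall x, `|f x| <= M) -> nu.-integrable setT (EFin \o f).
Proof.
move=> mf fM; apply: (@le_integrable _ _ _ nu setT measurableT (EFin \o f) (EFin \o cst M)); last exact: finite_measure_integrable_cst.
- exact/measurable_EFinP.
- by move=> x _ /=; rewrite lee_fin (le_trans (fM x))// ler_norm.
Qed.

Lemma bounded_L2 (f : R -> R[i]) M : @cmeasurable _ (measurableTypeR R) R f ->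
  (forall x, normc (f x) <= M) -> @hmem R H f.
Proof.
move=> mf fM; split => //.
have M0 : 0 <= M by apply: le_trans (normc_ge0 _) (fM 0).
apply: (@le_lt_trans _ _ (\int[nu]_x (cst (M ^+ 2)%:E x))%E).
  apply: ge0_le_integral => //.
  - by move=> x _; rewrite lee_fin sqr_ge0.
  - apply/measurable_EFinP; case: mf => m1 m2.
    rewrite (_ : (fun x => _) = (fun x => Re (f x) ^+ 2 + Im (f x) ^+ 2)).
      by apply: measurable_funD; apply: measurable_funX.
    by apply/funext => x; rewrite normc_sq.
  - by move=> x _; rewrite lee_fin ler_sqr ?nnegrE ?normc_ge0.
by rewrite integral_cst// [X in (_ * X)%E]probability_setT mule1 ltry.
Qed.

Definition borel (z : R[i]) : R[i] := cintegral nu (fun x => (x%:C - z)^-1).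

Lemma resolvent_cmeasurable z : Im z != 0 ->
  @cmeasurable _ (measurableTypeR R) R (fun x : R => (x%:C - z)^-1).
Proof.
by move=> z0; apply: continuous_cmeasurable => x; apply: resolvent_continuous.
Qed.

Lemma cmeasurableZ (c : R[i]) (f : R -> R[i]) : @cmeasurable _ (measurableTypeR R) R f ->
  @cmeasurable _ (measurableTypeR R) R (fun x => c * f x).
Proof.
move=> [m1 m2]; split.
  rewrite (_ : (fun x => _) = (fun x => Re c * Re (f x) - Im c * Im (f x))).
    by apply: measurable_funB; apply: measurable_funM.
  by apply/funext => x; rewrite ReM.
rewrite (_ : (fun x => _) = (fun x => Re c * Im (f x) + Im c * Re (f x))).
  by apply: measurable_funD; apply: measurable_funM.
by apply/funext => x; rewrite ImM.
Qed.

Lemma res_exists (z c : R[i]) : Im z != 0 ->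
  odom (h_res nu) (fun x : R => c * (x%:C - z)^-1).
Proof.
move=> z0; have mr := resolvent_cmeasurable z0; split.
  apply: (@bounded_L2 _ (normc c / `|Im z|)); first exact: cmeasurableZ.
  by move=> x; rewrite normcM ler_wpM2l ?normc_ge0 ?normc_resolvent_le.
have e : (fun x : R => x%:C * (c * (x%:C - z)^-1)) = (fun x => c + (c * z) * (x%:C - z)^-1).
  by apply/funext => x; field; apply: sub_real_neq0.
rewrite [X in hmem X]e.
apply: (@bounded_L2 _ (normc c + normc (c * z) / `|Im z|)).
  have [m1 m2] := cmeasurableZ (c * z) mr; split.
    rewrite (_ : (fun x => _) = (fun x => Re c + Re (c * z * (x%:C - z)^-1))).
      exact: measurable_funD.
    by apply/funext => x; rewrite ReD.
  rewrite (_ : (fun x => _) = (fun x => Im c + Im (c * z * (x%:C - z)^-1))).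
    exact: measurable_funD.
  by apply/funext => x; rewrite ImD.
move=> x; apply: le_trans (normcD _ _) _; rewrite lerD2l (normcM (c * z)).
by rewrite ler_wpM2l ?normc_ge0 ?normc_resolvent_le.
Qed.

Lemma borelZ (c z : R[i]) : Im z != 0 ->
  cintegral nu (fun x => c * (x%:C - z)^-1) = c * borel z.
Proof.
move=> z0; have [m1 m2] := resolvent_cmeasurable z0.
have i1 : nu.-integrable setT (EFin \o (fun x : R => Re ((x%:C - z)^-1))).
  apply: (bounded_integrable m1 (M := `|Im z|^-1)) => x.
  exact: le_trans (normc_Re _) (normc_resolvent_le _ z0).
have i2 : nu.-integrable setT (EFin \o (fun x : R => Im ((x%:C - z)^-1))).
  apply: (bounded_integrable m2 (M := `|Im z|^-1)) => x.
  exact: le_trans (normc_Im _) (normc_resolvent_le _ z0).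
have iZ a (f : R -> R) : nu.-integrable setT (EFin \o f) ->
  nu.-integrable setT (EFin \o (fun x => a * f x)).
  by move=> h; apply: (integrableZl measurableT a h).
apply: complex_eq; rewrite ?ReM ?ImM /=.
  rewrite -!RintegralZl// -RintegralB//; try exact: iZ.
  by apply: eq_Rintegral => x _; rewrite ReM.
rewrite -!RintegralZl// -RintegralD//; try exact: iZ.
by apply: eq_Rintegral => x _; rewrite ImM.
Qed.

Lemma res_unique (u : R -> R[i]) (c z : R[i]) : Im z != 0 -> @hmem R H u ->
  {ae nu, forall x, x%:C * u x - z * u x = c} -> hip (chi nu) u = c * borel z.
Proof.
move=> z0 [[mu1 mu2] _] hu; rewrite -borelZ//.
have [m1 m2] := cmeasurableZ c (resolvent_cmeasurable z0).
have hu' : {ae nu, forall x, u x = c * (x%:C - z)^-1}.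
  apply: ae_imp hu => x <-; rewrite -mulrBl mulrAC mulfV ?mul1r//.
  exact: sub_real_neq0.
have e x : (conjc (chi nu x) * u x) = u x.
  by rewrite (_ : conjc _ = 1) ?mul1r//; apply: complex_eq; rewrite /= ?oppr0.
rewrite [LHS]/(cintegral _ _); apply: complex_eq; congr fine.
  apply: ae_eq_integral => //=; try exact/measurable_EFinP.
    by apply/measurable_EFinP; under eq_fun do rewrite e.
  by apply: ae_imp hu' => x ux _; rewrite e ux.
apply: ae_eq_integral => //=; try exact/measurable_EFinP.
  by apply/measurable_EFinP; under eq_fun do rewrite e.
by apply: ae_imp hu' => x ux _; rewrite e ux.
Qed.

Lemma green_res z : Im z != 0 -> green (h_res nu) (chi nu) (chi nu) z = borel z.
Proof.
move=> z0; apply: greenE => [|u [mu _] hu].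
  exists (fun x => 1 * (x%:C - z)^-1); split; first exact: res_exists.
  apply: aeW => x.
  rewrite -[LHS]/(x%:C * (1 * (x%:C - z)^-1) - z * (1 * (x%:C - z)^-1)).
  by rewrite -mulrBl mul1r mulfV// sub_real_neq0.
by rewrite (@res_unique u 1 z)// ?mul1r.
Qed.

Lemma borel_lipschitz (E E' e : R) : 0 < e ->
  normc (borel (E +i* e) - borel (E' +i* e)) <= 2 * (`|E - E'| / e ^+ 2).
Proof.
move=> e0.
have z0 : Im (E +i* e) != 0 by rewrite /= gt_eqF.
have z0' : Im (E' +i* e) != 0 by rewrite /= gt_eqF.
pose d (x : R) := (x%:C - (E +i* e))^-1 - (x%:C - (E' +i* e))^-1.
have dle x : normc (d x) <= `|E - E'| / e ^+ 2.
  have -> : d x = (E - E')%:C * ((x%:C - (E +i* e))^-1 * (x%:C - (E' +i* e))^-1).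
    rewrite /d (_ : (E - E')%:C = (E +i* e) - (E' +i* e)); last first.
      by apply: complex_eq => //=; rewrite subrr.
    by field; rewrite !sub_real_neq0.
  rewrite !normcM normcR ler_wpM2l// expr2 invfM.
  have h1 := normc_resolvent_le x z0; have h2 := normc_resolvent_le x z0'.
  by rewrite /= gtr0_norm// in h1 h2; apply: ler_pM => //; rewrite normc_ge0.
have int z : Im z != 0 -> nu.-integrable setT (EFin \o (fun x : R => Re ((x%:C - z)^-1))) /\
    nu.-integrable setT (EFin \o (fun x : R => Im ((x%:C - z)^-1))).
  move=> zn0; have [m1 m2] := resolvent_cmeasurable zn0; split.
    apply: (bounded_integrable m1 (M := `|Im z|^-1)) => x.
    exact: le_trans (normc_Re _) (normc_resolvent_le _ zn0).
  apply: (bounded_integrable m2 (M := `|Im z|^-1)) => x.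
  exact: le_trans (normc_Im _) (normc_resolvent_le _ zn0).
have [r1 i1] := int _ z0; have [r2 i2] := int _ z0'.
have bnd (g : R -> R) M : nu.-integrable setT (EFin \o g) -> (forall x, `|g x| <= M) ->
    `|\int[nu]_x g x| <= M.
  move=> ig gM; apply: le_trans (le_normr_Rintegral measurableT ig) _.
  apply: (@le_trans _ _ (\int[nu]_x (cst M x))).
    apply: le_Rintegral => //; first exact: integrable_norm.
    exact: finite_measure_integrable_cst.
  by rewrite Rintegral_cst// [X in fine X]probability_setT mulr1.
apply: le_trans (normc_le _) _; rewrite mulr_natl mulr2n; apply: lerD.
  have -> : Re (borel (E +i* e) - borel (E' +i* e)) =
      \int[nu]_x (Re ((x%:C - (E +i* e))^-1) - Re ((x%:C - (E' +i* e))^-1)).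
    by rewrite RintegralB// ReD ReN.
  apply: bnd; first exact: (integrableB measurableT r1 r2).
  by move=> x; rewrite -ReN -ReD; apply: le_trans (normc_Re _) (dle x).
have -> : Im (borel (E +i* e) - borel (E' +i* e)) =
    \int[nu]_x (Im ((x%:C - (E +i* e))^-1) - Im ((x%:C - (E' +i* e))^-1)).
  by rewrite RintegralB// ImD ImN.
apply: bnd; first exact: (integrableB measurableT i1 i2).
by move=> x; rewrite -ImN -ImD; apply: le_trans (normc_Im _) (dle x).
Qed.

(** A limit that does not exist has the default value 0, whose imaginary part is
not positive. *)
Lemma F_res_cvg (E : R) : 0 < Im (F_res nu E) ->
  (borel (E +i* e) : cplx R) @[e --> (0 : R)^'+] --> (F_res nu E : cplx R).
Proof.
move=> h; have [c|nc] := pselect (cvg ((green (h_res nu) (chi nu) (chi nu) (E +i* e) : cplx R) @[e --> (0 : R)^'+])); last first.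
  by move: h; rewrite /F_res /boundary_value (dvgP nc) /= ltxx.
apply: cvg_trans c; apply: near_eq_cvg.
near=> e; apply/esym; rewrite green_res//= gt_eqF//.
Unshelve. all: by end_near. Qed.

End Measure.
End Reservoirs.

(** * Measurability of boundary values *)

Section BoundaryMeasurable.
Variable R : realType.
Variable G : R[i] -> R[i].
Hypothesis cG : forall e E0, 0 < e ->
  (G (E +i* e) : cplx R) @[E --> E0] --> (G (E0 +i* e) : cplx R).

(* oscillation larger than 1/(k+1) at heights below 1/(n+1) *)
Let U (n k : nat) : set R := [set E | exists e e' : R,
  [/\ 0 < e < n.+1%:R^-1, 0 < e' < n.+1%:R^-1 &
      k.+1%:R^-1 < normc (G (E +i* e) - G (E +i* e'))]].

Let U_open n k : open (U n k).
Proof.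
rewrite openE => E [e [e' [he he' h]]].
have e0 : 0 < e by case/andP: he. have e0' : 0 < e' by case/andP: he'.
have c : normc (G (E' +i* e) - G (E' +i* e')) @[E' --> E] -->
    normc (G (E +i* e) - G (E +i* e')).
  by apply: cvg_normc; apply: cvg_cD; [exact: cG|apply: cvg_cN; exact: cG].
have h' : \forall E' \near E, k.+1%:R^-1 < normc (G (E' +i* e) - G (E' +i* e')).
  exact: (cvgr_gt _ c).
by apply: filterS h' => E' hE'; exists e, e'.
Qed.

Let S : set R := \bigcap_k \bigcup_n ~` U n k.

Let mS : measurable (S : set (measurableTypeR R)).
Proof.
apply: bigcap_measurable => // k _; apply: bigcup_measurable => n _.
by apply: measurableC; apply: open_measurable.
Qed.

Lemma inv_lt_exists (e : R) : 0 < e -> exists n : nat, n.+1%:R^-1 < e.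
Proof.
move=> e0; exists (Num.truncn e^-1); rewrite -[ltRHS]invrK ltf_pV2 ?posrE ?invr_gt0//.
by rewrite truncnS_gt// invr_ge0 ltW.
Qed.

Let cvg_S E (l : R[i]) :
  (G (E +i* e) : cplx R) @[e --> (0 : R)^'+] --> (l : cplx R) -> S E.
Proof.
move=> /cvg_complexE /cvgrPdist_lt h k _.
have k0 : 0 < k.+1%:R^-1 / 2 :> R by rewrite divr_gt0// invr_gt0.
have [d /= d0 hd] := h _ k0.
have [n hn] := inv_lt_exists d0.
have close e : 0 < e < n.+1%:R^-1 -> normc (G (E +i* e) - l) < k.+1%:R^-1 / 2.
  move=> /andP[e0 en]; have := hd e; rewrite /= !sub0r !normrN gtr0_norm//.
  by rewrite ger0_norm ?normc_ge0//; apply => //; apply: lt_trans hn.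
exists n => // -[e [e' [he he']]]; apply/negP; rewrite -leNgt.
have -> : G (E +i* e) - G (E +i* e') = (G (E +i* e) - l) - (G (E +i* e') - l) by ring.
by apply: le_trans (normcB _ _) _; rewrite [leRHS]splitr lerD// ltW// close.
Qed.

Let S_cvg E : S E -> exists l, (G (E +i* e) : cplx R) @[e --> (0 : R)^'+] --> (l : cplx R).
Proof.
move=> hS.
have key (P : R[i] -> R) : (forall z w, `|P z - P w| <= normc (z - w)) ->
    cvg (P (G (E +i* e)) @[e --> (0 : R)^'+]).
  move=> hP; apply/cauchy_cvgP; apply: cauchy_exP => eps eps0.
  have [k hk] := inv_lt_exists eps0; have [n _ hn] := hS k I.
  have n0 : 0 < n.+1%:R^-1 :> R by rewrite invr_gt0.
  exists (P (G (E +i* (n.+1%:R^-1 / 2)))).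
  rewrite /fmap /=; near=> e; rewrite -ball_normE /=.
  apply: le_lt_trans hk; apply: le_trans (hP _ _) _.
  rewrite leNgt; apply/negP => h; apply: hn; exists (n.+1%:R^-1 / 2), e; split => //.
    by rewrite divr_gt0//= ltr_pdivrMr// ltr_pMr// ltr1n.
  apply/andP; split; first by near: e; exact: nbhs_right_gt.
  by near: e; exact: nbhs_right_lt.
have /cvg_ex[a ha] : cvg (Re (G (E +i* e)) @[e --> (0 : R)^'+]).
  by apply: key => z w; rewrite -ReN -ReD; exact: normc_Re.
have /cvg_ex[b hb] : cvg (Im (G (E +i* e)) @[e --> (0 : R)^'+]).
  by apply: key => z w; rewrite -ImN -ImD; exact: normc_Im.
by exists (a +i* b); apply: cvg_ReIm.
Unshelve. all: by end_near. Qed.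

Lemma cvg_inv_right : (n.+1%:R^-1 : R) @[n --> \oo] --> (0 : R)^'+.
Proof.
move=> A [d /= d0 hd]; have [n hn] := inv_lt_exists d0.
exists n => // m /= nm; apply: hd => /=; rewrite ?invr_gt0//.
rewrite sub0r normrN gtr0_norm ?invr_gt0//; apply: le_lt_trans hn.
by rewrite lef_pV2 ?posrE// ler_nat.
Qed.

(** The set of points where the limit exists is given by the Cauchy criterion
through the sets U n k, which are open because the oscillation at fixed
heights is continuous in E. On that set the boundary value is a limit of a
sequence of continuous functions; elsewhere it has the default value 0. *)
Lemma boundary_value_cmeasurable :
  @cmeasurable _ (measurableTypeR R) R (boundary_value G).
Proof.
pose h (P : R[i] -> R) n := (fun E : R => P (G (E +i* n.+1%:R^-1))) \_ S.
have key (P : R[i] -> R) : P 0 = 0 ->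
    (forall (f : R -> R[i]) (F : set_system R) (l : R[i]), Filter F ->
      (f x : cplx R) @[x --> F] --> (l : cplx R) -> P (f x) @[x --> F] --> P l) ->
    (forall (f : nat -> R[i]) (l : R[i]),
      (f x : cplx R) @[x --> \oo] --> (l : cplx R) -> P (f x) @[x --> \oo] --> P l) ->
    measurable_fun setT (fun E : measurableTypeR R => P (boundary_value G E)).
  move=> P0 cP cPn; apply: (@measurable_fun_cvg _ _ _ _ (h P)) => [n|E _].
    apply/(measurable_restrictT _ mS).
    apply: measurable_funTS; apply: measurable_realfun.continuous_measurable_fun => E.
    apply: (cP (fun E => G (E +i* n.+1%:R^-1))).
    by apply: cG; rewrite invr_gt0.
  rewrite /h; have [ES|ES] := boolP (E \in S).
    under eq_fun do rewrite patchE ES.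
    have [l hl] := S_cvg (set_mem ES).
    rewrite (boundary_valueE hl); apply: (cPn (fun n => G (E +i* n.+1%:R^-1))).
    by apply: (cvg_comp (fun n : nat => n.+1%:R^-1) (fun e => G (E +i* e) : cplx R)) hl; exact: cvg_inv_right.
  under eq_fun do rewrite patchE (negbTE ES).
  have nc : ~ cvg ((G (E +i* e) : cplx R) @[e --> (0 : R)^'+]).
    by move/cvg_ex => [l hl]; move/negP: ES; apply; apply/mem_set; apply: cvg_S hl.
  rewrite /boundary_value (dvgP nc) -[point]/(0 : R[i]) P0; exact: cvg_cst.
split; apply: key => //.
- by move=> f F l FF; exact: cvg_Re.
- by move=> f l; exact: cvg_Re.
- by move=> f F l FF; exact: cvg_Im.
- by move=> f l; exact: cvg_Im.
Qed.

End BoundaryMeasurable.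

(** At a fixed height above the axis the Borel transform is Lipschitz in E. *)
Lemma F_res_cmeasurable (R : realType) (nu : probability (measurableTypeR R) R) :
  @cmeasurable _ (measurableTypeR R) R (F_res nu).
Proof.
apply: boundary_value_cmeasurable => e E0 e0.
have gE E : green (h_res nu) (chi nu) (chi nu) (E +i* e) = borel nu (E +i* e).
  by apply: green_res; rewrite /= gt_eqF.
rewrite gE; under eq_fun do rewrite gE.
apply/cvg_complexE.
apply: (@squeeze_cvgr _ _ _ _ (cst 0) (fun E => 2 * (`|E - E0| / e ^+ 2))).
- by apply: nearW => E; rewrite normc_ge0/= borel_lipschitz.
- exact: cvg_cst.
- rewrite [X in _ --> X](_ : 0 = 2 * (`|E0 - E0| / e ^+ 2)); last first.
    by rewrite subrr normr0 mul0r mulr0.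
  apply: (@cvgM _ _ _ _ (fun=> 2) (fun E => `|E - E0| / e ^+ 2)).
    exact: cvg_cst.
  apply: (@cvgM _ _ _ _ (fun E => `|E - E0|) (fun=> (e ^+ 2)^-1)).
    apply: (@cvg_norm _ _ _ _ _ (fun E => E - E0)).
    by apply: cvgB; [exact: cvg_id|exact: cvg_cst].
  exact: cvg_cst.
Qed.

(** * The coupled system *)

Lemma fun_comb (T : Type) (R : realType) (m f g h k u : T -> R[i])
    (kap a b c d z : R[i]) x :
  (m + kap *: (a *: f + b *: g + (c *: h + d *: k)) - z *: u) x =
  m x + kap * (a * f x + b * g x + (c * h x + d * k x)) - z * u x.
Proof. by []. Qed.

Section Coupled.
Variables (R : realType) (L : nat) (J lam : int -> R) (kS : R).
Variables (nul nur : probability (measurableTypeR R) R) (kap : R).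
Hypothesis hL : (1 <= L)%N.
Hypothesis hJ : forall x : int, 1 <= x < L%:Z -> J x != 0.
Hypothesis hkS : kS != 0.

Local Notation jacobi := (jacobi L J lam kS).

Lemma hip0_L2 d (T : measurableType d) (mu : {measure set T -> \bar R}) (u : T -> R[i]) :
  @hip R (L2 mu) (0 : T -> R[i]) u = 0.
Proof.
have e x : (conjc ((0 : T -> R[i]) x) * u x) = 0.
  by rewrite (_ : conjc _ = 0) ?mul0r//; apply: complex_eq; rewrite /= ?oppr0.
rewrite [LHS]/(cintegral _ _); apply: complex_eq; rewrite [LHS]/(Rintegral _ _ _);
  rewrite (@eq_integral _ _ _ _ _ (cst 0%:E)) ?integral0//; by move=> x _; rewrite e.
Qed.

Lemma hip_psi_l N (U : coupled_space L nul nur N) : hip (psi_l L nul nur N) U = U.1.2 1.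
Proof.
rewrite -[LHS]/(@hip R (L2 nul) 0 U.1.1 + @hip R (ell2 R (box L N)) (delta R 1) U.1.2
  + @hip R (L2 nur) 0 U.2).
by rewrite !hip0_L2 hip_delta add0r addr0.
Qed.

Lemma hip_psi_r N (U : coupled_space L nul nur N) :
  hip (psi_r L nul nur N) U = U.1.2 (N * L)%N%:Z.
Proof.
rewrite -[LHS]/(@hip R (L2 nul) 0 U.1.1 + @hip R (ell2 R (box L N)) (delta R (N * L)%N%:Z) U.1.2
  + @hip R (L2 nur) 0 U.2).
by rewrite !hip0_L2 hip_delta add0r addr0.
Qed.

Lemma hip_chi_l N (U : coupled_space L nul nur N) :
  hip (chi_l L nul nur N) U = hip (chi nul) U.1.1.
Proof.
rewrite -[LHS]/(@hip R (L2 nul) (chi nul) U.1.1 + @hip R (ell2 R (box L N)) 0 U.1.2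
  + @hip R (L2 nur) 0 U.2).
by rewrite !(@hip0_L2 _ _ nur) (@hip0_L2 _ int) !addr0.
Qed.

Lemma hip_chi_r N (U : coupled_space L nul nur N) :
  hip (chi_r L nul nur N) U = hip (chi nur) U.2.
Proof.
rewrite -[LHS]/(@hip R (L2 nul) 0 U.1.1 + @hip R (ell2 R (box L N)) 0 U.1.2
  + @hip R (L2 nur) (chi nur) U.2).
by rewrite (@hip0_L2 _ _ nul) (@hip0_L2 _ int) !add0r.
Qed.

(** The coupling has rank one at each end: a reservoir only sees the value of u at
its end of the sample, times the constant function chi, and the sample only sees
the pairings of the reservoir components with chi. *)
Lemma coupled_eqP N z (ul ur : R -> R[i]) (u : int -> R[i]) :
  heqv (oact (h_coupled L J lam kS nul nur kap N) (ul, u, ur) - z *: (ul, u, ur))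
    (psi_r L nul nur N) <->
  [/\ {ae nul, forall x : R, x%:C * ul x - z * ul x = - (kap%:C * u 1)},
      forall y : int, (if `[< box L N y >] then jacobi u y else 0)
        + kap%:C * (hip (chi nul) ul * delta R 1 y + hip (chi nur) ur * delta R (N * L)%N%:Z y)
        - z * u y = delta R (N * L)%N%:Z y
    & {ae nur, forall x : R, x%:C * ur x - z * ur x = - (kap%:C * u (N * L)%N%:Z)}].
Proof.
set U : coupled_space L nul nur N := (ul, u, ur).
have hpl : hip (psi_l L nul nur N) U = u 1 := hip_psi_l U.
have hpr : hip (psi_r L nul nur N) U = u (N * L)%N%:Z := hip_psi_r U.
have hcl : hip (chi_l L nul nur N) U = hip (chi nul) ul := hip_chi_l U.
have hcr : hip (chi_r L nul nur N) U = hip (chi nur) ur := hip_chi_r U.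
have e0 : oact (h_coupled L J lam kS nul nur kap N) U - z *: U =
    oact (oper_sum (oper_sum (h_res nul) (h_crystal L J lam kS (box L N))) (h_res nur)) U
    + kap%:C *: (u 1 *: chi_l L nul nur N + hip (chi nul) ul *: psi_l L nul nur N
       + (u (N * L)%N%:Z *: chi_r L nul nur N + hip (chi nur) ur *: psi_r L nul nur N))
    - z *: U.
  by rewrite -hpl -hpr -hcl -hcr.
rewrite e0 {e0}.
move: (hip (chi nul) ul) (hip (chi nur) ur) {hpl hpr hcl hcr} => Cl Cr.
move: (u 1) (u (N * L)%N%:Z) => u1 uN.
set w := _ - _.
have e1 (x : R) : w.1.1 x = x%:C * ul x - z * ul x + kap%:C * u1.
  rewrite /w /= fun_comb.
  transitivity (x%:C * ul x + kap%:C * (u1 * 1 + Cl * 0 + (uN * 0 + Cr * 0)) - z * ul x) => //.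
  ring.
have e3 (x : R) : w.2 x = x%:C * ur x - z * ur x + kap%:C * uN.
  rewrite /w /= fun_comb.
  transitivity (x%:C * ur x + kap%:C * (u1 * 0 + Cl * 0 + (uN * 1 + Cr * 0)) - z * ur x) => //.
  ring.
have e2 (y : int) : w.1.2 y = (if `[< box L N y >] then jacobi u y else 0)
        + kap%:C * (Cl * delta R 1 y + Cr * delta R (N * L)%N%:Z y) - z * u y.
  rewrite /w /= fun_comb.
  transitivity ((if `[< box L N y >] then jacobi u y else 0)
    + kap%:C * (u1 * 0 + Cl * delta R 1 y + (uN * 0 + Cr * delta R (N * L)%N%:Z y)) - z * u y) => //.
  ring.
split.
  move=> [[h1 h2] h3]; split.
  - apply: ae_imp h1 => x hx; apply/eqP; rewrite -subr_eq0 opprK -e1; exact/eqP.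
  - by move=> y; rewrite -e2; exact: (counting_ae h2 y).
  - apply: ae_imp h3 => x hx; apply/eqP; rewrite -subr_eq0 opprK -e3; exact/eqP.
move=> [h1 h2 h3]; split; first split.
- by apply: ae_imp h1 => x hx; rewrite e1 hx addNr.
- by apply: aeW => y; rewrite e2 h2.
- by apply: ae_imp h3 => x hx; rewrite e3 hx addNr.
Qed.

End Coupled.

Lemma box_case (n : nat) (y : int) : 1 <= y <= n%:Z ->
  exists k : nat, (k < n)%N /\ y = k.+1%:Z.
Proof. by move=> h; exists `|y - 1|%N; lia. Qed.

Lemma box_succ (n k : nat) : (k < n)%N -> (1 : int) <= k.+1%:Z <= n%:Z.
Proof. lia. Qed.

Lemma box_out (n : nat) : ((1 <= (0:int) <= n%:Z) = false) * (((1 : int) <= n.+1%:Z <= n%:Z) = false).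
Proof. by split; lia. Qed.

Lemma delta_eq (R : realType) (y : int) : delta R y y = 1.
Proof. by rewrite /delta eqxx. Qed.

Lemma delta_neq (R : realType) (x y : int) : x != y -> delta R y x = 0.
Proof. by rewrite /delta => /negbTE ->. Qed.

Section BoxGreen.
Variables (R : realType) (L : nat) (J lam : int -> R) (kS : R).
Variables (nul nur : probability (measurableTypeR R) R) (kap : R).
Hypothesis hL : (1 <= L)%N.
Hypothesis hJ : forall x : int, 1 <= x < L%:Z -> J x != 0.
Hypothesis hkS : kS != 0.

Local Notation cJ := (crystal_J L J kS).
Local Notation cl := (crystal_lam L lam).
Local Notation trC := (transfer L J lam kS (real_complex R)).
Local Notation jacobi := (jacobi L J lam kS).

(** A solution u in the box with boundary sources a and b at its two ends becomes
a solution v of the homogeneous recursion once the Dirichlet values 0 at the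
sites 0 and n+1 are replaced by the values that produce these sources. *)
Lemma box_bridge (n : nat) z (u : int -> R[i]) (v : nat -> R[i]) (a b : R[i]) :
  (forall k, (k < n)%N -> u k.+1%:Z = v k.+1) -> u 0 = 0 -> u n.+1%:Z = 0 ->
  (cJ 0)%:C * v 0%N = a -> (cJ n%:Z)%:C * v n.+1 = b - 1 ->
  forall k, (k < n)%N ->
  jacobi u k.+1%:Z + (a * delta R 1 k.+1%:Z + b * delta R n%:Z k.+1%:Z)
    - z * u k.+1%:Z - delta R n%:Z k.+1%:Z =
  (cJ k.+1%:Z)%:C * v k.+2 + (cJ k%:Z)%:C * v k + (cl k.+1%:Z)%:C * v k.+1
    - z * v k.+1.
Proof.
move=> uv u0 un ha hb k kn.
have eA : (cJ k%:Z)%:C * v k = (cJ k%:Z)%:C * u k%:Z + a * delta R 1 k.+1%:Z.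
  case: k kn => [|k] kn.
    by rewrite u0 mulr0 add0r ha delta_eq mulr1.
  rewrite (@delta_neq _ k.+2%:Z); last by rewrite eqz_nat.
  by rewrite -uv ?(ltnW kn)// mulr0 addr0.
have eB : (cJ k.+1%:Z)%:C * v k.+2 = (cJ k.+1%:Z)%:C * u k.+2%:Z
    + (b - 1) * delta R n%:Z k.+1%:Z.
  have [e|ne] := eqVneq k.+1 n.
    by rewrite e un mulr0 add0r hb delta_eq mulr1.
  rewrite -uv; last by rewrite ltn_neqAle ne kn.
  by rewrite delta_neq ?eqz_nat// mulr0 addr0.
rewrite eA eB /jacobi -uv// (_ : k.+1%:Z + 1 = k.+2%:Z); last by rewrite -PoszD addn1.
rewrite (_ : k.+1%:Z - 1 = k%:Z); last by rewrite -addn1 PoszD addrK.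
ring.
Qed.

(** The recursion is started from u(1) = 1 with the left reservoir built into the
fictitious value u(0) = - fl / kS; the result measures how far the solution is
from satisfying the condition kS u(n+1) = - fr u(n) of the right reservoir. *)
Definition green_den (z fl fr : R[i]) (N : nat) : R[i] :=
  let w := iter N (trC z L) (kS%:C, - fl / kS%:C) in w.1 + fr * w.2.

Lemma finite_support_l2 (n : nat) (u : int -> R[i]) :
  (forall y, ~ (1 <= y <= n%:Z) -> u y = 0) -> l2 u.
Proof.
move=> hu; pose M := \sum_(k < n) normc (u k.+1%:Z) ^+ 2.
have M0 : 0 <= M by apply: sumr_ge0 => k _; rewrite sqr_ge0.
have r : (0 : R) <= 2^-1 < (1 : R).
  by rewrite invr_ge0 ler0n invf_lt1 ?ltr1n.
apply: (l2P (geometric_window r (B := M * 2 ^+ n) _ _)); first by rewrite mulr_ge0.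
move=> x; have [h|h] := boolP (1 <= x <= n%:Z); last first.
  rewrite hu; last exact/negP.
  by rewrite Normc.normc0 expr0n /= !mulr_ge0// exprn_ge0// invr_ge0.
have [k [kn ->]] := box_case h.
rewrite absz_nat exprVn -mulrA.
apply: (@le_trans _ _ M).
  by rewrite /M (bigD1 (Ordinal kn))//= lerDl sumr_ge0// => i _; rewrite sqr_ge0.
by rewrite ler_peMr// ler_pdivlMr ?exprn_gt0// mul1r ler_weXn2l// ler1n.
Qed.

(** Solving for the reservoir components gives the self-energies fl and fr. The
sample component is then u(1) times the solution started at the left end, and
the source psi_r at the right end says that u(1) times the defect is -1. *)
Lemma green_box (N : nat) z : (1 <= N)%N -> Im z != 0 ->
  let fl := (kap ^+ 2)%:C * borel nul z in
  let fr := (kap ^+ 2)%:C * borel nur z in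
  green_den z fl fr N != 0 ->
  green (h_coupled L J lam kS nul nur kap N) (psi_l L nul nur N) (psi_r L nul nur N) z
    = - (green_den z fl fr N)^-1.
Proof.
move=> N1 z0 fl fr; set den := green_den z fl fr N => den0.
have kC : kS%:C != 0 by rewrite -normc_eq0 normcR normr_eq0.
pose n := (N * L)%N; have n0 : (0 < n)%N by rewrite muln_gt0 N1.
have Jn : cJ n%:Z = kS.
  by rewrite /n PoszM -[_ * _]addr0 crystal_JDM crystal_J0.
have denE : den = (trC z n (kS%:C, - fl / kS%:C)).1 + fr * (trC z n (kS%:C, - fl / kS%:C)).2.
  by rewrite /den /green_den -(transferM J lam hL hkS).
have [bo0 bon] := box_out n.
apply: greenE.
  pose g := - den^-1.
  pose v (k : nat) := g * (trC z k (kS%:C, - fl / kS%:C)).2.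
  pose u (y : int) := if 1 <= y <= n%:Z then v `|y|%N else 0.
  have uv k : (k < n)%N -> u k.+1%:Z = v k.+1 by move=> kn; rewrite /u box_succ.
  have u0 : u 0 = 0 by rewrite /u bo0.
  have un : u n.+1%:Z = 0 by rewrite /u bon.
  have v1 : v 1%N = g.
    by rewrite /v /= crystal_J0// -rmorphM mulVf// rmorph1 mulr1.
  have u1 : u 1 = g by rewrite -v1 -uv.
  pose cl_ := - (kap%:C * u 1); pose cr_ := - (kap%:C * u n%:Z).
  exists ((fun x : R => cl_ * (x%:C - z)^-1), u, (fun x : R => cr_ * (x%:C - z)^-1)).
  have hu y : ~ (1 <= y <= n%:Z) -> u y = 0 by move=> /negP h; rewrite /u (negbTE h).
  have hun : u n%:Z = v n by rewrite -(prednK n0) uv// prednK.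
  have res c (nu : probability (measurableTypeR R) R) :
      hip (chi nu) (fun x : R => c * (x%:C - z)^-1) = c * borel nu z.
    apply: res_unique => //; first by case: (res_exists nu c z0).
    apply: aeW => x; transitivity (c * ((x%:C - z) * (x%:C - z)^-1)); first by ring.
    by rewrite mulfV ?mulr1// sub_real_neq0.
  have eql : kap%:C * (cl_ * borel nul z) = - fl * u 1.
    by rewrite /cl_ /fl rmorphXn /=; ring.
  have eqr : kap%:C * (cr_ * borel nur z) = - fr * u n%:Z.
    by rewrite /cr_ /fr rmorphXn /=; ring.
  have lu : l2 u by apply: (@finite_support_l2 n).
  split.
    split; last exact: res_exists.
    split; first exact: res_exists.
    by split => // y; apply: hu.
  apply/coupled_eqP; split.
  - apply: aeW => x; rewrite -/cl_.
    transitivity (cl_ * ((x%:C - z) * (x%:C - z)^-1)); first by ring.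
    by rewrite mulfV ?mulr1// sub_real_neq0.
  - move=> y; rewrite !res mulrDr !mulrA -(mulrA kap%:C cl_) -(mulrA kap%:C cr_) eql eqr.
    rewrite asboolb; case: ifPn => hy; last first.
      have y1 : delta R 1 y = 0.
        by apply: delta_neq; apply: contraNneq hy => ->; rewrite lexx /= lez_nat n0.
      have yn : delta R n%:Z y = 0.
        by apply: delta_neq; apply: contraNneq hy => ->; rewrite lexx andbT lez_nat n0.
      by rewrite -/n y1 yn !mulr0 !addr0 hu ?mulr0 ?subrr//; apply/negP.
    have [k [kn ->]] := box_case hy.
    apply/eqP; rewrite -subr_eq0; apply/eqP.
    rewrite (@box_bridge n z u v (- fl * u 1) (- fr * u n%:Z) uv u0 un)//.
    + pose c (k : nat) := (trC z k (kS%:C, - fl / kS%:C)).2.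
      have h : (cJ k.+1%:Z)%:C * c k.+2 + (cJ k%:Z)%:C * c k + (cl k.+1%:Z)%:C * c k.+1
        = z * c k.+1 := transfer_rec lam hL hJ hkS (real_complex R) z k (kS%:C, - fl / kS%:C).
      rewrite /v -/(c k.+2) -/(c k.+1) -/(c k).
      transitivity (g * ((cJ k.+1%:Z)%:C * c k.+2 + (cJ k%:Z)%:C * c k
          + (cl k.+1%:Z)%:C * c k.+1 - z * c k.+1)); first by ring.
      by rewrite h subrr mulr0.
    + by rewrite crystal_J0// u1 /v /=; field.
    + have h := transfer1 lam hL hJ hkS (real_complex R) z n (kS%:C, - fl / kS%:C).
      rewrite hun /v mulrCA h.
      have : g * den = - 1 by rewrite /g mulNr mulVf.
      rewrite denE => <-; ring.
  - apply: aeW => x; rewrite -/cr_.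
    transitivity (cr_ * ((x%:C - z) * (x%:C - z)^-1)); first by ring.
    by rewrite mulfV ?mulr1// sub_real_neq0.
(* conversely, any solution has this value at site 1 *)
move=> [[ul u] ur] [[hul [lu u_out]] hur] /coupled_eqP[h1 h2 h3].
rewrite hip_psi_l /=.
have hcl := res_unique z0 hul.1 h1; have hcr := res_unique z0 hur.1 h3.
rewrite hcl hcr -/n in h2.
pose v (k : nat) := if k is 0%N then - fl * u 1 / kS%:C else
   if (k <= n)%N then u k%:Z else (- fr * u n%:Z - 1) / kS%:C.
have uv k : (k < n)%N -> u k.+1%:Z = v k.+1 by move=> kn; rewrite /v kn.
have u0 : u 0 = 0 by apply: u_out; rewrite /box /mkset -/n bo0.
have un : u n.+1%:Z = 0 by apply: u_out; rewrite /box /mkset -/n bon.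
have hv0 : (cJ 0)%:C * v 0%N = - fl * u 1.
  by rewrite crystal_J0// /v mulrCA mulfV ?mulr1.
have hvn : (cJ n%:Z)%:C * v n.+1 = - fr * u n%:Z - 1.
  by rewrite Jn /v ltnn mulrCA mulfV ?mulr1.
have br := @box_bridge n z u v _ _ uv u0 un hv0 hvn.
have rec k : (k < n)%N -> (cJ k.+1%:Z)%:C * v k.+2 + (cJ k%:Z)%:C * v k
    + (cl k.+1%:Z)%:C * v k.+1 = z * v k.+1.
  move=> kn; apply/eqP; rewrite -subr_eq0 -br//.
  have := h2 k.+1%:Z; rewrite /box /mkset -/n asboolb box_succ// => /eqP.
  rewrite -subr_eq0 => /eqP h; apply/eqP; rewrite -[RHS]h /fl /fr rmorphXn /=; ring.
have := transfer_sol hL hJ hkS rec; rewrite hvn.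
have -> : v 1%N = u 1 by rewrite -uv.
have -> : v n = u n%:Z by rewrite -(prednK n0) -uv// prednK.
move=> e; have {}e : u 1 * den = - 1.
  rewrite denE.
  have := transferZ L J lam kS (real_complex R) z (u 1) n (kS%:C, - fl / kS%:C).
  rewrite /= (_ : u 1 * kS%:C = kS%:C * u 1); last by rewrite mulrC.
  rewrite (_ : u 1 * (- fl / kS%:C) = v 0%N); last by rewrite /v; ring.
  rewrite e => -[e1 e2].
  rewrite mulrDr mulrCA -e1 -e2; ring.
by rewrite -[LHS](mulfK den0) e mulN1r.
Qed.

End BoxGreen.

(** * The transmittance of the finite sample *)

Section Transmission.
Variables (R : realType) (L : nat) (J lam : int -> R) (kS : R).
Variables (nul nur : probability (measurableTypeR R) R) (kap : R).
Hypothesis hL : (1 <= L)%N.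
Hypothesis hJ : forall x : int, 1 <= x < L%:Z -> J x != 0.
Hypothesis hkS : kS != 0.
Hypothesis hkap : kap != 0.

Local Notation trC := (transfer L J lam kS (real_complex R)).
Local Notation t11 z := (tr11 L J lam kS (real_complex R) z L).
Local Notation t12 z := (tr12 L J lam kS (real_complex R) z L).
Local Notation t21 z := (tr21 L J lam kS (real_complex R) z L).
Local Notation t22 z := (tr22 L J lam kS (real_complex R) z L).
Local Notation den := (green_den L J lam kS).

Lemma Im_borel_ge0 (nu : probability (measurableTypeR R) R) z : 0 <= Im z ->
  0 <= Im (borel nu z).
Proof.
move=> z0; apply: Rintegral_ge0 => x _.
case: z z0 => a b /= b0; rewrite sub0r mulNr opprK divr_ge0// addr_ge0 ?sqr_ge0//.
Qed.

Lemma Im_F_res_ge0 (nu : probability (measurableTypeR R) R) E : 0 <= Im (F_res nu E).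
Proof.
have [c|nc] := pselect (cvg ((green (h_res nu) (chi nu) (chi nu) (E +i* e) : cplx R) @[e --> (0 : R)^'+])); last first.
  by rewrite /F_res /boundary_value (dvgP nc) /= lexx.
have h : Im (green (h_res nu) (chi nu) (chi nu) (E +i* e)) @[e --> (0 : R)^'+]
  --> Im (F_res nu E) by apply: (cvg_Im c).
rewrite -(cvg_lim (@Rhausdorff R) h); apply: limr_ge; first exact: cvgP h.
near=> e; have e0 : 0 < e by near: e; exact: nbhs_right_gt.
by rewrite green_res ?Im_borel_ge0//= ?gt_eqF// ltW.
Unshelve. all: by end_near. Qed.

(** Cayley-Hamilton for a matrix of determinant 1. *)
Lemma den_cayley z v N :
  let w N := iter N (trC z L) v in
  (w N.+2).1 = (t11 z + t22 z) * (w N.+1).1 - (w N).1 /\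
  (w N.+2).2 = (t11 z + t22 z) * (w N.+1).2 - (w N).2.
Proof.
move=> w; have det := transfer_det lam hL hJ hkS (real_complex R) z L.
have e M : w M.+1 = trC z L (w M) by [].
rewrite !e; move: (w N) => u; rewrite !(transferE _ _ _ _ _ _ L) /=; split.
  transitivity ((t11 z + t22 z) * (t11 z * u.1 + t12 z * u.2) - (t11 z * t22 z - t12 z * t21 z) * u.1).
    by ring.
  by rewrite det mul1r.
transitivity ((t11 z + t22 z) * (t21 z * u.1 + t22 z * u.2) - (t11 z * t22 z - t12 z * t21 z) * u.2).
  by ring.
by rewrite det mul1r.
Qed.

Lemma den_rec z fl fr N :
  den z fl fr N.+2 = (t11 z + t22 z) * den z fl fr N.+1 - den z fl fr N.
Proof.
have [e1 e2] := den_cayley z (kS%:C, - fl / kS%:C) N.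
by rewrite /green_den e1 e2; ring.
Qed.

(** At real energy the current Im fl injected at the left arrives unchanged at the
right end, where it equals Im (conj w2 w1); then |w1 + fr w2|^2 is at least
4 Im (conj w2 w1) Im fr, the difference being |w1 + conj fr w2|^2. *)
Lemma den_lower_bound (E : R) fl fr N :
  4 * Im fl * Im fr <= normc (den E%:C fl fr N) ^+ 2.
Proof.
rewrite /green_den -(transferM J lam hL hkS).
have := flux lam hL hJ hkS E%:C (N * L) (kS%:C, - fl / kS%:C).
move: (trC _ _ _) => [A B] /=.
have -> : Im (conjc (- fl / kS%:C) * kS%:C) = Im fl.
  transitivity (Im (conjc (- fl))); last by rewrite ImJ ImN opprK.
  congr Im; rewrite -[X in _ * X](conjc_real kS) -rmorphM mulfVK//.
  by rewrite -normc_eq0 normcR normr_eq0.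
rewrite mul0r addr0 !(ReM, ImM, ReJ, ImJ) => e.
rewrite normc_sq !(ReD, ImD, ReM, ImM) -e.
rewrite -subr_ge0.
have -> : forall a b c d u v : R, (a + (u * c - v * d)) ^+ 2 + (b + (u * d + v * c)) ^+ 2
   - 4 * (c * b + - d * a) * v = (a + (u * c + v * d)) ^+ 2 + (b + (u * d - v * c)) ^+ 2.
  by move=> *; ring.
by rewrite addr_ge0 ?sqr_ge0.
Qed.

Lemma Im_kap (F : R[i]) : Im ((kap ^+ 2)%:C * F) = kap ^+ 2 * Im F.
Proof. by rewrite ImM ReC ImC mul0r addr0. Qed.

Lemma Im_kap_gt0 (F : R[i]) : 0 < Im F -> 0 < Im ((kap ^+ 2)%:C * F).
Proof. by move=> F0; rewrite Im_kap mulr_gt0// exprn_even_gt0. Qed.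

Lemma den_neq0 (E : R) fl fr N : 0 < Im fl -> 0 < Im fr -> den E%:C fl fr N != 0.
Proof.
move=> l0 r0; rewrite -normc_gt0 lt_def normc_ge0 andbT -sqrf_eq0 gt_eqF//.
by apply: lt_le_trans (den_lower_bound E fl fr N); rewrite !mulr_gt0.
Qed.

Lemma green_coupled_limit (E : R) N (Fl Fr : R[i]) : (1 <= N)%N ->
  0 < Im Fl -> 0 < Im Fr ->
  (borel nul (E +i* e) : cplx R) @[e --> (0 : R)^'+] --> (Fl : cplx R) ->
  (borel nur (E +i* e) : cplx R) @[e --> (0 : R)^'+] --> (Fr : cplx R) ->
  (green (h_coupled L J lam kS nul nur kap N) (psi_l L nul nur N)
    (psi_r L nul nur N) (E +i* e) : cplx R) @[e --> (0 : R)^'+] -->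
    (- (den E%:C ((kap ^+ 2)%:C * Fl) ((kap ^+ 2)%:C * Fr) N)^-1 : cplx R).
Proof.
move=> N1 Fl0 Fr0 cFl cFr.
have d0 := den_neq0 E N (Im_kap_gt0 Fl0) (Im_kap_gt0 Fr0).
have cgl : ((kap ^+ 2)%:C * borel nul (E +i* e) : cplx R) @[e --> (0 : R)^'+]
    --> ((kap ^+ 2)%:C * Fl : cplx R).
  by apply: cvg_cM cFl; exact: cvg_cst.
have cgr : ((kap ^+ 2)%:C * borel nur (E +i* e) : cplx R) @[e --> (0 : R)^'+]
    --> ((kap ^+ 2)%:C * Fr : cplx R).
  by apply: cvg_cM cFr; exact: cvg_cst.
move: ((kap ^+ 2)%:C * Fl) ((kap ^+ 2)%:C * Fr) d0 cgl cgr => fl fr d0 cgl cgr.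
pose gl (e : R) := (kap ^+ 2)%:C * borel nul (E +i* e).
pose gr (e : R) := (kap ^+ 2)%:C * borel nur (E +i* e).
have cd : (den (E +i* e) (gl e) (gr e) N : cplx R) @[e --> (0 : R)^'+] -->
    (den E%:C fl fr N : cplx R).
  have [c1 c2] : ((trC (E +i* e) (N * L) (kS%:C, - gl e / kS%:C)).1 : cplx R)
        @[e --> (0 : R)^'+] --> ((trC E%:C (N * L) (kS%:C, - fl / kS%:C)).1 : cplx R) /\
      ((trC (E +i* e) (N * L) (kS%:C, - gl e / kS%:C)).2 : cplx R)
        @[e --> (0 : R)^'+] --> ((trC E%:C (N * L) (kS%:C, - fl / kS%:C)).2 : cplx R).
    apply: (@transfer_cvg R L J lam kS _ _ (fun e => E +i* e) E%:C (N * L)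
      (fun e => (kS%:C, - gl e / kS%:C)) (kS%:C, - fl / kS%:C)).
    - exact: cvg_boundary.
    - exact: cvg_cst.
    - exact: (cvg_cM (cvg_cN cgl) (cvg_cst (kS%:C^-1 : cplx R))).
  rewrite /green_den -(transferM J lam hL hkS).
  under eq_fun do rewrite -(transferM J lam hL hkS).
  by apply: cvg_cD c1 _; apply: cvg_cM cgr c2.
have cV : (- (den (E +i* e) (gl e) (gr e) N)^-1 : cplx R) @[e --> (0 : R)^'+] -->
    (- (den E%:C fl fr N)^-1 : cplx R).
  exact: (cvg_cN (cvg_cV d0 cd)).
apply: cvg_trans cV; apply: near_eq_cvg.
have dn : \forall e \near (0 : R)^'+, 0 < normc (den (E +i* e) (gl e) (gr e) N).
  by apply: (cvgr_gt _ (cvg_normc cd)); rewrite normc_gt0.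
near=> e; apply/esym; apply: green_box => //.
  by rewrite /= gt_eqF//; near: e; exact: nbhs_right_gt.
rewrite -normc_gt0 -/(gl e) -/(gr e); near: e; exact: dn.
Unshelve. all: by end_near. Qed.

Lemma transmittanceE (E : R) N : (1 <= N)%N ->
  0 < Im (F_res nul E) -> 0 < Im (F_res nur E) ->
  transmittance L J lam kS nul nur kap N E =
    4 * Im ((kap ^+ 2)%:C * F_res nul E) * Im ((kap ^+ 2)%:C * F_res nur E) /
    normc (den E%:C ((kap ^+ 2)%:C * F_res nul E) ((kap ^+ 2)%:C * F_res nur E) N) ^+ 2.
Proof.
move=> N1 Fl0 Fr0.
have lim := green_coupled_limit N1 Fl0 Fr0 (F_res_cvg Fl0) (F_res_cvg Fr0).
rewrite /transmittance (boundary_valueE lim) {lim Fl0 Fr0}.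
move: (F_res nul E) (F_res nur E) => Fl Fr.
move: (den _ _ _ _) => d; rewrite !Im_kap normcN Normc.normcV.
rewrite (_ : kap ^+ 4 = kap ^+ 2 * kap ^+ 2); last by rewrite -exprD.
by rewrite exprVn; ring.
Qed.

(** The imaginary part of a reservoir function is never negative, so outside the
common support one of the two factors Im F vanishes. *)
Lemma transmittance_notin (E : R) N : ~ (0 < Im (F_res nul E) /\ 0 < Im (F_res nur E)) ->
  transmittance L J lam kS nul nur kap N E = 0.
Proof.
have key (a b c : R) : 0 <= a -> 0 <= b -> ~ (0 < a /\ 0 < b) -> c * a * b = 0.
  rewrite le_eqVlt => /orP[/eqP <- _ _|a0]; first by rewrite mulr0 mul0r.
  rewrite le_eqVlt => /orP[/eqP <- _|b0 h]; first by rewrite mulr0.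
  by exfalso; apply: h.
exact: key (Im_F_res_ge0 nul E) (Im_F_res_ge0 nur E).
Qed.

End Transmission.

(** * The Poisson kernel *)

Section PoissonKernel.
Variable R : realType.

Definition expi (t : R) : R[i] := cos t +i* sin t.

Lemma normc_expi t : normc (expi t) = 1.
Proof. by rewrite /expi /= cos2Dsin2 sqrtr1. Qed.

Definition poisson (w : R[i]) : R := (1 - normc w ^+ 2) / normc (1 - w) ^+ 2.

(** With A = (|X|^2 + |Y|^2)/2, B = (|X|^2 - |Y|^2)/2 and C = Re (conj X Y) one has
|cos t X + sin t Y|^2 = A + B cos 2t + C sin 2t. The reciprocal of such a
trigonometric polynomial is 1/q times a Poisson kernel, q^2 = A^2 - B^2 - C^2
being the square of Im (conj X Y); this is the point of that kernel. *)
Definition disc_point (X Y : R[i]) : R[i] :=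
  let A := (normc X ^+ 2 + normc Y ^+ 2) / 2 in
  let B := (normc X ^+ 2 - normc Y ^+ 2) / 2 in
  let C := Re (conjc X * Y) in
  let q := `|Im (conjc X * Y)| in
  (- B / (A + q)) +i* (C / (A + q)).

Lemma disc_point_spec (X Y : R[i]) : 0 < `|Im (conjc X * Y)| ->
  normc (disc_point X Y) < 1 /\
  forall t, (normc ((cos t)%:C * X + (sin t)%:C * Y) ^+ 2)^-1 =
    `|Im (conjc X * Y)|^-1 * poisson (disc_point X Y * expi (2 * t)).
Proof.
set q := `|_|; set A := (normc X ^+ 2 + normc Y ^+ 2) / 2.
set B := (normc X ^+ 2 - normc Y ^+ 2) / 2; set C := Re (conjc X * Y) => q0.
have A0 : 0 <= A by rewrite /A divr_ge0// addr_ge0 ?sqr_ge0.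
have Aq : 0 < A + q by rewrite ltr_wpDl.
have e : A ^+ 2 = B ^+ 2 + C ^+ 2 + q ^+ 2.
  have : C ^+ 2 + q ^+ 2 = normc X ^+ 2 * normc Y ^+ 2.
    by rewrite /q real_normK ?num_real// -normc_sq normcM normcJ exprMn.
  by rewrite -addrA => ->; rewrite /A /B; field.
have r2 : normc (disc_point X Y) ^+ 2 = (A - q) / (A + q).
  rewrite normc_sq /disc_point -/A -/B -/C -/q /= !expr_div_n sqrrN.
  rewrite -mulrDl (_ : B ^+ 2 + C ^+ 2 = (A - q) * (A + q)); last first.
    by rewrite -subr_sqr e addrK.
  by field; rewrite gt_eqF.
split.
  have : normc (disc_point X Y) ^+ 2 < 1.
    by rewrite r2 ltr_pdivrMr// mul1r; lra.
  by rewrite expr_lt1// normc_ge0.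
move=> t.
have c2 : cos (2 * t) = cos t ^+ 2 - sin t ^+ 2.
  by rewrite mulr_natl mulr2n cosD !expr2.
have s2 : sin (2 * t) = 2 * (sin t * cos t).
  by rewrite mulr_natl mulr2n sinD; ring.
have u2 := cos2Dsin2 t.
rewrite /poisson normcM normc_expi mulr1 r2.
set N2 := normc _ ^+ 2; set W2 := normc (1 - _) ^+ 2.
have N2E : N2 = A + B * cos (2 * t) + C * sin (2 * t).
  rewrite c2 s2 /N2 /A /B /C !normc_sq !(ReD, ImD, ReM, ImM, ReJ, ImJ, ReC, ImC).
  move: (cos t) (sin t) u2 => u v u2.
  transitivity (((Re X ^+ 2 + Im X ^+ 2 + (Re Y ^+ 2 + Im Y ^+ 2)) / 2) * (u ^+ 2 + v ^+ 2)
    + (Re X ^+ 2 + Im X ^+ 2 - (Re Y ^+ 2 + Im Y ^+ 2)) / 2 * (u ^+ 2 - v ^+ 2)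
    + (Re X * Re Y + Im X * Im Y) * (2 * (v * u))); first by field.
  by rewrite u2 mulr1; ring.
have W2E : W2 = 2 * N2 / (A + q).
  rewrite N2E /W2 normc_sq /expi !(ReD, ImD, ReN, ImN, ReM, ImM).
  rewrite /disc_point -/A -/B -/C -/q /=.
  have := cos2Dsin2 (2 * t); move: (cos (2 * t)) (sin (2 * t)) => u v uv.
  transitivity (1 + (B ^+ 2 + C ^+ 2) / (A + q) ^+ 2 * (u ^+ 2 + v ^+ 2) + 2 * (B * u + C * v) / (A + q)).
    by field; rewrite gt_eqF.
  rewrite uv mulr1 (_ : B ^+ 2 + C ^+ 2 = (A - q) * (A + q)); last first.
    by rewrite -subr_sqr e addrK.
  by field; rewrite gt_eqF.
rewrite W2E; have [->|n0] := eqVneq N2 0; first by rewrite mulr0 mul0r invr0 mulr0 mulr0.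
by field; rewrite n0 !gt_eqF.
Qed.

(** The Poisson kernel is 1 + 2 Re (w + w^2 + ...), truncated after K terms. *)
Lemma poisson_expansion (w : R[i]) (r : R) (K : nat) : normc w <= r -> r < 1 ->
  `|poisson w - 1 - 2 * \sum_(k < K) Re (w ^+ k.+1)| <= 2 * (r ^+ K.+1 / (1 - r)).
Proof.
move=> wr r1; have w1 : normc w < 1 by apply: le_lt_trans r1.
have r0 : 0 <= r by apply: le_trans wr; exact: normc_ge0.
have n0 : 1 - w != 0.
  rewrite subr_eq0; apply: contraTneq w1 => <-.
  by rewrite Normc.normc1 ltxx.
have e1 : poisson w = 1 + 2 * Re (w / (1 - w)).
  rewrite /poisson.
  have m0 : normc (1 - w) ^+ 2 != 0 by rewrite expf_eq0/= normc_eq0.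
  have gen (z v : R[i]) : normc v ^+ 2 != 0 -> Re (z / v) = Re (z * conjc v) / normc v ^+ 2.
    rewrite normc_sq; case: v => a b; case: z => c d /= m1.
    by field.
  rewrite gen//.
  move: m0; rewrite !normc_sq !(ReM, ReJ, ImJ, ReD, ImD, ReN, ImN) => m0.
  rewrite -[X in X + 2 * _](divff m0) mulrA -mulrDl; congr (_ / _).
  rewrite -[Re 1]/(1 : R) -[Im 1]/(0 : R); ring.
have e2 : w / (1 - w) = \sum_(k < K) w ^+ k.+1 + w ^+ K.+1 / (1 - w).
  elim: K => [|K IH]; first by rewrite big_ord0 add0r expr1.
  rewrite big_ord_recr/= {}IH -addrA; congr (_ + _); rewrite (exprS _ K.+1); field.
  exact: n0.
have ReS : Re (\sum_(k < K) w ^+ k.+1) = \sum_(k < K) Re (w ^+ k.+1).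
  by elim/big_ind2: _ => // z1 x1 z2 x2 <- <-; rewrite ReD.
rewrite e1 e2 ReD ReS.
rewrite (_ : _ - _ = 2 * Re (w ^+ K.+1 / (1 - w))); last by ring.
rewrite normrM ger0_norm// ler_wpM2l//; apply: le_trans (normc_Re _) _.
rewrite normcM normcX Normc.normcV; apply: ler_pM; rewrite ?exprn_ge0 ?invr_ge0 ?normc_ge0//.
  by rewrite lerXn2r ?nnegrE ?normc_ge0.
rewrite lef_pV2 ?posrE ?normc_gt0 ?subr_gt0//.
have := normcD (1 - w) w; rewrite subrK Normc.normc1; lra.
Qed.

End PoissonKernel.

(** * Inside a band *)

Section Structure.
Variables (R : realType) (L : nat) (J lam : int -> R) (kS : R).
Variables (nul nur : probability (measurableTypeR R) R) (kap : R).
Hypothesis hL : (1 <= L)%N.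
Hypothesis hJ : forall x : int, 1 <= x < L%:Z -> J x != 0.
Hypothesis hkS : kS != 0.
Hypothesis hkap : kap != 0.

Local Notation p11 := (tr11 L J lam kS polyC 'X L).
Local Notation p12 := (tr12 L J lam kS polyC 'X L).
Local Notation p21 := (tr21 L J lam kS polyC 'X L).
Local Notation p22 := (tr22 L J lam kS polyC 'X L).
Local Notation D := (discr L J lam kS).
Local Notation den := (green_den L J lam kS).

(** cos N theta and sin N theta solve the recursion, where theta = acos c. *)
Lemma chebyshev_recursion (c : R) (d : nat -> R[i]) : c ^+ 2 < 1 ->
  (forall N, d N.+2 = (2 * c)%:C * d N.+1 - d N) ->
  forall N, d N = (cos (N%:R * acos c))%:C * d 0%N +
    (sin (N%:R * acos c))%:C * ((Num.sqrt (1 - c ^+ 2))^-1%:C * (d 1%N - c%:C * d 0%N)).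
Proof.
move=> c1 hd.
have cc : -1 <= c <= 1 by apply/andP; split; nra.
have cosc : cos (acos c) = c by rewrite acosK.
have sinc : sin (acos c) = Num.sqrt (1 - c ^+ 2) by rewrite sin_acos.
set s := Num.sqrt _ in sinc *; set th := acos c in cosc sinc *.
have s0 : s != 0 by rewrite gt_eqF// sqrtr_gt0 subr_gt0.
have sC : s%:C * s^-1%:C = 1 by rewrite -rmorphM mulfV.
move=> N; suff : d N = (cos (N%:R * th))%:C * d 0%N +
    (sin (N%:R * th))%:C * (s^-1%:C * (d 1%N - c%:C * d 0%N)) /\
    d N.+1 = (cos (N.+1%:R * th))%:C * d 0%N +
    (sin (N.+1%:R * th))%:C * (s^-1%:C * (d 1%N - c%:C * d 0%N)) by case.
elim: N => [|N [IH1 IH2]].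
  rewrite mul0r cos0 sin0 !mul1r mul0r addr0; split => //.
  by rewrite cosc sinc mulrA sC mul1r addrC subrK.
split => //; rewrite hd IH2 IH1.
have e1 : (N.+2%:R * th) = N.+1%:R * th + th by rewrite -[N.+2]addn1 natrD mulrDl mul1r.
have e0 : (N%:R * th) = N.+1%:R * th - th by rewrite -[N.+1]addn1 natrD mulrDl mul1r addrK.
rewrite e1 e0 cosB sinB (cosD _ th) (sinD _ th) cosc sinc.
move: (cos _) (sin _) => u v.
apply: complex_eq; rewrite !(ReD, ImD, ReN, ImN, ReM, ImM, ReC, ImC); ring.
Qed.

Lemma den_recursion (E : R) fl fr N : 
  den E%:C fl fr N.+2 = (2 * (D.[E] / 2))%:C * den E%:C fl fr N.+1 - den E%:C fl fr N.
Proof.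
by rewrite (den_rec lam hL hJ hkS) discr_real mulrCA divff ?mulr1.
Qed.

Definition denX (fl fr : R[i]) : R[i] := kS%:C - fr * (fl / kS%:C).

Lemma den_at0 (E : R) fl fr : den E%:C fl fr 0 = denX fl fr.
Proof. by rewrite /green_den /denX /=; ring. Qed.

Lemma den_at1 (E : R) fl fr : den E%:C fl fr 1 =
  (p11.[E])%:C * kS%:C - (p12.[E])%:C * (fl / kS%:C)
   + fr * ((p21.[E])%:C * kS%:C - (p22.[E])%:C * (fl / kS%:C)).
Proof. rewrite /green_den /= transferE/= t11_real t12_real t21_real t22_real; ring. Qed.

Definition denY (E : R) (fl fr : R[i]) : R[i] :=
  (Num.sqrt (1 - (D.[E] / 2) ^+ 2))^-1%:C *
  (den E%:C fl fr 1 - (D.[E] / 2)%:C * den E%:C fl fr 0).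

Lemma den_cos (E : R) fl fr N : D.[E] ^+ 2 < 4 ->
  den E%:C fl fr N = (cos (N%:R * acos (D.[E] / 2)))%:C * denX fl fr +
    (sin (N%:R * acos (D.[E] / 2)))%:C * denY E fl fr.
Proof.
move=> hE; have c1 : (D.[E] / 2) ^+ 2 < 1 by rewrite expr_div_n ltr_pdivrMr// mul1r -natrX.
by rewrite (chebyshev_recursion c1 (den_recursion E fl fr)) den_at0 -(den_at0 E).
Qed.

(** Up to the factor y, the current between the two amplitudes of the denominator
is 4 Im fl Im fr times the bracket of the crystalline transmittance: p and ml are the limiting
values of kS^2 m_r and kS^2 m_l at an energy inside a band. *)
Lemma flux_identity (k x y l1 l2 r1 r2 : R) : k != 0 -> 0 < y -> 0 < l2 -> 0 < r2 ->
  let p := x +i* y in let fl := l1 +i* l2 in let fr := r1 +i* r2 in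
  let ml := (k ^+ 2)%:C / (x -i* y) in
  Im (conjc (k%:C - fr * (fl / k%:C)) *
    (- (k * x)%:C + (x ^+ 2 + y ^+ 2)%:C * (fl / k%:C) + fr * (k%:C - x%:C * (fl / k%:C)))) =
  y * (4 * l2 * r2 * (1 + 4^-1 * (normc (p - fr) ^+ 2 / (Im p * Im fr)
        + normc (ml - fl) ^+ 2 / (Im ml * Im fl)))).
Proof.
move=> k0 y0 l0 r0 p fl fr ml.
have n0 : 0 < x ^+ 2 + y ^+ 2 by rewrite ltr_wpDl ?sqr_ge0// exprn_gt0.
have mlE : ml = (k ^+ 2 * x / (x ^+ 2 + y ^+ 2)) +i* (k ^+ 2 * y / (x ^+ 2 + y ^+ 2)).
  by apply: complex_eq => /=; rewrite sqrrN; field; rewrite gt_eqF.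
rewrite mlE /p /fl /fr.
have flk : (l1 +i* l2) / k%:C = (l1 / k) +i* (l2 / k).
  by apply: complex_eq => /=; field.
have rc (a b : R) : Re (a +i* b) = a by [].
have ic (a b : R) : Im (a +i* b) = b by [].
rewrite flk !normc_sq !(ReD, ImD, ReN, ImN, ReM, ImM, ReJ, ImJ) !rc !ic.
by field; rewrite k0 (gt_eqF n0) (gt_eqF l0) (gt_eqF y0) (gt_eqF r0).
Qed.

Lemma crystal_inside (E : R) (fl fr ml mr : R[i]) : sp_crystal L J lam kS E ->
  0 < Im (F_res nul E) -> 0 < Im (F_res nur E) ->
  (kap ^+ 2)%:C * F_res nul E = fl -> (kap ^+ 2)%:C * F_res nur E = fr ->
  (kS ^+ 2)%:C * weyl_l L J lam kS E = ml ->
  (kS ^+ 2)%:C * weyl_r L J lam kS E = mr ->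
  crystal_transmittance L J lam kS nul nur kap E =
  (1 + 4^-1 * (normc (mr - fr) ^+ 2 / (Im mr * Im fr) +
               normc (ml - fl) ^+ 2 / (Im ml * Im fl)))^-1.
Proof.
move=> hs hl hr <- <- <- <-; rewrite /crystal_transmittance.
by have /asboolP -> : (sp_crystal L J lam kS `&` Sigma_res nul `&` Sigma_res nur) E := conj (conj hs hl) hr.
Qed.

(** The entries of T - cos theta are p21 times the coefficients of the quadratic
with roots x + i y and x - i y, so the second amplitude is the expression of
the flux identity times p21 / sin theta; the determinant relation says that
this factor is 1 / y in modulus. *)
Lemma crystal_formula (E : R) : D.[E] ^+ 2 < 4 ->
  0 < Im (F_res nul E) -> 0 < Im (F_res nur E) ->
  let fl := (kap ^+ 2)%:C * F_res nul E in
  let fr := (kap ^+ 2)%:C * F_res nur E in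
  let q := `|Im (conjc (denX fl fr) * denY E fl fr)| in
  4 * Im fl * Im fr <= q /\
  crystal_transmittance L J lam kS nul nur kap E = 4 * Im fl * Im fr / q.
Proof.
move=> hE Fl0 Fr0 fl fr q.
have hsp := in_spectrum hL hJ hkS hE.
have [x [y [y0 a0 hx hxy [wr wl]]]] := weyl_limits hL hJ hkS hE.
have dt := det_real lam hL hJ hkS E.
have dc : D.[E] = p11.[E] + p22.[E] by rewrite /discr hornerD.
have yl0 : 0 < Im fl := Im_kap_gt0 hkap Fl0.
have yr0 : 0 < Im fr := Im_kap_gt0 hkap Fr0.
rewrite (crystal_inside hsp Fl0 Fr0 (erefl fl) (erefl fr) wl wr) {wr wl Fl0 Fr0 hsp}.
rewrite /q {q}; move: fl fr yl0 yr0 => fl fr yl0 yr0.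
set a := p21.[E] in a0 hx hxy dt; set c := D.[E] / 2.
set s := Num.sqrt (1 - c ^+ 2).
have c1 : c ^+ 2 < 1 by rewrite /c expr_div_n ltr_pdivrMr// mul1r -natrX.
have s0 : 0 < s by rewrite sqrtr_gt0 subr_gt0.
have s2 : s ^+ 2 = 1 - c ^+ 2 by rewrite sqr_sqrtr// subr_ge0 ltW.
have e11 : p11.[E] = c - a * x by rewrite /c dc; lra.
have e22 : p22.[E] = c + a * x by rewrite /c dc; lra.
(* the determinant relation det T = 1 *)
have as2 : (s^-1 * a * y) ^+ 2 = 1.
  rewrite !exprMn exprVn s2.
  have -> : 1 - c ^+ 2 = a ^+ 2 * y ^+ 2 by rewrite -dt e11 e22 hxy; ring.
  by field; rewrite a0 gt_eqF.
have as1 : `|s^-1 * a * y| = 1.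
  by apply/eqP; rewrite -(@eqrXn2 _ 2%N)// real_normK ?num_real// as2 expr1n.
have dY : denY E fl fr = (s^-1 * a)%:C * (- (kS * x)%:C +
    (x ^+ 2 + y ^+ 2)%:C * (fl / kS%:C) + fr * (kS%:C - x%:C * (fl / kS%:C))).
  rewrite /denY den_at0 den_at1 -/c -/s -/a e11 e22 hxy /denX.
  by rewrite !(rmorphM, rmorphB, rmorphD, rmorphN, rmorphXn)/=; ring.
have FI := flux_identity x (Re fl) (Re fr) hkS y0 yl0 yr0; cbv zeta in FI.
have eC (z : R[i]) : Re z +i* Im z = z by case: z.
rewrite !eC in FI.
have Imp : 0 < Im ((kS ^+ 2)%:C / (x -i* y)).
  have -> : Im ((kS ^+ 2)%:C / (x -i* y)) = kS ^+ 2 * y / (x ^+ 2 + y ^+ 2).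
    by rewrite /= sqrrN; field; rewrite gt_eqF// ltr_wpDl ?sqr_ge0// exprn_gt0.
  apply: divr_gt0; first by apply: mulr_gt0 => //; rewrite exprn_even_gt0.
  by rewrite ltr_wpDl ?sqr_ge0// exprn_gt0.
have qE : `|Im (conjc (denX fl fr) * denY E fl fr)| =
   4 * Im fl * Im fr * (1 + 4^-1 *
     (normc (x +i* y - fr) ^+ 2 / (Im (x +i* y) * Im fr) +
      normc ((kS ^+ 2)%:C / (x -i* y) - fl) ^+ 2 /
      (Im ((kS ^+ 2)%:C / (x -i* y)) * Im fl))).
  have hI (z w : R[i]) (t : R) : Im (conjc z * (t%:C * w)) = t * Im (conjc z * w).
    by case: z; case: w => a1 b1 a2 b2 /=; ring.
  rewrite dY hI /denX FI.
  rewrite mulrA normrM as1 mul1r ger0_norm//.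
  apply: mulr_ge0; first by rewrite !mulr_ge0// ltW.
  by rewrite addr_ge0// mulr_ge0// addr_ge0// divr_ge0 ?sqr_ge0// mulr_ge0// ?ltW// Imp.
rewrite qE {qE FI dY}.
set S := _ + _ / _.
have S0 : 0 <= S by rewrite addr_ge0// divr_ge0 ?sqr_ge0// mulr_ge0// ?ltW// Imp.
have M0 : 0 < 4 * Im fl * Im fr by rewrite !mulr_gt0.
split; first by rewrite ler_peMr ?(ltW M0)// lerDl mulr_ge0.
by rewrite invfM mulrA divff ?mul1r ?gt_eqF.
Qed.

End Structure.

(** * Outside the bands *)

Section Escape.
Variable R : realType.

Lemma hyperbolic_root (c : R) : 1 < c ^+ 2 ->
  exists2 m : R, 1 < `|m| & m ^+ 2 = 2 * c * m - 1.
Proof.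
move=> c1; set s := Num.sqrt (c ^+ 2 - 1).
have s2 : s ^+ 2 = c ^+ 2 - 1 by rewrite sqr_sqrtr// subr_ge0 ltW.
have s0 : 0 <= s by rewrite sqrtr_ge0.
have [c0|c0] := leP 0 c.
  exists (c + s); last by rewrite sqrrD s2; ring.
  have cg : 1 < c by rewrite -(@ltr_pXn2r _ 2) ?expr1n ?nnegrE.
  by rewrite ger0_norm ?addr_ge0//; lra.
exists (c - s); last by rewrite sqrrB s2; ring.
have cg : 1 < - c by rewrite -(@ltr_pXn2r _ 2) ?expr1n ?nnegrE ?sqrrN// oppr_ge0 ltW.
by rewrite ler0_norm; lra.
Qed.

(** In the eigenbasis of the recursion d_N = (m^N e0 - m^-N f0) / (m - 1/m) with
|m| > 1. If e0 were 0, then d_N would tend to 0, against the lower bound; so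
|d_N| grows like |m|^N. *)
Lemma escape (c : R) (d : nat -> R[i]) (m0 : R) : 1 < c ^+ 2 -> 0 < m0 ->
  (forall N, d N.+2 = (2 * c)%:C * d N.+1 - d N) ->
  (forall N, m0 <= normc (d N)) ->
  (normc (d N) ^+ 2)^-1 @[N --> \oo] --> (0 : R).
Proof.
move=> c1 m00 hd hm; have [m m1 me] := hyperbolic_root c1.
have nm0 : 0 < `|m| by apply: lt_trans m1.
have mn0 : m != 0 by rewrite -normr_gt0.
have mc : 2 * c = m + m^-1.
  by apply: (mulIf mn0); rewrite [RHS]mulrDl (mulVf mn0) -expr2 me subrK.
set del := m - m^-1.
have del0 : del != 0.
  apply/eqP => e; have : m ^+ 2 = 1.
    by move/eqP: e; rewrite subr_eq0 => /eqP e; rewrite expr2 {1}e mulVf.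
  move/eqP; rewrite sqrf_eq1 => /orP[] /eqP e'; move: m1; rewrite e' ?normrN normr1 ltxx//.
pose e0 := d 1%N - m^-1%:C * d 0%N; pose f0 := d 1%N - m%:C * d 0%N.
have eN N : d N.+1 - m^-1%:C * d N = (m ^+ N)%:C * e0.
  elim: N => [|N IH]; first by rewrite expr0 mul1r.
  rewrite exprS rmorphM -mulrA -IH hd mc rmorphD/=.
  rewrite mulrBr mulrA -rmorphM mulfV// mul1r; ring.
have fN N : d N.+1 - m%:C * d N = (m^-1 ^+ N)%:C * f0.
  elim: N => [|N IH]; first by rewrite expr0 mul1r.
  rewrite exprS rmorphM -mulrA -IH hd mc rmorphD/=.
  rewrite mulrBr mulrA -rmorphM mulVf// mul1r; ring.
have dN N : del%:C * d N = (m ^+ N)%:C * e0 - (m^-1 ^+ N)%:C * f0.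
  by rewrite -eN -fN /del rmorphB/=; ring.
set q := `|m|^-1; have q0 : 0 < q by rewrite invr_gt0.
have q1 : q < 1 by rewrite invf_lt1.
have qN : (q ^+ N : R) @[N --> \oo] --> (0 : R).
  by apply: cvg_expr; rewrite ger0_norm ?(ltW q0).
have nX N : normc (m ^+ N)%:C = q^-1 ^+ N by rewrite normcR normrX /q invrK.
have nV N : normc (m^-1 ^+ N)%:C = q ^+ N by rewrite normcR normrX normfV.
have ndel : 0 < `|del| by rewrite normr_gt0.
have e00 : 0 < normc e0.
  rewrite normc_gt0; apply/eqP => e00.
  have h : (q ^+ N * normc f0 : R) @[N --> \oo] --> (0 * normc f0 : R).
    exact: (@cvgMl _ _ _ _ _ _ _ qN).
  have hb N : `|del| * m0 <= q ^+ N * normc f0.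
    rewrite -nV -normcM; have := dN N; rewrite e00 mulr0 sub0r => e.
    by rewrite -normcN -e normcM normcR ler_pM2l.
  have : \forall N \near \oo, q ^+ N * normc f0 < `|del| * m0.
    by move/(@cvgr_lt R) : h; apply; rewrite mul0r mulr_gt0.
  by move=> [N _ /(_ N (leqnn _))] /=; rewrite ltNge hb.
set K := 2 * `|del| / normc e0.
have qN1 N : q ^+ N <= 1 by rewrite exprn_ile1// ltW.
have hK : \forall N \near \oo, (normc (d N) ^+ 2)^-1 <= K ^+ 2 * q ^+ N.
  have h : (q ^+ N * normc f0 : R) @[N --> \oo] --> (0 * normc f0 : R).
    exact: (@cvgMl _ _ _ _ _ _ _ qN).
  have : \forall N \near \oo, q ^+ N * normc f0 < normc e0 / 2.
    by move/(@cvgr_lt R) : h; apply; rewrite mul0r divr_gt0.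
  apply: filterS => N hN.
  have q0N : 0 < q ^+ N by rewrite exprn_gt0.
  have nd : 0 < normc (d N) by apply: lt_le_trans (hm N).
  have h1 : q^-1 ^+ N * normc e0 <= `|del| * normc (d N) + q ^+ N * normc f0.
    rewrite -nX -nV -(normcM (m ^+ N)%:C) -(normcM (m^-1 ^+ N)%:C) -normcR -normcM dN.
    by rewrite -[X in normc X <= _](subrK ((m^-1 ^+ N)%:C * f0)) normcD.
  have h2 : normc e0 <= `|del| * normc (d N) * q ^+ N + q ^+ N * normc f0.
    have : q ^+ N * (q^-1 ^+ N * normc e0) <=
        q ^+ N * (`|del| * normc (d N) + q ^+ N * normc f0) by rewrite ler_pM2l.
    rewrite mulrA exprVn mulfV ?gt_eqF// mul1r mulrDr => /le_trans; apply.
    rewrite mulrC lerD2l ler_piMl// mulr_ge0 ?normc_ge0// ltW//.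
  have h3 : 1 <= K * q ^+ N * normc (d N).
    rewrite /K -(ler_pM2r e00) mul1r.
    have -> : 2 * `|del| / normc e0 * q ^+ N * normc (d N) * normc e0 =
      2 * (`|del| * normc (d N) * q ^+ N) by field; rewrite gt_eqF.
    lra.
  rewrite -[leLHS]mul1r ler_pdivrMr ?exprn_gt0//.
  have h4 : 1 <= (K * q ^+ N * normc (d N)) ^+ 2 by rewrite exprn_ege1.
  apply: (le_trans h4); rewrite 2!exprMn ler_pM2r ?exprn_gt0//.
  by rewrite ler_wpM2l ?sqr_ge0// expr2 ler_piMl// ltW.
apply: (@squeeze_cvgr _ _ _ _ (fun=> 0) (fun N => K ^+ 2 * q ^+ N)).
- by apply: filterS hK => N ->; rewrite invr_ge0 sqr_ge0.
- exact: cvg_cst.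
- rewrite -(mulr0 (K ^+ 2)); exact: (@cvgMr _ _ _ _ _ _ _ qN).
Qed.
End Escape.

(** * Integrals that tend to zero *)

Section VanishingIntegrals.
Context d (T : measurableType d) (R : realType).
Variable mu : {measure set T -> \bar R}.

Lemma cvg0_approx (u : nat -> R) :
  (forall e, 0 < e -> exists2 v : nat -> R, v @ \oo --> (0 : R) &
     forall N, `|u N - v N| <= e) -> u @ \oo --> (0 : R).
Proof.
move=> h; apply/cvgr0Pnorm_lt => e e0.
have e2 : 0 < e / 2 by rewrite divr_gt0.
have [v /cvgr0Pnorm_lt /(_ _ e2) hv hu] := h _ e2.
apply: filterS hv => N hN; rewrite -[u N](subrK (v N)).
by rewrite (le_lt_trans (ler_normD _ _))// [ltRHS]splitr ler_ltD.
Qed.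

Lemma cvg0D (u w : nat -> R) : u @ \oo --> (0 : R) -> w @ \oo --> (0 : R) ->
  (u N + w N) @[N --> \oo] --> (0 : R).
Proof. by move=> hu hw; rewrite -(addr0 (0 : R)); apply: (@cvgD _ R^o). Qed.

Lemma cvg0B (u w : nat -> R) : u @ \oo --> (0 : R) -> w @ \oo --> (0 : R) ->
  (u N - w N) @[N --> \oo] --> (0 : R).
Proof. by move=> hu hw; rewrite -(subrr (0 : R)); apply: (@cvgB _ R^o). Qed.

Lemma cvg0Z (r : R) (u : nat -> R) : u @ \oo --> (0 : R) ->
  (r * u N) @[N --> \oo] --> (0 : R).
Proof. by move=> hu; rewrite -(mulr0 r); apply: (@cvgMr _ _ _ _ _ _ _ hu). Qed.

Definition vanish (v : nat -> T -> R) (A : set T) : Prop :=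
  (\int[mu]_(x in A) v N x) @[N --> \oo] --> (0 : R).

Lemma eq_vanish (u w : nat -> T -> R) (A : set T) :
  (forall N x, A x -> u N x = w N x) -> vanish u A -> vanish w A.
Proof.
move=> uw; rewrite /vanish; set p := (X in X @ \oo --> _ -> _).
set q := (X in _ -> X @ \oo --> _); suff -> : p = q by [].
by apply/funext => N; apply: eq_Rintegral => x /set_mem; exact: uw.
Qed.

Variables (v : nat -> T -> R) (g : T -> R).
Hypothesis mv : forall N, measurable_fun setT (v N).
Hypothesis ig : mu.-integrable setT (EFin \o g).
Hypothesis vg : forall N x, `|v N x| <= g x.

Lemma dominated_integrableS N A : measurable A -> mu.-integrable A (EFin \o v N).
Proof.
move=> mA; apply: (integrableS measurableT mA) => //.
apply: (le_integrable _ _ _ ig) => //; first exact/measurable_EFinP.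
by move=> x _ /=; rewrite lee_fin (le_trans (vg N x))// ler_norm.
Qed.

Lemma Rintegral_setD (f : T -> R) A B : measurable A -> measurable B -> A `<=` B ->
  mu.-integrable B (EFin \o f) ->
  \int[mu]_(x in B `\` A) f x = \int[mu]_(x in B) f x - \int[mu]_(x in A) f x.
Proof.
move=> mA mB AB iB; apply/eqP; rewrite eq_sym subr_eq; apply/eqP.
rewrite addrC -Rintegral_setU//.
- by rewrite setDUK.
- exact: measurableD.
- by rewrite setDUK.
- by rewrite disj_set2E; apply/eqP; rewrite setDE setICA setICr setI0.
Qed.

Lemma vanish_setD A B : measurable A -> measurable B -> A `<=` B ->
  vanish v A -> vanish v B -> vanish v (B `\` A).
Proof.
move=> mA mB AB hA hB; rewrite /vanish.
under eq_fun do rewrite (Rintegral_setD mA mB AB (dominated_integrableS _ mB)).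
exact: cvg0B.
Qed.

Lemma vanish_setU A B : measurable A -> measurable B -> [disjoint A & B] ->
  vanish v A -> vanish v B -> vanish v (A `|` B).
Proof.
move=> mA mB AB hA hB; rewrite /vanish.
have mAB := measurableU _ _ mA mB.
under eq_fun do rewrite (Rintegral_setU mA mB (dominated_integrableS _ mAB) AB).
exact: cvg0D.
Qed.

(** The domination makes the integral over the rest of the union small uniformly
in N. *)
Lemma vanish_increasing (F : nat -> set T) : nondecreasing_seq F ->
  (forall n, measurable (F n)) -> (forall n, vanish v (F n)) ->
  vanish v (\bigcup_n F n).
Proof.
move=> ndF mF hF; set U := \bigcup_n F n.
have mU : measurable U by exact: bigcupT_measurable.
have g0 x : 0 <= g x by apply: le_trans (vg 0%N x).
have igA A : measurable A -> mu.-integrable A (EFin \o g).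
  by move=> mA; apply: (integrableS measurableT mA).
have cvg_g : (\int[mu]_(x in F n) g x) @[n --> \oo] --> \int[mu]_(x in U) g x.
  apply: fine_cvg; rewrite fineK; last exact: integrable_fin_num (igA _ mU).
  apply: ge0_nondecreasing_set_cvg_integral => //.
    by move=> i; exact: (measurable_int mu (igA _ (mF i))).
  by move=> i x _; rewrite lee_fin.
apply: cvg0_approx => e e0.
move/cvgrPdist_le : cvg_g => /(_ e e0) [n _ /(_ n (leqnn n))] /= hn.
exists (fun N => \int[mu]_(x in F n) v N x) => [|N]; first exact: hF.
have FU : F n `<=` U by move=> x hx; exists n.
rewrite -(Rintegral_setD (mF n) mU FU (dominated_integrableS _ mU)).
have mD := measurableD mU (mF n).
apply: (le_trans (le_normr_Rintegral mD (dominated_integrableS _ mD))).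
apply: le_trans (le_trans (ler_norm _) hn).
rewrite -(Rintegral_setD (mF n) mU FU (igA _ mU)).
apply: le_Rintegral => //; last exact: igA.
by have := integrable_norm (dominated_integrableS N mD).
Qed.

Lemma vanish_bigsetU (F : nat -> set T) n : trivIset setT F ->
  (forall n, measurable (F n)) -> (forall n, vanish v (F n)) ->
  vanish v (\big[setU/set0]_(k < n) F k).
Proof.
move=> tF mF hF; elim: n => [|n IH].
  by rewrite big_ord0 /vanish; under eq_fun do rewrite Rintegral_set0; exact: cvg_cst.
rewrite big_ord_recr/=; apply: vanish_setU => //.
  exact: bigsetU_measurable.
rewrite disj_set2E; apply/eqP; rewrite -bigcup_mkord.
have /trivIsetP tF' := tF.
rewrite setI_bigcupl; apply: bigcup0 => k /= kn.
by apply: tF' => //; rewrite lt_eqF.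
Qed.

Lemma vanish_trivIset (F : nat -> set T) : trivIset setT F ->
  (forall n, measurable (F n)) -> (forall n, vanish v (F n)) ->
  vanish v (\bigcup_n F n).
Proof.
move=> tF mF hF.
have -> : \bigcup_n F n = \bigcup_n \big[setU/set0]_(k < n.+1) F k.
  by rewrite -bigcup_bigsetU_bigcup.
apply: vanish_increasing => n; [|exact: bigsetU_measurable|exact: vanish_bigsetU].
by move=> m nm; apply/subsetPset; exact: subset_bigsetU.
Qed.

(** The sets on which the integrals vanish in the limit form a Dynkin system. *)
Lemma vanish_generated (G : set (set T)) : @measurable _ T = <<s G >> ->
  setI_closed G -> vanish v setT -> (forall A, G A -> vanish v A) ->
  forall A, measurable A -> vanish v A.
Proof.
move=> hG GI hT hA A; rewrite hG => mA.
apply: (dynkin_induction hG GI hT hA _ _ mA).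
- move=> S mS hS; rewrite -setTD; exact: vanish_setD.
- by move=> F mF tF hF; apply: vanish_trivIset.
Qed.

End VanishingIntegrals.

Import HBSimple.
Section VanishingDensity.
Context d (T : measurableType d) (R : realType).
Variable mu : {measure set T -> \bar R}.
Variables (v : nat -> T -> R) (g : T -> R) (C : R).
Hypothesis mv : forall N, measurable_fun setT (v N).
Hypothesis ig : mu.-integrable setT (EFin \o g).
Hypothesis vg : forall N x, `|v N x| <= g x.
Hypothesis vC : forall N x, `|v N x| <= C.
Hypothesis hv : forall A, measurable A -> vanish mu v A.

Lemma bounded_mul_integrable N (k : T -> R) : mu.-integrable setT (EFin \o k) ->
  mu.-integrable setT (EFin \o (fun x => k x * v N x)).
Proof.
move=> ik; apply: (integrableMl measurableT ik (mv N)).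
exists C; split; first exact: num_real.
by move=> M hM x _ /=; apply: le_trans (vC N x) (ltW hM).
Qed.

Lemma vanish_step (A : R -> set T) (s : seq R) : (forall r, measurable (A r)) ->
  vanish mu (fun N x => (\sum_(r <- s) r * \1_(A r) x) * v N x) setT.
Proof.
move=> mA.
have iS r N : mu.-integrable setT (EFin \o (fun x => r * (v N \_ (A r)) x)).
  have := dominated_integrableS mv ig vg N (mA r).
  rewrite (integrable_mkcond _ (mA r)) => h.
  have -> : EFin \o (fun x => r * (v N \_ (A r)) x) =
      (fun x => r%:E * (((EFin \o v N) \_ (A r)) x))%E.
    by apply/funext => x; rewrite /= !patchE; case: (x \in _); rewrite /= -EFinM.
  exact: integrableZl.
have eS r x N : (r * \1_(A r) x) * v N x = r * (v N \_ (A r)) x.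
  by rewrite patchE indicE; case: (x \in _); rewrite ?mulr1 ?mulr0 ?mul0r.
suff : (forall N, mu.-integrable setT
          (EFin \o (fun x => (\sum_(r <- s) r * \1_(A r) x) * v N x))) /\
   vanish mu (fun N x => (\sum_(r <- s) r * \1_(A r) x) * v N x) setT by case.
elim: s => [|r s [iIH IH]].
  have e N : (fun x => (\sum_(r <- [::]) r * \1_(A r) x) * v N x) = cst 0.
    by apply/funext => x; rewrite big_nil mul0r.
  split=> [N|]; first by rewrite e; exact: integrable0.
  by rewrite /vanish; under eq_fun do rewrite e Rintegral_cst// mul0r; exact: cvg_cst.
have e N : (fun x => (\sum_(r <- r :: s) r * \1_(A r) x) * v N x) =
    (fun x => r * (v N \_ (A r)) x + (\sum_(r <- s) r * \1_(A r) x) * v N x).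
  by apply/funext => x; rewrite big_cons mulrDl eS.
split=> [N|].
  rewrite e; have -> : EFin \o (fun x => r * (v N \_ (A r)) x + (\sum_(r <- s) r * \1_(A r) x) * v N x) = (EFin \o (fun x => r * (v N \_ (A r)) x)) \+ (EFin \o (fun x => (\sum_(r <- s) r * \1_(A r) x) * v N x)) by [].
  exact: integrableD.
rewrite /vanish; under eq_fun do rewrite e RintegralD//.
apply: cvg0D => //.
have i1 N : mu.-integrable setT (EFin \o (v N \_ (A r))).
  have := dominated_integrableS mv ig vg N (mA r).
  by rewrite (integrable_mkcond _ (mA r)) -restrict_EFin.
under eq_fun do rewrite RintegralZl// -Rintegral_mkcond.
exact/cvg0Z/hv.
Qed.

(** Simple functions are dense in L^1 and the functions v N are uniformly bounded. *)
Lemma vanish_mul (k : T -> R) : mu.-integrable setT (EFin \o k) ->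
  vanish mu (fun N x => k x * v N x) setT.
Proof.
move=> ik; have [f [fi _ fk]] := approximation_sfun_integrable measurableT ik.
have ikf n : mu.-integrable setT (EFin \o (fun x => k x - f n x)).
  have -> : EFin \o (fun x => k x - f n x) = ((EFin \o k) \- (EFin \o f n))%E by [].
  exact: integrableB.
have ikf' n : mu.-integrable setT (EFin \o (fun x => `|k x - f n x|)).
  by have := integrable_norm (ikf n).
have {}fk : (\int[mu]_x `|k x - f n x|) @[n --> \oo] --> (0 : R).
  by apply: fine_cvg.
apply: cvg0_approx => e e0.
have C0 : 0 < `|C| + 1 by rewrite ltr_wpDl.
have e'0 : 0 < e / (`|C| + 1) by rewrite divr_gt0.
move/cvgr0Pnorm_le : fk => /(_ _ e'0) [n _ /(_ n (leqnn n))] /= hn.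
exists (fun N => \int[mu]_x (f n x * v N x)) => [|N].
  pose A r : set T := f n @^-1` [set r].
  have mA r : measurable (A r).
    by apply: measurable_funPTI; exact: measurable_set1.
  apply: eq_vanish (vanish_step (finmap.enum_fset (fset_set (range (f n)))) mA) => N' x _.
  by rewrite fimfunE fsbig_finite.
rewrite -RintegralB//; [|exact: bounded_mul_integrable..].
under eq_Rintegral do rewrite -mulrBl.
have i1 := bounded_mul_integrable N (ikf n).
apply: (le_trans (le_normr_Rintegral measurableT i1)).
have : \int[mu]_x (`|k x - f n x| * (`|C| + 1)) <= e.
  rewrite RintegralZr// -ler_pdivlMr//.
  by apply: le_trans hn; exact: ler_norm.
apply: le_trans; apply: le_Rintegral => //.
- by have := integrable_norm i1.
- have -> : EFin \o (fun x => `|k x - f n x| * (`|C| + 1)) =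
    (fun x => (`|k x - f n x|%R%:E * (`|C| + 1)%R%:E)%E) by apply/funext => x; rewrite /= EFinM.
  exact: (integrableZr measurableT _ (ikf' n)).
- move=> x _ /=; rewrite normrM ler_wpM2l// (le_trans (vC N x))//.
  by rewrite (le_trans (ler_norm _))// lerDl.
Qed.

End VanishingDensity.

(** * Oscillatory integrals *)

Section OscillationItv.
Variable R : realType.
Local Notation mu := (@lebesgue_measure R).
Variables (th dth : R -> R) (b0 : R).

Definition wave (N : nat) (x : R) : R := cos (N%:R * th x - b0).

Lemma normr_wave N x : `|wave N x| <= 1.
Proof. by rewrite ler_norml cos_geN1 cos_le1. Qed.

(** The integrand is the derivative of sin (N theta - b0) / N. *)
Lemma wave_primitive (a b : R) (N : nat) : a < b -> (0 < N)%N ->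
  (forall x, a <= x <= b -> is_derive x (1 : R) th (dth x)) ->
  (forall x, a <= x <= b -> {for x, continuous dth}) ->
  \int[mu]_(x in `[a, b]) (dth x * wave N x) =
  (sin (N%:R * th b - b0) - sin (N%:R * th a - b0)) / N%:R.
Proof.
move=> ab N0 hd hc.
have Nn : N%:R != 0 :> R by rewrite pnatr_eq0 -lt0n.
pose F x := sin (N%:R * th x - b0) / N%:R.
have dF x : a <= x <= b -> is_derive x (1 : R) F (dth x * wave N x).
  move=> hx; have h := hd x hx; rewrite /F /wave.
  by apply: is_derive_eq; rewrite !scaler0 !add0r !subr0; rewrite /GRing.scale /=; field.
have cF x : a <= x <= b -> {for x, continuous F}.
  move=> hx; apply/differentiable_continuous/derivable1_diffP.
  by have [] := dF x hx.
have cth x : a <= x <= b -> {for x, continuous th}.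
  move=> hx; apply/differentiable_continuous/derivable1_diffP.
  by have [] := hd x hx.
have cf x : a <= x <= b -> {for x, continuous (fun x => dth x * wave N x)}.
  move=> hx; apply: cvgM; first exact: hc.
  apply: (@continuous_comp _ _ _ (fun x => N%:R * th x - b0) cos); last exact: continuous_cos.
  by apply: cvgB; [apply: cvgMr; exact: cth|exact: cvg_cst].
rewrite /Rintegral (@continuous_FTC2 _ _ F a b)//.
- by rewrite /F /= -mulrBl.
- apply: continuous_in_subspaceT => x; rewrite inE/= in_itv/= => hx; exact: cf.
- split.
  + by move=> x; rewrite in_itv/= => /andP[ax xb]; have := dF x; rewrite !ltW// => /(_ isT) [].
  + by apply: cvg_at_right_filter; apply: cF; rewrite lexx ltW.
  + by apply: cvg_at_left_filter; apply: cF; rewrite lexx ltW.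
- move=> x; rewrite in_itv/= => /andP[ax xb]; rewrite derive1E.
  by have := dF x; rewrite !ltW// => /(_ isT) h; rewrite derive_val.
Qed.

Variables (a b : R).
Hypothesis ab : a < b.
Hypothesis hd : forall x, a <= x <= b -> is_derive x (1 : R) th (dth x).
Hypothesis hc : forall x, a <= x <= b -> {for x, continuous dth}.

Lemma th_continuous x : a <= x <= b -> {for x, continuous th}.
Proof.
move=> hx; apply/differentiable_continuous/derivable1_diffP.
by have [] := hd hx.
Qed.

Lemma cvg_inv_nat : (N%:R^-1 : R) @[N --> \oo] --> (0 : R).
Proof. by rewrite -cvg_shiftS; exact: cvg_harmonic. Qed.

Lemma wave_vanish_itv c d : a <= c -> d <= b ->
  vanish mu (fun N x => dth x * wave N x) `[c, d].
Proof.
move=> ac db; have [cd|dc] := ltP c d; last first.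
  rewrite /vanish; move: dc; rewrite le_eqVlt => /predU1P[->|dc].
    by under eq_fun do rewrite set_itv1 Rintegral_set1; exact: cvg_cst.
  by under eq_fun do rewrite set_itv_ge ?bnd_simp -?ltNge// Rintegral_set0; exact: cvg_cst.
rewrite /vanish; apply: (@squeeze_cvgr _ _ _ _ (fun N => - (2 * N%:R^-1)) (fun N => 2 * N%:R^-1)).
- exists 1%N => // N /= N0.
  have hd' x : c <= x <= d -> is_derive x (1 : R) th (dth x).
    by move=> /andP[cx xd]; apply: hd; rewrite (le_trans ac)// (le_trans xd).
  have hc' x : c <= x <= d -> {for x, continuous dth}.
    by move=> /andP[cx xd]; apply: hc; rewrite (le_trans ac)// (le_trans xd).
  rewrite (wave_primitive cd N0 hd' hc').
  rewrite -ler_norml normrM (normfV N%:R) normr_nat ler_wpM2r//.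
  rewrite (le_trans (ler_normB _ _))// [leRHS](_ : 2 = 1 + 1 :> R)//.
  by apply: lerD; rewrite ler_norml sin_geN1 sin_le1.
- rewrite -oppr0; apply: (@cvgN _ R^o); exact/cvg0Z/cvg_inv_nat.
- exact/cvg0Z/cvg_inv_nat.
Qed.

Let I : set (measurableTypeR R) := `[a, b]%classic.

Let mI : measurable I. Proof. exact: measurable_itv. Qed.

Lemma wave_measurable N : measurable_fun I (wave N : measurableTypeR R -> R).
Proof.
apply: subspace_continuous_measurable_fun => //.
apply: continuous_in_subspaceT => x; rewrite inE/= /I/= in_itv/= => hx.
apply: (@continuous_comp _ _ _ (fun x => N%:R * th x - b0) cos); last exact: continuous_cos.
by apply: cvgB; [apply: cvgMr; exact: th_continuous|exact: cvg_cst].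
Qed.

Lemma within_dth : {within I, continuous dth}.
Proof.
by apply: continuous_in_subspaceT => x; rewrite inE/= /I/= in_itv/= => hx; exact: hc.
Qed.

Let v N : measurableTypeR R -> R := (fun x => dth x * wave N x) \_ I.
Let g : measurableTypeR R -> R := (fun x => `|dth x|) \_ I.

Let mv N : measurable_fun setT (v N).
Proof.
have h1 : measurable_fun I (dth : measurableTypeR R -> R).
  by apply: subspace_continuous_measurable_fun => //; exact: within_dth.
have h2 := measurable_funM h1 (wave_measurable N).
have [h _] := measurable_restrictT ((fun x => dth x * wave N x) : measurableTypeR R -> measurableTypeR R) mI.
exact: h h2.

Qed.

Let ig : mu.-integrable setT (EFin \o g).
Proof.
have := continuous_compact_integrable (@segment_compact _ a b) within_dth.
move=> /integrable_norm /(integrable_mkcond _ mI).1.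
by rewrite /g -restrict_EFin.
Qed.

Let vg N x : `|v N x| <= g x.
Proof.
rewrite /v /g !patchE; case: ifP => _; last by rewrite normr0.
by rewrite normrM ler_piMr// normr_wave.
Qed.

Let dth_bounded : exists C, forall N x, `|v N x| <= C.
Proof.
have [M [_ hM]] := compact_bounded (continuous_compact within_dth (@segment_compact _ a b)).
exists (`|M| + 1) => N x; apply: (le_trans (vg N x)); rewrite /g patchE.
case: ifPn => [xI|_]; last by rewrite addr_ge0.
apply: hM; first by rewrite (le_lt_trans (ler_norm _))// ltrDl.
by exists x => //; exact: set_mem.
Qed.

Let v_vanish A : measurable A -> vanish mu v A.
Proof.
apply: (vanish_generated mv ig vg (G := @RGenOInfty.G R)).
- exact: RGenOInfty.measurableE.
- move=> _ _ [x ->] [y ->]; exists (Num.max x y).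
  by apply/seteqP; split => z /=; rewrite !in_itv/= !andbT gt_max => /andP.
- rewrite /vanish; under eq_fun do rewrite -Rintegral_mkcond.
  exact: wave_vanish_itv.
- move=> _ [x ->]; rewrite /vanish; under eq_fun do rewrite -Rintegral_mkcondr.
  have [xa|ax] := ltP x a.
    have -> : `]x, +oo[%classic `&` I = I.
      by rewrite setIidr// => y; rewrite /I/= !in_itv/= andbT => /andP[/(lt_le_trans xa)].
    exact: wave_vanish_itv.
  have e : `]x, +oo[%classic `&` I = `]x, b]%classic.
    apply/seteqP; split=> y; rewrite /I/= !in_itv/= andbT; first by move=> [-> /andP[]].
    by move=> /andP[xy ->]; rewrite xy (le_trans ax (ltW xy)).
  have iI N : mu.-integrable `]x, b]%classic (EFin \o (fun x => dth x * wave N x)).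
    apply: (@integrableS _ _ _ _ I) => //.
      by rewrite -e; exact: subIsetr.
    apply/(integrable_mkcond _ mI); have := dominated_integrableS mv ig vg N measurableT.
    by rewrite /v -restrict_EFin.
  under eq_fun => N do rewrite e (Rintegral_itv_obnd_cbnd (iI N)).
  exact: wave_vanish_itv.
Qed.

Hypothesis dth0 : forall x, a <= x <= b -> dth x != 0.

Let r : measurableTypeR R -> R := (fun x => (dth x)^-1) \_ I.

Let within_r : {within I, continuous (fun x => (dth x)^-1)}.
Proof.
apply: continuous_in_subspaceT => x; rewrite inE/= /I/= in_itv/= => hx.
by apply: cvgV; [exact: dth0|exact: hc].
Qed.

(** With the weight theta' the integrals over rays, restricted to [a, b], are
O(1/N), hence they vanish in the limit over every Borel set, and against every
integrable function by density. The weight is removed by dividing by theta',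
which is bounded away from 0 on [a, b]. *)
Lemma wave_vanish (h : measurableTypeR R -> R) (A : set (measurableTypeR R)) :
  mu.-integrable setT (EFin \o h) -> measurable A -> A `<=` `[a, b] ->
  vanish mu (fun N x => h x * wave N x) A.
Proof.
move=> ih mA AI; have [C hC] := dth_bounded.
have ihA : mu.-integrable setT (EFin \o (h \_ A)).
  have := (integrable_mkcond (EFin \o h) mA).1 (integrableS measurableT mA (@subsetT _ _) ih).
  by rewrite -restrict_EFin.
have mr : measurable_fun setT r.
  have h1 : measurable_fun I ((fun x => (dth x)^-1) : measurableTypeR R -> R).
    by apply: subspace_continuous_measurable_fun => //; exact: within_r.
  have [h2 _] := measurable_restrictT ((fun x => (dth x)^-1) : measurableTypeR R -> measurableTypeR R) mI.
  exact: h2.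
have br : [bounded r x | x in setT].
  have [M [_ hM]] := compact_bounded (continuous_compact within_r (@segment_compact _ a b)).
  exists `|M|; split; first exact: num_real.
  move=> K hK x _ /=; rewrite /r patchE; case: ifPn => [xI|_].
    apply: hM; first by rewrite (le_lt_trans (ler_norm _)).
    by exists x => //; exact: set_mem.
  by rewrite normr0 (le_trans _ (ltW hK)).
have ik := integrableMl measurableT ihA mr br.
have hv := vanish_mul mv ig vg hC v_vanish ik.
suff : vanish mu (fun N => (fun x => h x * wave N x) \_ A) setT.
  by rewrite /vanish; under eq_fun do rewrite -Rintegral_mkcond.
apply: eq_vanish hv => N x _.
rewrite /= /r /v !patchE; case: ifPn => [xA|_]; last by rewrite !mul0r.
have xI : x \in I by rewrite inE; apply: AI; exact: set_mem.
rewrite xI; have := xI; rewrite inE /I /= in_itv/= => /dth0 d0.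
by rewrite -mulrA mulKf.
Qed.

End OscillationItv.

Section OscillationOpen.
Variable R : realType.
Local Notation mu := (@lebesgue_measure R).
Local Notation T := (measurableTypeR R).
Variables (th dth : R -> R) (b0 : R) (B : set R).
Hypothesis oB : open B.
Hypothesis hd : forall x, B x -> is_derive x (1 : R) th (dth x).
Hypothesis hc : forall x, B x -> {for x, continuous dth}.
Hypothesis dth0 : forall x, B x -> dth x != 0.

(** Countably many compact intervals, cutting the open set B into pieces on which
the derivative of the phase is bounded away from 0. *)
Definition rat_itv (n : nat) : set T :=
  if @unpickle (rat * rat)%type n is Some p then
    if `[< ratr p.1 < ratr p.2 :> R /\ `[ratr p.1, ratr p.2]%classic `<=` B >]
    then `[ratr p.1, ratr p.2]%classic else set0
  else set0.

Lemma measurable_rat_itv n : measurable (rat_itv n).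
Proof. by rewrite /rat_itv; case: unpickle => // p; case: ifP => _ //; exact: measurable_itv. Qed.

Lemma rat_itv_cover x : B x -> exists n, rat_itv n x.
Proof.
move=> Bx; have [e /= e0 he] := open_itvoo_subset oB Bx.
have e2 : 0 < e / 2 by rewrite divr_gt0.
have {}he := he (e / 2) _ e2.
have {}he : `]x - e / 2, x + e / 2[%classic `<=` B.
  by apply: he; rewrite /= sub0r normrN gtr0_norm// ltr_pdivrMr// ltr_pMr// ltr1n.
have [p] : exists p : rat, ratr p \in `]x - e / 2, x[ by apply: rat_in_itvoo; rewrite ltrBlDr ltrDl.
have [q] : exists q : rat, ratr q \in `]x, x + e / 2[ by apply: rat_in_itvoo; rewrite ltrDl.
rewrite !in_itv/= => /andP[q1 q2] /andP[p1 p2].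
exists (pickle (p, q)); rewrite /rat_itv pickleK/=.
case: asboolP => [_|]; first by rewrite /= in_itv/= !ltW.
case; split; first exact: lt_trans q1.
move=> y /=; rewrite in_itv/= => /andP[y1 y2]; apply: he; rewrite /= in_itv/=.
by rewrite (lt_le_trans p1)//= (le_lt_trans y2).
Qed.

Lemma wave_vanish_rat_itv n (h : T -> R) (A : set T) :
  mu.-integrable setT (EFin \o h) -> measurable A -> A `<=` rat_itv n ->
  vanish mu (fun N x => h x * wave th b0 N x) A.
Proof.
rewrite /rat_itv => ih mA; have h0 : vanish mu (fun N x => h x * wave th b0 N x) set0.
  by rewrite /vanish; under eq_fun do rewrite Rintegral_set0; exact: cvg_cst.
case: unpickle => [p|]; last by rewrite subset0 => ->.
case: asboolP => [[ab abB]|_]; last by rewrite subset0 => ->.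
apply: (@wave_vanish _ _ dth) => // x hx.
- by apply: hd; apply: abB; rewrite /= in_itv.
- by apply: hc; apply: abB; rewrite /= in_itv.
- by apply: dth0; apply: abB; rewrite /= in_itv.
Qed.

Lemma wave_measurable_open N : measurable_fun (B : set T) (wave th b0 N : T -> R).
Proof.
apply: open_continuous_measurable_fun => // x /set_mem Bx.
have cth : {for x, continuous th}.
  by apply/differentiable_continuous/derivable1_diffP; have [] := hd Bx.
apply: (@continuous_comp _ _ _ (fun x => N%:R * th x - b0) cos); last exact: continuous_cos.
by apply: cvgB; [apply: cvgMr; exact: cth|exact: cvg_cst].
Qed.

Lemma wave_vanish_open (h : T -> R) (A : set T) :
  mu.-integrable setT (EFin \o h) -> measurable A -> A `<=` B ->
  vanish mu (fun N x => h x * wave th b0 N x) A.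
Proof.
move=> ih mA AB.
have mB : measurable (B : set T) by exact: open_measurable.
pose v N : T -> R := (fun x => h x * wave th b0 N x) \_ A.
have mh : measurable_fun setT h by apply/measurable_EFinP; exact: (measurable_int mu ih).
have mv N : measurable_fun setT (v N).
  have h1 : measurable_fun A (wave th b0 N : T -> R).
    exact: measurable_funS (wave_measurable_open N).
  have h2 := measurable_funM (measurable_funS measurableT (@subsetT _ A) mh) h1.
  have [h3 _] := measurable_restrictT ((fun x => h x * wave th b0 N x) : T -> T) mA.
  exact: h3.
have ig : mu.-integrable setT (EFin \o (fun x => `|h x|)) by have := integrable_norm ih.
have vg N x : `|v N x| <= `|h x|.
  rewrite /v patchE; case: ifP => _; last by rewrite normr0.
  by rewrite normrM ler_piMr// normr_wave.
have vE (A' : set T) N x : A' `<=` A -> A' x -> v N x = h x * wave th b0 N x.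
  by move=> A'A /A'A xA; rewrite /v patchE mem_set.
pose F n := A `&` \big[setU/set0]_(k < n) rat_itv k.
have mF n : measurable (F n).
  by apply: measurableI => //; apply: bigsetU_measurable => k _; exact: measurable_rat_itv.
have AF : A = \bigcup_n F n.
  apply/seteqP; split=> x; last by move=> [n _ []].
  move=> Ax; have [n hn] := rat_itv_cover (AB _ Ax).
  by exists n.+1 => //; split => //; rewrite big_ord_recr; right.
suff hU : vanish mu v (\bigcup_n F n) by rewrite -AF in hU; apply: eq_vanish hU => N x; exact: vE.
apply: (vanish_increasing mv ig vg _ mF) => [m n mn|].
  by apply/subsetPset; apply: setIS; exact: subset_bigsetU.
elim=> [|n IH].
  by rewrite /F big_ord0 setI0 /vanish; under eq_fun do rewrite Rintegral_set0; exact: cvg_cst.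
have -> : F n.+1 = F n `|` ((A `&` rat_itv n) `\` F n).
  by rewrite [RHS]setUC setDE setUIl (setUC (~` _)) setUCr setIT setUC /F big_ord_recr/= setIUr.
apply: (vanish_setU mv ig vg) => //.
- by apply: measurableD => //; apply: measurableI => //; exact: measurable_rat_itv.
- by rewrite disj_set2E; apply/eqP; rewrite setDE setICA setICr setI0.
- have h1 : (A `&` rat_itv n) `\` F n `<=` A by move=> x [[]].
  have h2 : vanish mu (fun N x => h x * wave th b0 N x) ((A `&` rat_itv n) `\` F n).
    apply: (@wave_vanish_rat_itv n) => //; last by move=> x [[]].
    by apply: measurableD => //; apply: measurableI => //; exact: measurable_rat_itv.
  by apply: eq_vanish h2 => N x /(vE _ N _ h1).
Qed.

End OscillationOpen.

Section PolynomialPhase.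
Variable R : realType.
Local Notation mu := (@lebesgue_measure R).
Local Notation T := (measurableTypeR R).
Variable D : {poly R}.

(** The energies inside the bands where the phase has a nonzero derivative. *)
Definition band : set R := [set E | D.[E] ^+ 2 < 4 /\ D^`().[E] != 0].

Definition phase (E : R) : R := acos (D.[E] / 2).

Lemma open_band : open band.
Proof.
have o1 : open ((fun E => D.[E] ^+ 2) @^-1` [set y | y < 4]).
  apply: open_comp => [x _|]; last exact: open_lt.
  by apply: (@continuous_comp _ _ _ (horner D) (fun y => y ^+ 2)); [exact: continuous_horner|exact: exprn_continuous].
have o2 : open ((horner D^`()) @^-1` [set y | y != 0]).
  apply: open_comp => [x _|]; last exact: open_neq.
  exact: continuous_horner.
exact: (openI o1 o2).
Qed.

Lemma measurable_band : measurable (band : set T).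
Proof. by apply: open_measurable; exact: open_band. Qed.

(** The Riemann-Lebesgue lemma for the phase theta with 2 cos theta = D. *)
Lemma phase_vanish (b0 : R) (h : T -> R) (A : set T) :
  mu.-integrable setT (EFin \o h) -> measurable A -> A `<=` band ->
  vanish mu (fun N x => h x * cos (N%:R * phase x - b0)) A.
Proof.
pose dth x := - (Num.sqrt (1 - (D.[x] / 2) ^+ 2))^-1 * (D^`().[x] / 2).
have hs x : D.[x] ^+ 2 < 4 -> (D.[x] / 2) ^+ 2 < 1.
  by move=> hE; rewrite expr_div_n ltr_pdivrMr// mul1r -natrX.
apply: (@wave_vanish_open _ phase dth b0 band open_band) => x [/hs hx hx'].
- have hx1 : -1 < D.[x] / 2 < 1 by apply/andP; split; nra.
  have h1 : is_derive x (1 : R) (fun x => D.[x] / 2) (D^`().[x] / 2).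
    have hp : is_derive x (1 : R) (horner D) D^`().[x].
      by split; [exact: derivable_horner|rewrite derivE derive1E].
    by apply: is_derive_eq; rewrite !scaler0 add0r /GRing.scale/= mulrC.
  have h2 := is_derive1_acos hx1.
  by apply: is_derive_eq; rewrite /dth /GRing.scale/= mulrC.
- apply: (@cvgM R^o).
    apply: cvgN; apply: cvgV; first by rewrite gt_eqF// sqrtr_gt0 subr_gt0.
    apply: (@continuous_comp _ _ _ (fun x => 1 - (D.[x] / 2) ^+ 2) Num.sqrt); last exact: sqrt_continuous.
    apply: cvgB; first exact: cvg_cst.
    apply: (@continuous_comp _ _ _ (fun x => D.[x] / 2) (fun y => y ^+ 2)); last exact: exprn_continuous.
    by apply: cvgMl; exact: continuous_horner.
  by apply: cvgMl; exact: continuous_horner.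
- by rewrite /dth mulf_neq0// ?oppr_eq0 ?invr_eq0 ?mulf_neq0// ?invr_eq0// gt_eqF// sqrtr_gt0 subr_gt0.
Qed.

End PolynomialPhase.

(** * Averaging the Poisson kernel over the phase *)

Section PhaseHarmonics.
Variable R : realType.
Local Notation mu := (@lebesgue_measure R).
Local Notation T := (measurableTypeR R).
Variable D : {poly R}.

Lemma expiX (t : R) n : expi t ^+ n = expi (n%:R * t).
Proof.
elim: n => [|n IH]; first by rewrite expr0 mul0r /expi cos0 sin0.
rewrite exprS IH; have -> : n.+1%:R * t = t + n%:R * t by rewrite -add1n natrD mulrDl mul1r.
by rewrite /expi cosD sinD; apply: complex_eq; rewrite ?ReM ?ImM /= // addrC mulrC; congr (_ + _); rewrite mulrC.
Qed.

Lemma cmeasurableM (u w : T -> R[i]) : cmeasurable u -> cmeasurable w ->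
  cmeasurable (fun x => u x * w x).
Proof.
move=> [ur ui] [wr wi]; split.
  under eq_fun do rewrite ReM.
  by apply: measurable_funB; exact: measurable_funM.
under eq_fun do rewrite ImM.
by apply: measurable_funD; exact: measurable_funM.
Qed.

Lemma cmeasurableX (w : T -> R[i]) n : cmeasurable w -> cmeasurable (fun x => w x ^+ n).
Proof.
move=> hw; elim: n => [|n IH]; first by split; under eq_fun do rewrite expr0; exact: measurable_cst.
have h := cmeasurableM hw IH.
have <- : (fun x => w x * w x ^+ n) = (fun x => w x ^+ n.+1) by apply/funext => x; rewrite exprS.
exact: h.
Qed.

Lemma vanish_subseq (v : nat -> T -> R) (m : nat -> nat) A :
  (forall N, (N <= m N)%N) -> vanish mu v A -> vanish mu (fun N => v (m N)) A.
Proof.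
move=> hm hv; apply: (cvg_comp m (fun N => \int[mu]_(x in A) v N x) _ hv).
by move=> B [n _ hn]; exists n => // k /= nk; apply: hn; exact: leq_trans nk (hm k).
Qed.

Lemma vanishB (u v : nat -> T -> R) A : measurable A ->
  (forall N, mu.-integrable A (EFin \o u N)) -> (forall N, mu.-integrable A (EFin \o v N)) ->
  vanish mu u A -> vanish mu v A -> vanish mu (fun N x => u N x - v N x) A.
Proof.
move=> mA iu iv hu hv; rewrite /vanish; under eq_fun do rewrite RintegralB//.
exact: cvg0B.
Qed.

Lemma integrable_bounded_mul (h b : T -> R) (C : R) : mu.-integrable setT (EFin \o h) ->
  measurable_fun setT b -> (forall x, `|b x| <= C) ->
  mu.-integrable setT (EFin \o (fun x => h x * b x)).
Proof.
move=> ih mb bC; apply: (integrableMl measurableT ih mb).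
exists C; split; first exact: num_real.
by move=> M hM x _ /=; apply: le_trans (bC x) (ltW hM).
Qed.

Lemma phase_measurable_wave (b0 : R) N (A : set T) : measurable A -> A `<=` band D ->
  measurable_fun A (fun x : T => cos (N%:R * phase D x - b0)).
Proof.
move=> mA AB; apply: (measurable_funS (measurable_band D) AB).
apply: open_continuous_measurable_fun; first exact: open_band.
move=> x /set_mem [hx _].
have hc : -1 < D.[x] / 2 < 1 by apply/andP; split; nra.
have cth : {for x, continuous (phase D)}.
  apply: (@continuous_comp _ _ _ (fun x => D.[x] / 2) acos); last exact: continuous_acos.
  by apply: cvgMl; exact: continuous_horner.
apply: (@continuous_comp _ _ _ (fun x => N%:R * phase D x - b0) cos); last exact: continuous_cos.
by apply: cvgB; [apply: cvgMr; exact: cth|exact: cvg_cst].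
Qed.

Lemma phase_wave_integrable (b0 : R) N (h : T -> R) (A : set T) :
  mu.-integrable setT (EFin \o h) -> measurable A -> A `<=` band D ->
  mu.-integrable A (EFin \o (fun x : T => h x * cos (N%:R * phase D x - b0))).
Proof.
move=> ih mA AB.
have ihA := integrableS measurableT mA (@subsetT _ A) ih.
apply: (integrableMl mA ihA (phase_measurable_wave b0 N mA AB)).
exists 1; split; first exact: num_real.
by move=> M hM x _ /=; rewrite ler_norml !(le_trans _ (ltW hM)) ?cos_le1// lerNl (le_trans _ (ltW hM))// lerNl cos_geN1.
Qed.

Lemma Re_disc_power (w : R[i]) (t : R) N k :
  Re ((w * expi (2 * (N.+1%:R * t))) ^+ k.+1) =
  Re (w ^+ k.+1) * cos ((k.+1 * (2 * N.+1))%:R * t - 0) -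
  Im (w ^+ k.+1) * cos ((k.+1 * (2 * N.+1))%:R * t - pi / 2).
Proof.
rewrite exprMn expiX ReM subr0 cosBpihalf /expi /= !natrM.
by congr (_ * cos _ - _ * sin _); ring.
Qed.

(** The harmonic of order k+1 of the Poisson kernel is an oscillation of frequency
2 (k+1) (N+1) with integrable amplitude. *)
Lemma disc_power_vanish (w : T -> R[i]) (h : T -> R) (A : set T) (k : nat) :
  cmeasurable w -> mu.-integrable setT (EFin \o h) ->
  measurable A -> A `<=` band D -> (forall x, A x -> normc (w x) <= 1) ->
  (forall N, mu.-integrable A
     (EFin \o (fun x => h x * Re ((w x * expi (2 * (N.+1%:R * phase D x))) ^+ k.+1)))) /\
  vanish mu (fun N x => h x * Re ((w x * expi (2 * (N.+1%:R * phase D x))) ^+ k.+1)) A.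
Proof.
move=> mw ih mA AB w1; have [mr mi] := cmeasurableX k.+1 mw.
have wk x : A x -> normc (w x ^+ k.+1) <= 1.
  by move=> /w1 hx; rewrite normcX exprn_ile1// normc_ge0.
have bnd (P : R[i] -> R) : (forall z, `|P z| <= normc z) ->
    measurable_fun setT (fun x : T => P (w x ^+ k.+1)) ->
    mu.-integrable setT (EFin \o (fun x => h x * ((fun x => P (w x ^+ k.+1)) \_ A) x)).
  move=> hP mP; apply: (integrable_bounded_mul (C := 1)) => //.
    have [h3 _] := measurable_restrictT ((fun x => P (w x ^+ k.+1)) : T -> T) mA.
    exact: h3 (measurable_funS measurableT (@subsetT _ A) mP).
  move=> x; rewrite patchE; case: ifPn => [/set_mem xA|_]; last by rewrite normr0.
  exact: le_trans (hP _) (wk _ xA).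
have ir := bnd _ (@normc_Re R) mr; have ii := bnd _ (@normc_Im R) mi.
pose m N := (k.+1 * (2 * N.+1))%N.
have hm N : (N <= m N)%N by rewrite /m; lia.
have vr := vanish_subseq hm (phase_vanish 0 ir mA AB).
have vi := vanish_subseq hm (phase_vanish (pi / 2) ii mA AB).
have hv := vanishB mA (fun N => phase_wave_integrable 0 (m N) ir mA AB)
  (fun N => phase_wave_integrable (pi / 2) (m N) ii mA AB) vr vi.
have eA N : {in A, (fun x => h x * Re ((w x * expi (2 * (N.+1%:R * phase D x))) ^+ k.+1)) =1
   (fun x => h x * ((fun x => Re (w x ^+ k.+1)) \_ A) x * cos ((m N)%:R * phase D x - 0) -
             h x * ((fun x => Im (w x ^+ k.+1)) \_ A) x * cos ((m N)%:R * phase D x - pi / 2))}.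
  by move=> x xA; rewrite !patchE xA Re_disc_power; ring.
split=> [N|].
  have i1 := phase_wave_integrable 0 (m N) ir mA AB.
  have i2 := phase_wave_integrable (pi / 2) (m N) ii mA AB.
  apply: eq_integrable (integrableB mA i1 i2) => // x xA.
  by rewrite /= (eA N x xA).
apply: eq_vanish hv => N x xA; apply/esym/eA; exact: mem_set.
Qed.

End PhaseHarmonics.

Section PoissonAveraging.
Variable R : realType.
Local Notation mu := (@lebesgue_measure R).
Local Notation T := (measurableTypeR R).
Variable D : {poly R}.

Lemma measurable_normc (w : T -> R[i]) : cmeasurable w ->
  measurable_fun setT (fun x => normc (w x)).
Proof.
move=> [wr wi]; have e : (fun x => normc (w x)) = (fun x => Num.sqrt (Re (w x) ^+ 2 + Im (w x) ^+ 2)).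
  by apply/funext => x; case: (w x).
rewrite e; apply: (measurableT_comp (f := @Num.sqrt R)).
  by apply: continuous_measurable_fun; exact: sqrt_continuous.
by apply: measurable_funD; exact: measurable_funX.
Qed.

Lemma disc_sum_vanish (w : T -> R[i]) (h : T -> R) (A : set T) (K : nat) :
  cmeasurable w -> mu.-integrable setT (EFin \o h) ->
  measurable A -> A `<=` band D -> (forall x, A x -> normc (w x) <= 1) ->
  (forall N, mu.-integrable A
     (EFin \o (fun x => \sum_(k < K) h x * Re ((w x * expi (2 * (N.+1%:R * phase D x))) ^+ k.+1)))) /\
  vanish mu (fun N x => \sum_(k < K) h x * Re ((w x * expi (2 * (N.+1%:R * phase D x))) ^+ k.+1)) A.
Proof.
move=> mw ih mA AB w1; elim: K => [|K [iIH vIH]].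
  split=> [N|].
    have -> : (EFin \o (fun x => \sum_(k < 0) h x * Re ((w x * expi (2 * (N.+1%:R * phase D x))) ^+ k.+1))) = cst 0%E.
      by apply/funext => x; rewrite /= big_ord0.
    exact: integrable0.
  have h0 : vanish mu (fun=> (cst 0 : T -> R)) A.
    by rewrite /vanish; under eq_fun do rewrite Rintegral_cst// mul0r; exact: cvg_cst.
  by apply: eq_vanish h0 => N x _; rewrite big_ord0.
have [iK vK] := disc_power_vanish K mw ih mA AB w1.
split=> [N|].
  apply: eq_integrable (integrableD mA (iIH N) (iK N)) => // x _.
  by rewrite /= big_ord_recr.
have hv : vanish mu (fun N x => \sum_(k < K) h x * Re ((w x * expi (2 * (N.+1%:R * phase D x))) ^+ k.+1) +
   h x * Re ((w x * expi (2 * (N.+1%:R * phase D x))) ^+ K.+1)) A.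
  by rewrite /vanish; under eq_fun do rewrite RintegralD//; exact: cvg0D.
by apply: eq_vanish hv => N x _; rewrite big_ord_recr.
Qed.

(** Where |w| <= r < 1, finitely many harmonics approximate the Poisson kernel
uniformly in the phase; all of them vanish in the limit except the constant
one. The sets |w| <= 1 - 1/(n+1) exhaust A. *)
Lemma poisson_average (w : T -> R[i]) (G f : T -> R) (t : nat -> T -> R) (A : set T) :
  cmeasurable w -> measurable_fun setT G -> (forall N, measurable_fun setT (t N)) ->
  mu.-integrable setT (EFin \o f) -> measurable A -> A `<=` band D ->
  (forall x, A x -> `|G x| <= 1) -> (forall N x, A x -> `|t N x| <= 1) ->
  (forall x, A x -> normc (w x) < 1) ->
  (forall N x, A x -> t N x = G x * poisson (w x * expi (2 * (N.+1%:R * phase D x)))) ->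
  vanish mu (fun N x => (t N x - G x) * f x) A.
Proof.
move=> mw mG mt iff mA AB G1 t1 w1 tE.
have mf : measurable_fun setT f by apply/measurable_EFinP; exact: (measurable_int mu iff).
have iaf : mu.-integrable setT (EFin \o (fun x => `|f x|)) by have := integrable_norm iff.
pose v N : T -> R := (fun x => (t N x - G x) * f x) \_ A.
have mv N : measurable_fun setT (v N).
  have h1 := measurable_funM (measurable_funB (mt N) mG) mf.
  have [h3 _] := measurable_restrictT ((fun x => (t N x - G x) * f x) : T -> T) mA.
  exact: h3 (measurable_funS measurableT (@subsetT _ A) h1).
have ig : mu.-integrable setT (EFin \o (fun x => 2 * `|f x|)).
  by apply: eq_integrable (integrableZl measurableT 2 iaf).
have vg N x : `|v N x| <= 2 * `|f x|.
  rewrite /v patchE; case: ifPn => [/set_mem xA|_]; last by rewrite normr0 mulr_ge0.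
  rewrite normrM ler_wpM2r// (le_trans (ler_normB _ _))//.
  by rewrite -[leRHS]/(1 + 1); apply: lerD; [exact: t1|exact: G1].
pose r n : R := 1 - n.+1%:R^-1.
have r1 n : r n < 1 by rewrite /r ltrBlDr ltrDl invr_gt0.
have r0 n : 0 <= r n by rewrite /r subr_ge0 invf_le1// ler1n.
pose F n := A `&` [set x | normc (w x) <= r n].
have mF n : measurable (F n).
  apply: measurableI => //.
  have h1 := measurable_fun_ler (measurable_normc mw) (measurable_cst (r n)).
  by have := h1 measurableT [set true]; rewrite setTI; apply.
have FA n : F n `<=` A by move=> x [].
have AF : A = \bigcup_n F n.
  apply/seteqP; split=> x; last by move=> [n _ []].
  move=> Ax; have [n hn] : exists n : nat, n.+1%:R^-1 < 1 - normc (w x).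
    by apply: inv_lt_exists; rewrite subr_gt0 w1.
  by exists n => //; split=> //=; rewrite /r lerBrDr -lerBrDl ltW.
suff hU : vanish mu v (\bigcup_n F n).
  by rewrite -AF in hU; apply: eq_vanish hU => N x xA; rewrite /v patchE mem_set.
apply: (vanish_increasing mv ig vg _ mF) => [m n mn|n].
  apply/subsetPset => x [Ax hx]; split=> //=; apply: (le_trans hx).
  by rewrite lerD2l lerN2 lef_pV2 ?posrE// ler_nat.
apply: cvg0_approx => e e0.
set If := \int[mu]_x `|f x|.
have If0 : 0 <= If by apply: Rintegral_ge0.
have c0 : 0 < 2 / (1 - r n) * (If + 1).
  by rewrite mulr_gt0 ?divr_gt0 ?subr_gt0// ltr_wpDl.
have [K hK] : exists K : nat, 2 * (r n ^+ K.+1 / (1 - r n)) * If <= e.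
  have /cvgr0Pnorm_le /(_ _ (divr_gt0 e0 c0)) [K _ hK] : (r n ^+ K : R) @[K --> \oo] --> (0 : R).
    by apply: cvg_expr; rewrite ger0_norm.
  exists K; have := hK K.+1 (leqnSn K); rewrite /= ger0_norm ?exprn_ge0// ler_pdivlMr//.
  apply: le_trans; rewrite [leLHS](_ : _ = r n ^+ K.+1 * (2 / (1 - r n) * If)); last by field; rewrite subr_eq0 gt_eqF.
  rewrite ler_wpM2l ?exprn_ge0// ler_wpM2l ?lerDl//.
  by rewrite divr_ge0// subr_ge0 ltW.
pose h x := f x * ((fun x => 2 * G x) \_ A) x.
have ih : mu.-integrable setT (EFin \o h).
  apply: (integrable_bounded_mul (C := 2)) => //.
    have [h3 _] := measurable_restrictT ((fun x => 2 * G x) : T -> T) mA.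
    have h1 := measurable_funM (measurable_cst (2 : R)) mG.
    exact: h3 (measurable_funS measurableT (@subsetT _ A) h1).
  move=> x; rewrite patchE; case: ifPn => [/set_mem xA|_]; last by rewrite normr0.
  by rewrite normrM ger0_norm// ler_piMr// G1.
have w1F x : F n x -> normc (w x) <= 1 by move=> [_ /=] hx; rewrite (le_trans hx)// ltW.
have FB : F n `<=` band D by apply: subset_trans AB.
have [iS vS] := disc_sum_vanish K mw ih (mF n) FB w1F.
exists (fun N => \int[mu]_(x in F n) \sum_(k < K) h x * Re ((w x * expi (2 * (N.+1%:R * phase D x))) ^+ k.+1)) => // N.
have iv := dominated_integrableS mv ig vg N (mF n).
rewrite -RintegralB//.
have ivS := integrableB (mF n) iv (iS N).
apply: (le_trans (le_normr_Rintegral (mF n) ivS)).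
have iC : mu.-integrable setT (EFin \o (fun x => 2 * (r n ^+ K.+1 / (1 - r n)) * `|f x|)).
  by apply: eq_integrable (integrableZl measurableT (2 * (r n ^+ K.+1 / (1 - r n))) iaf).
apply: le_trans hK; rewrite -RintegralZl//.
have C0 : 0 <= 2 * (r n ^+ K.+1 / (1 - r n)).
  by apply: mulr_ge0 => //; apply: divr_ge0; [exact: exprn_ge0|rewrite subr_ge0 ltW].
apply: (@le_trans _ _ (\int[mu]_(x in F n) (2 * (r n ^+ K.+1 / (1 - r n)) * `|f x|))).
  apply: le_Rintegral => //.
  - by have := integrable_norm ivS.
  - exact: integrableS iC.
  - move=> x Fx; have xA := FA n x Fx; rewrite /v /h !patchE mem_set// tE//.
    set z := w x * _; rewrite -mulr_sumr.
    have hz : normc z <= r n by rewrite /z normcM normc_expi mulr1; case: Fx.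
    have := poisson_expansion K hz (r1 n); set S := \sum_(k < K) _ => hp.
    rewrite (_ : _ - _ = (poisson z - 1 - 2 * S) * (G x * f x)); last by ring.
    rewrite normrM; apply: ler_pM => //.
    by rewrite normrM ler_piMl// G1.
rewrite [leRHS](_ : _ = \int[mu]_(x in F n `|` ~` F n) (2 * (r n ^+ K.+1 / (1 - r n)) * `|f x|)); last by rewrite setUv.
rewrite Rintegral_setU ?setUv//.
- by rewrite lerDl; apply: Rintegral_ge0 => x _; rewrite mulr_ge0.
- exact: measurableC.
- by rewrite disj_set2E setICr.
Qed.

End PoissonAveraging.

(** * Passage to the limit *)

Section RepeatedLimit.
Variable R : realType.
Local Notation mu := (@lebesgue_measure R).
Local Notation T := (measurableTypeR R).

Lemma finite_roots (p : {poly R}) : p != 0 -> finite_set [set x | p.[x] = 0].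
Proof.
elim: {p}(size p) {-2}p (leqnn (size p)) => [|n IH] p hp p0.
  by move: p0; rewrite -size_poly_eq0 -leqn0 hp.
have [[a pa]|h] := pselect (exists a, p.[a] = 0); last first.
  by rewrite (_ : [set x | _] = set0)// -subset0 => x hx; apply: h; exists x.
have /factor_theorem [q pE] : root p a by apply/rootP.
have q0 : q != 0 by apply: contraNneq p0 => q0; rewrite pE q0 mul0r.
have cq : finite_set [set x | q.[x] = 0].
  apply: IH => //; move: hp; rewrite pE size_Mmonic ?monicXsubC// size_XsubC addn2//.
have -> : [set x | p.[x] = 0] = [set a] `|` [set x | q.[x] = 0].
  apply/seteqP; split=> x /=; rewrite pE !hornerE => h.
    by move/eqP: h; rewrite mulf_eq0 subr_eq0 => /orP[] /eqP ->; [right|left].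
  by case: h => ->; rewrite ?subrr ?mulr0 ?mul0r.
by rewrite finite_setU; split=> //; exact: finite_set1.
Qed.

Variable D : {poly R}.
Hypothesis D1 : (1 < size D)%N.

Lemma deriv_neq0 : D^`() != 0.
Proof.
have [n sn] : exists n, size D = n.+2 by case: (size D) D1 => [|[|n]]//; exists n.
apply/eqP => /(congr1 (fun p : {poly R} => p`_n)); rewrite coef_deriv coef0 => /eqP.
rewrite mulrn_eq0/=; apply/negP; have : lead_coef D != 0 by rewrite lead_coef_eq0 -size_poly_gt0 sn.
by rewrite /lead_coef sn.
Qed.

Definition band_edge : set R := [set E | D.[E] ^+ 2 = 4].

Lemma finite_band_edge : finite_set band_edge.
Proof.
have p0 : D ^+ 2 - 4%:P != 0.
  rewrite subr_eq0; apply/eqP => /(congr1 (fun p : {poly R} => size p)).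
  rewrite size_polyC expr2 size_mul -?size_poly_gt0 ?(ltnW D1)//.
  by case: (size D) D1 => [|[|n]]// _; case: (_ != 0); rewrite !addnS.
have := finite_roots p0; congr finite_set; apply/seteqP; split=> x /=; rewrite !hornerE.
  by move/eqP; rewrite subr_eq0 => /eqP.
by move=> ->; rewrite subrr.
Qed.

(** D^2 - 4 and the derivative of D are nonzero polynomials. *)
Lemma ae_regular : {ae mu, forall x : T, D.[x] ^+ 2 != 4 /\ D^`().[x] != 0}.
Proof.
exists (band_edge `|` [set x | D^`().[x] = 0]).
have cU : countable (band_edge `|` [set x | D^`().[x] = 0]).
  apply: finite_set_countable; rewrite finite_setU.
  by split; [exact: finite_band_edge|exact/finite_roots/deriv_neq0].
split.
- by apply: countable_measurable => // t; exact: measurable_set1.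
- exact: countable_lebesgue_measure0.
- move=> x; apply: contra_notP => h; split; apply/eqP => e; apply: h; [by left|by right].
Qed.

(** Inside the bands the oscillation averages out; everywhere else there is
dominated convergence. *)
Lemma repeated_limit (w : T -> R[i]) (G f : T -> R) (t : nat -> T -> R) (S : set T) :
  cmeasurable w -> measurable_fun setT G -> (forall N, measurable_fun setT (t N)) ->
  mu.-integrable setT (EFin \o f) -> measurable S ->
  (forall x, `|G x| <= 1) -> (forall N x, `|t N x| <= 1) ->
  (forall x, ~ S x -> G x = 0 /\ forall N, t N x = 0) ->
  (forall x, S x -> 4 < D.[x] ^+ 2 -> G x = 0 /\ t N x @[N --> \oo] --> (0 : R)) ->
  (forall x, S x -> D.[x] ^+ 2 < 4 -> normc (w x) < 1 /\
     forall N, t N x = G x * poisson (w x * expi (2 * (N.+1%:R * phase D x)))) ->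
  (\int[mu]_x (t N x * f x)) @[N --> \oo] --> (\int[mu]_x (G x * f x)).
Proof.
move=> mw mG mt iff mS G1 t1 off gap inb.
have mf : measurable_fun setT f by apply/measurable_EFinP; exact: (measurable_int mu iff).
have iaf : mu.-integrable setT (EFin \o (fun x => `|f x|)) by have := integrable_norm iff.
pose v N x := (t N x - G x) * f x.
have mv N : measurable_fun setT (v N).
  exact: measurable_funM (measurable_funB (mt N) mG) mf.
have ig : mu.-integrable setT (EFin \o (fun x => 2 * `|f x|)).
  by apply: eq_integrable (integrableZl measurableT 2 iaf).
have vg N x : `|v N x| <= 2 * `|f x|.
  rewrite normrM ler_wpM2r// (le_trans (ler_normB _ _))//.
  by rewrite -[leRHS]/(1 + 1); apply: lerD; [exact: t1|exact: G1].
pose A := S `&` band D.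
have mA : measurable A by apply: measurableI => //; exact: measurable_band.
have AB : A `<=` band D by move=> x [].
have vA : vanish mu v A.
  apply: (poisson_average mw mG mt iff mA AB).
  - by move=> x _; exact: G1.
  - by move=> N x _; exact: t1.
  - by move=> x [Sx [hx _]]; case: (inb x Sx hx).
  - by move=> N x [Sx [hx _]]; case: (inb x Sx hx).
have mCA : measurable (~` A) by exact: measurableC.
have vCA : vanish mu v (~` A).
  have igC := integrableS measurableT mCA (@subsetT _ _) ig.
  have hcv : {ae mu, forall x : T, (~` A) x -> (v N x)%:E @[N --> \oo] --> (cst 0%E : T -> \bar R) x}.
    apply: ae_imp ae_regular => x [h4 h0] nA.
    suff : v N x @[N --> \oo] --> (0 : R) by move=> h; apply: cvg_EFin h; exact: nearW.
    have [Sx|nS] := pselect (S x); last first.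
      have [g0 t0] := off x nS; rewrite /v.
      by under eq_fun do rewrite g0 t0 subrr mul0r; exact: cvg_cst.
    have gt4 : 4 < D.[x] ^+ 2.
      rewrite lt_neqAle eq_sym h4 leNgt /=; apply/negP => lt4; exact: nA.
    have [g0 t0] := gap x Sx gt4; rewrite /v.
    under eq_fun do rewrite g0 subr0 mulrC; exact: cvg0Z.
  have hdom : {ae mu, forall (x : T) N, (~` A) x -> (`|(v N x)%:E| <= (2 * `|f x|)%R%:E)%E}.
    by apply: ae_imp ae_regular => x _ N _ /=; rewrite lee_fin.
  have [_ _] := dominated_convergence mCA
    (fun N => (measurable_EFinP _ _).2 (measurable_funTS (mv N))) (measurable_cst _) hcv igC hdom.
  rewrite integral0 => h; exact: fine_cvg h.
have vT : vanish mu v setT.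
  rewrite -(setUv A); apply: (vanish_setU mv ig vg) => //.
  by rewrite disj_set2E setICr.
have iT N : mu.-integrable setT (EFin \o (fun x => t N x * f x)).
  apply: eq_integrable (integrable_bounded_mul iff (mt N) (t1 N)) => // x _.
  by rewrite /= mulrC.
have iG : mu.-integrable setT (EFin \o (fun x => G x * f x)).
  apply: eq_integrable (integrable_bounded_mul iff mG G1) => // x _.
  by rewrite /= mulrC.
have e N : \int[mu]_x (t N x * f x) = \int[mu]_x v N x + \int[mu]_x (G x * f x).
  rewrite -RintegralD//; last by have := dominated_integrableS mv ig vg N measurableT.
  by apply: eq_Rintegral => x _; rewrite /v; ring.
under eq_fun do rewrite e.
have h : (\int[mu]_x v N x + \int[mu]_x (G x * f x)) @[N --> \oo] -->
    (0 + \int[mu]_x (G x * f x) : R).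
  by apply: (@cvgD _ R^o); [exact: vT|exact: cvg_cst].
by rewrite add0r in h.
Qed.

End RepeatedLimit.

(** * Application to the transmittance *)

Section Application.
Variables (R : realType) (L : nat) (J lam : int -> R) (kS : R).
Variables (nul nur : probability (measurableTypeR R) R) (kap : R).
Hypothesis hL : (1 <= L)%N.
Hypothesis hJ : forall x : int, 1 <= x < L%:Z -> J x != 0.
Hypothesis hkS : kS != 0.
Hypothesis hkap : kap != 0.

Local Notation mu := (@lebesgue_measure R).
Local Notation T := (measurableTypeR R).
Local Notation D := (discr L J lam kS).
Local Notation den := (green_den L J lam kS).
Local Notation TN := (transmittance L J lam kS nul nur kap).
Local Notation Too := (crystal_transmittance L J lam kS nul nur kap).

Lemma measurable_inv : measurable_fun setT (fun x : T => x^-1 : R).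
Proof.
have o0 : open [set x : R | x != 0] by exact: open_neq.
have m0 : measurable ([set x : R | x != 0] : set T) by exact: open_measurable.
have h : measurable_fun ([set x : R | x != 0] : set T) (fun x : T => x^-1 : T).
  apply: (open_continuous_measurable_fun o0) => x /set_mem x0.
  by apply: cvgV => //; exact: cvg_id.
have [h3 _] := measurable_restrictT (fun x : T => x^-1 : T) m0.
have e : (fun x : T => x^-1 : R) = (fun x : T => x^-1 : T) \_ [set x : R | x != 0].
  apply/funext => x; rewrite patchE; case: ifPn => //; rewrite notin_setE/= => /negP.
  by rewrite negbK => /eqP ->; rewrite invr0.
by rewrite e; exact: h3.
Qed.

Lemma cmeasurableD (u w : T -> R[i]) : cmeasurable u -> cmeasurable w ->
  cmeasurable (fun x => u x + w x).
Proof.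
move=> [ur ui] [wr wi]; split; under eq_fun do rewrite ?ReD ?ImD;
  exact: measurable_funD.
Qed.

Lemma cmeasurableN (u : T -> R[i]) : cmeasurable u -> cmeasurable (fun x => - u x).
Proof.
by move=> [ur ui]; split; under eq_fun do rewrite ?ReN ?ImN; exact: measurableT_comp.
Qed.

Lemma cmeasurableB (u w : T -> R[i]) : cmeasurable u -> cmeasurable w ->
  cmeasurable (fun x => u x - w x).
Proof. by move=> hu hw; apply: cmeasurableD => //; exact: cmeasurableN. Qed.

Lemma cmeasurableC (a : T -> R) : measurable_fun setT a -> cmeasurable (fun x => (a x)%:C).
Proof. by move=> ha; split => //=; exact: measurable_cst. Qed.

Lemma cmeasurable_cst (z : R[i]) : cmeasurable (fun _ : T => z).
Proof. by split; exact: measurable_cst. Qed.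

Lemma cmeasurableJ (u : T -> R[i]) : cmeasurable u -> cmeasurable (fun x => conjc (u x)).
Proof.
move=> [ur ui]; split; first by under eq_fun do rewrite ReJ.
by under eq_fun do rewrite ImJ; exact: measurableT_comp.
Qed.

Lemma measurable_horner (p : {poly R}) : measurable_fun setT (fun x : T => p.[x]).
Proof. exact: measurable_poly. Qed.

Lemma measurable_normc_sq (u : T -> R[i]) : cmeasurable u ->
  measurable_fun setT (fun x => normc (u x) ^+ 2).
Proof. by move=> hu; apply: measurable_funX; exact: measurable_normc. Qed.

Lemma cmeasurable_disc_point (u w : T -> R[i]) : cmeasurable u -> cmeasurable w ->
  cmeasurable (fun x => disc_point (u x) (w x)).
Proof.
move=> hu hw; have hp := cmeasurableM (cmeasurableJ hu) hw.
have mq : measurable_fun setT (fun x => `|Im (conjc (u x) * w x)|).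
  by apply: measurableT_comp => //; case: hp.
have mu2 := measurable_normc_sq hu; have mw2 := measurable_normc_sq hw.
have m2 : measurable_fun setT (fun _ : T => 2^-1 : R) by exact: measurable_cst.
have mi : measurable_fun setT (fun x =>
    ((normc (u x) ^+ 2 + normc (w x) ^+ 2) / 2 + `|Im (conjc (u x) * w x)|)^-1).
  apply: (measurableT_comp measurable_inv); apply: measurable_funD => //.
  by apply: measurable_funM => //; exact: measurable_funD.
split; rewrite /disc_point /=.
  apply: measurable_funM => //; apply: measurableT_comp => //.
  by apply: measurable_funM => //; exact: measurable_funB.
by apply: measurable_funM => //; case: hp.
Qed.

Lemma measurable_patch (g : T -> R) (A : set T) : measurable A ->
  measurable_fun setT g -> measurable_fun setT (g \_ A).
Proof.
move=> mA mg; have [h3 _] := measurable_restrictT (g : T -> T) mA.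
exact: h3 (measurable_funS measurableT (@subsetT _ A) mg).
Qed.

Section Fluxes.
Variables fl fr : T -> R[i].
Hypothesis mfl : cmeasurable fl.
Hypothesis mfr : cmeasurable fr.

Lemma measurable_den N : cmeasurable (fun E : T => den E%:C (fl E) (fr E) N).
Proof.
have mk : cmeasurable (fun E => fl E / kS%:C).
  by apply: cmeasurableM => //; exact: cmeasurable_cst.
have mX : cmeasurable (fun E : T => den E%:C (fl E) (fr E) 0).
  under eq_fun do rewrite den_at0 /denX.
  by apply: cmeasurableB; [exact: cmeasurable_cst|exact: cmeasurableM].
have mp (p : {poly R}) : cmeasurable (fun E : T => (p.[E])%:C).
  by apply: cmeasurableC; exact: measurable_horner.
suff [] : cmeasurable (fun E : T => den E%:C (fl E) (fr E) N) /\
  cmeasurable (fun E : T => den E%:C (fl E) (fr E) N.+1) by [].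
elim: N => [|N [IH1 IH2]]; split => //.
  under eq_fun do rewrite den_at1//.
  apply: cmeasurableD; last apply: cmeasurableM => //; apply: cmeasurableB;
    apply: cmeasurableM => //; exact: cmeasurable_cst.
under eq_fun do rewrite den_recursion//.
apply: cmeasurableB => //; apply: cmeasurableM => //.
by apply: cmeasurableC; apply: measurable_funM => //; apply: measurable_funM => //; exact: measurable_horner.
Qed.

Lemma measurable_denX : cmeasurable (fun E : T => denX kS (fl E) (fr E)).
Proof.
by have := measurable_den 0; congr cmeasurable; apply/funext => E; rewrite den_at0.
Qed.

Lemma measurable_denY : cmeasurable (fun E : T => denY L J lam kS E (fl E) (fr E)).
Proof.
have mc : measurable_fun setT (fun E : T => D.[E] / 2).
  by apply: measurable_funM; [exact: measurable_horner|exact: measurable_cst].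
apply: cmeasurableM.
  apply: cmeasurableC; apply: (measurableT_comp measurable_inv).
  apply: (measurableT_comp (f := @Num.sqrt R)).
    by apply: continuous_measurable_fun; exact: sqrt_continuous.
  by apply: measurable_funB; [exact: measurable_cst|exact: measurable_funX].
apply: cmeasurableB; first exact: measurable_den.
by apply: cmeasurableM; [exact: cmeasurableC|exact: measurable_den].
Qed.

Lemma measurable_flux_over (g : T -> R) : measurable_fun setT g ->
  measurable_fun setT (fun E => 4 * Im (fl E) * Im (fr E) / g E).
Proof.
move=> mg; have [_ ml] := mfl; have [_ mr] := mfr.
apply: measurable_funM; last exact: measurableT_comp measurable_inv mg.
by apply: measurable_funM => //; apply: measurable_funM => //; exact: measurable_cst.
Qed.

Lemma measurable_flux_den N : measurable_fun setT (fun E : T =>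
  4 * Im (fl E) * Im (fr E) / normc (den E%:C (fl E) (fr E) N) ^+ 2).
Proof. exact: measurable_flux_over (measurable_normc_sq (measurable_den N)). Qed.

Lemma measurable_flux_cross : measurable_fun setT (fun E : T =>
  4 * Im (fl E) * Im (fr E) /
    `|Im (conjc (denX kS (fl E) (fr E)) * denY L J lam kS E (fl E) (fr E))|).
Proof.
apply: measurable_flux_over; apply: measurableT_comp => //.
by have [_] := cmeasurableM (cmeasurableJ measurable_denX) measurable_denY.
Qed.

End Fluxes.

Let fl (E : T) : R[i] := (kap ^+ 2)%:C * F_res nul E.
Let fr (E : T) : R[i] := (kap ^+ 2)%:C * F_res nur E.

Let mfl : cmeasurable fl.
Proof. exact: cmeasurableM (cmeasurable_cst _) (F_res_cmeasurable nul). Qed.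

Let mfr : cmeasurable fr.
Proof. exact: cmeasurableM (cmeasurable_cst _) (F_res_cmeasurable nur). Qed.

Let S : set T := [set E | 0 < Im (F_res nul E) /\ 0 < Im (F_res nur E)].

Let mS : measurable S.
Proof.
have [_ ml] := F_res_cmeasurable nul; have [_ mr] := F_res_cmeasurable nur.
have h (nu : probability T R) : measurable_fun setT (fun E : T => Im (F_res nu E)) ->
    measurable ([set E | 0 < Im (F_res nu E)] : set T).
  move=> m; have h1 := measurable_fun_ltr (measurable_cst (0 : R)) m.
  by have := h1 measurableT [set true]; rewrite setTI; apply.
exact: measurableI (h nul ml) (h nur mr).
Qed.

Let w (E : T) : R[i] := disc_point (denX kS (fl E) (fr E)) (denY L J lam kS E (fl E) (fr E)).

Let mlt4 : measurable ([set E | D.[E] ^+ 2 < 4] : set T).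
Proof.
have h1 := measurable_fun_ltr (measurable_funX 2 (measurable_horner D)) (measurable_cst (4 : R)).
by have := h1 measurableT [set true]; rewrite setTI; apply.
Qed.

Lemma measurable_transmittance N : (1 <= N)%N -> measurable_fun setT (TN N : T -> R).
Proof.
move=> N1; have := measurable_patch mS (measurable_flux_den mfl mfr N); congr measurable_fun; apply/funext => E.
rewrite patchE; case: ifPn => [/set_mem [Fl0 Fr0]|].
  by rewrite (transmittanceE lam hL hJ hkS hkap N1 Fl0 Fr0).
by rewrite notin_setE => nS; rewrite transmittance_notin.
Qed.

Lemma ratio_bounds (a b d : R) : 0 < a -> 0 < b -> 4 * a * b <= d ->
  0 <= 4 * a * b / d <= 1.
Proof.
move=> a0 b0 hd; have ab0 : 0 < 4 * a * b by rewrite !mulr_gt0.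
have d0 := lt_le_trans ab0 hd.
by rewrite ler_pdivrMr// mul1r hd divr_ge0 ?ltW.
Qed.

Lemma transmittance_bounds N E : (1 <= N)%N -> 0 <= TN N E <= 1.
Proof.
move=> N1; have [[Fl0 Fr0]|nS] := pselect (S E); last first.
  by rewrite transmittance_notin// lexx ler01.
rewrite (transmittanceE lam hL hJ hkS hkap N1 Fl0 Fr0).
have yl := Im_kap_gt0 hkap Fl0; have yr := Im_kap_gt0 hkap Fr0.
exact: ratio_bounds yl yr (den_lower_bound lam hL hJ hkS E _ _ N).
Qed.

Lemma den_escape E (a b : R[i]) : 0 < Im a -> 0 < Im b -> 4 < D.[E] ^+ 2 ->
  (4 * Im a * Im b / normc (den E%:C a b N.+1) ^+ 2) @[N --> \oo] --> (0 : R).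
Proof.
move=> a0 b0 hE; apply/cvg0Z.
have c1 : 1 < (D.[E] / 2) ^+ 2 by rewrite expr_div_n ltr_pdivlMr// mul1r -natrX.
have m0 : 0 < 4 * Im a * Im b by rewrite !mulr_gt0.
have lb N : Num.sqrt (4 * Im a * Im b) <= normc (den E%:C a b N).
  have n0 := normc_ge0 (den E%:C a b N); rewrite -[X in _ <= X](ger0_norm n0).
  by rewrite -sqrtr_sqr ler_wsqrtr// den_lower_bound.
have := escape c1 _ (den_recursion lam hL hJ hkS E a b) lb.
rewrite sqrtr_gt0 => /(_ m0) h.
by rewrite (cvg_shiftS (fun N => (normc (den E%:C a b N) ^+ 2)^-1)).
Qed.

Lemma transmittance_gap E : S E -> 4 < D.[E] ^+ 2 ->
  TN N.+1 E @[N --> \oo] --> (0 : R).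
Proof.
move=> [Fl0 Fr0] hE.
under eq_fun do rewrite (transmittanceE lam hL hJ hkS hkap (ltn0Sn _) Fl0 Fr0).
exact: den_escape (Im_kap_gt0 hkap Fl0) (Im_kap_gt0 hkap Fr0) hE.
Qed.

(** Such an energy is outside the spectrum of the crystal. *)
Lemma crystal_gap E : 4 < D.[E] ^+ 2 -> Too E = 0.
Proof.
move=> hE; rewrite /crystal_transmittance; case: asboolP => [[[h _] _]|_]; last by [].
by case: (notin_spectrum hL hJ hkS hE h).
Qed.

Lemma crystal_notin E : ~ S E -> Too E = 0.
Proof.
move=> nS; rewrite /crystal_transmittance; case: asboolP => [[[_ h1] h2]|_]; last by [].
by exfalso; exact: nS (conj h1 h2).
Qed.

(** The denominator is cos N theta X + sin N theta Y, and 4 Im fl Im fr divided by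
|Im (conj X Y)| is the crystalline transmittance. *)
Lemma transmittance_band E : S E -> D.[E] ^+ 2 < 4 ->
  normc (w E) < 1 /\ forall N, TN N.+1 E =
    Too E * poisson (w E * expi (2 * (N.+1%:R * phase D E))).
Proof.
move=> [Fl0 Fr0] hE; have [hq hT] := crystal_formula hL hJ hkS hkap hE Fl0 Fr0.
have yl := Im_kap_gt0 hkap Fl0; have yr := Im_kap_gt0 hkap Fr0.
have q0 := lt_le_trans (mulr_gt0 (mulr_gt0 (ltr0n R 4) yl) yr) hq.
have [w1 hw] := disc_point_spec q0; split => // N.
rewrite (transmittanceE lam hL hJ hkS hkap (ltn0Sn N) Fl0 Fr0) (den_cos hL hJ hkS _ _ _ hE) hw hT.
exact: mulrA.
Qed.

Let G : T -> R := (Too : T -> R) \_ ([set E | D.[E] ^+ 2 < 4] : set T).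

Let mG : measurable_fun setT G.
Proof.
have := measurable_patch mlt4 (measurable_patch mS (measurable_flux_cross mfl mfr)); congr measurable_fun.
apply/funext => E; rewrite /G !patchE; case: ifPn => // /set_mem hE.
case: ifPn => [/set_mem [Fl0 Fr0]|].
  by have [_ ->] := crystal_formula hL hJ hkS hkap hE Fl0 Fr0.
by rewrite notin_setE => nS; rewrite crystal_notin.
Qed.

Let Gcrystal E : D.[E] ^+ 2 != 4 -> G E = Too E.
Proof.
move=> h4; rewrite /G patchE; case: ifPn => //; rewrite notin_setE /= => /negP.
by rewrite -leNgt le_eqVlt eq_sym (negbTE h4) => /crystal_gap ->.
Qed.

Let G01 E : 0 <= G E <= 1.
Proof.
rewrite /G patchE; case: ifPn => [/set_mem hE|_]; last by rewrite lexx ler01.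
have [[Fl0 Fr0]|nS] := pselect (S E); last by rewrite crystal_notin// lexx ler01.
have [hq ->] := crystal_formula hL hJ hkS hkap hE Fl0 Fr0.
exact: ratio_bounds (Im_kap_gt0 hkap Fl0) (Im_kap_gt0 hkap Fr0) hq.
Qed.

Lemma discr_size : (1 < size D)%N.
Proof. by rewrite (size_discr lam hL hJ hkS). Qed.

(** Away from the band edges the explicit formula applies, and the edges are
finitely many: every subset of a finite set is measurable. *)
Lemma measurable_crystal : measurable_fun setT (Too : T -> R).
Proof.
have fE := finite_band_edge discr_size.
have mE : measurable (band_edge D : set T).
  by apply: countable_measurable (finite_set_countable fE) => t; exact: measurable_set1.
move=> _ Y mY; rewrite setTI.
have -> : (Too : T -> R) @^-1` Y = (band_edge D `&` Too @^-1` Y) `|` (G @^-1` Y `\` band_edge D).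
  apply/seteqP; split=> E /=.
    by move=> hY; have [hE|hE] := pselect (band_edge D E); [left|right; rewrite Gcrystal//; exact/eqP].
  by case=> [[]//|[hY hE]]; rewrite -Gcrystal//; exact/eqP.
apply: measurableU.
  apply: countable_measurable; last by apply/finite_set_countable/finite_setIl.
  by move=> t; exact: measurable_set1.
by apply: measurableD => //; have := mG measurableT mY; rewrite setTI.
Qed.

Lemma transmittance_limit (f : T -> R) : mu.-integrable setT (EFin \o f) ->
  (\int[mu]_x (TN N x * f x)) @[N --> \oo] --> (\int[mu]_x (Too x * f x)).
Proof.
move=> iff; rewrite -(cvg_shiftS (fun N => \int[mu]_x (TN N x * f x))).
have mf : measurable_fun setT f by apply/measurable_EFinP; exact: (measurable_int mu iff).
have -> : \int[mu]_x (Too x * f x) = \int[mu]_x (G x * f x).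
  congr fine; apply: ae_eq_integral => //.
  - by apply/measurable_EFinP; exact: measurable_funM measurable_crystal mf.
  - by apply/measurable_EFinP; exact: measurable_funM mG mf.
  - by apply: ae_imp (ae_regular discr_size) => x [h4 _] _; rewrite Gcrystal.
apply: (repeated_limit discr_size (cmeasurable_disc_point (measurable_denX mfl mfr)
  (measurable_denY mfl mfr)) mG _ iff mS).
- by move=> N; exact: measurable_transmittance.
- by move=> x; have /andP[g0 g1] := G01 x; rewrite ger0_norm.
- by move=> N x; have /andP[g0 g1] := transmittance_bounds x (ltn0Sn N); rewrite ger0_norm.
- move=> x nS; split=> [|N]; last exact: transmittance_notin.
  by rewrite /G patchE; case: ifP => // _; exact: crystal_notin.
- move=> x Sx h4; split; last exact: transmittance_gap.
  by rewrite Gcrystal ?gt_eqF//; exact: crystal_gap.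
- move=> x Sx h4; rewrite Gcrystal ?lt_eqF//; exact: transmittance_band.
Qed.

End Application.

Theorem theorem2p1 (R : realType) (L : nat) (J lam : int -> R) (kS kap : R)
    (nul nur : probability (measurableTypeR R) R)
    (hL : (1 <= L)%N)
    (hJ : forall x : int, 1 <= x < L%:Z -> J x != 0)
    (hkS : kS != 0) (hkap : kap != 0)
    (hsc : forall N : nat, (1 <= N)%N ->
       no_sc_spectrum (h_coupled L J lam kS nul nur kap N))
    (f : R -> R[i])
    (hf : cintegrable (@lebesgue_measure R) f) :
  (cintegral (@lebesgue_measure R)
     (fun E => (transmittance L J lam kS nul nur kap N E)%:C * f E) : cplx R)
    @[N --> \oo]
  --> (cintegral (@lebesgue_measure R)
     (fun E => (crystal_transmittance L J lam kS nul nur kap E)%:C * f E)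
     : cplx R).
Proof.
have [ir ii] := hf.
have ReZ (c : R) (z : R[i]) : complex.Re (c%:C * z) = c * complex.Re z.
  by rewrite ReM ReC ImC mul0r subr0.
have ImZ (c : R) (z : R[i]) : complex.Im (c%:C * z) = c * complex.Im z.
  by rewrite ImM ReC ImC mul0r addr0.
apply: cvg_ReIm; rewrite /cintegral /=.
  under eq_fun do under eq_Rintegral do rewrite ReZ.
  under eq_Rintegral do rewrite ReZ.
  exact: transmittance_limit.
under eq_fun do under eq_Rintegral do rewrite ImZ.
under eq_Rintegral do rewrite ImZ.
exact: transmittance_limit.
Qed.
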